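(* Let $G$ and $H$ be countable sofic groups with sofic approximations $\Sigma=(\sigma_n:G\to\mathrm{Sym}(V_n))_{n\ge1}$ and $\mathrm{T}=(\tau_n:H\to\mathrm{Sym}(W_n))_{n\ge1}$ respectively. Let $(\mathcal{X}^G,\mu,S,d)$ be a metric $G$-process and let $\mathfrak{P}$ be a family of finite Borel partitions of $\mathcal{X}$ such that (Pi) for every $\delta>0$ there exists $\mathcal{P}\in\mathfrak{P}$ all of whose cells have $d$-diameter less than $\delta$, and (Pii) every cell $C$ of every $\mathcal{P}\in\mathfrak{P}$ satisfies $\mu\{x\in\mathcal{X}^G:x_e\in\partial C\}=0$, where $e$ is the identity of $G$. If $H$ is infinite, then $$\mathrm{h}_{\Sigma\times\mathrm{T}}(\mu^{\times H})=\mathrm{h}^{\mathrm{m}}_{\Sigma\times\mathrm{T}}(\mu^{\times H})=\widetilde{\mathrm{h}}_\Sigma(\mu).$$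
   Context: A sofic approximation to $G$ is a sequence of maps $\sigma_n:G\to\mathrm{Sym}(V_n)$, $g\mapsto\sigma_n^g$, with $V_n$ finite nonempty sets, such that $|\{v\in V_n:\sigma_n^g(\sigma_n^h(v))=\sigma_n^{gh}(v)\}|=(1-o(1))|V_n|$ for all $g,h\in G$ and $|\{v\in V_n:\sigma_n^g(v)\ne v\}|=(1-o(1))|V_n|$ for all $g\in G\setminus\{e\}$. The product sofic approximation $\Sigma\times\mathrm{T}$ to $G\times H$ consists of the maps $\sigma_n\times\tau_n:G\times H\to\mathrm{Sym}(V_n\times W_n)$, $(g,h)\mapsto\sigma_n^g\times\tau_n^h$. A metric $G$-process $(\mathcal{X}^G,\mu,S,d)$ consists of a standard measurable space $\mathcal{X}$, a compact metric $d$ on $\mathcal{X}$ whose Borel sets are the measurable sets of $\mathcal{X}$, the left coordinate-shift action $S$ of $G$ on $\mathcal{X}^G$ (with the convention $(S^gx)_h=x_{hg}$, compatible with the pullback names below), and an $S$-invariant Borel probability measure $\mu$ on $\mathcal{X}^G$. Its co-induction to $G\times H$ is the metric $(G\times H)$-process $(\mathcal{X}^{G\times H},\mu^{\times H},S,d)$, where $\mathcal{X}^{G\times H}=(\mathcal{X}^G)^H$ and $S$ again denotes the coordinate-shift action. $\mathrm{Prob}(Y)$ denotes the Borel probability measures on $Y$; $\mathrm{Prob}(\mathcal{X}^G)$ carries the weak$^\ast$ topology coming from the product topology on $\mathcal{X}^G$. The following definitions are given for $(G,\Sigma)$ and apply verbatim to $(G\times H,\Sigma\times\mathrm{T})$.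 For $\mathbf{x}\in\mathcal{X}^{V_n}$ and $v\in V_n$ the pullback name is $\Pi^{\sigma_n}_v(\mathbf{x})=(x_{\sigma_n^g(v)})_{g\in G}\in\mathcal{X}^G$, and the empirical distribution is $P^{\sigma_n}_{\mathbf{x}}=\frac{1}{|V_n|}\sum_{v\in V_n}\delta_{\Pi_v^{\sigma_n}(\mathbf{x})}$. For $U\subseteq\mathrm{Prob}(\mathcal{X}^G)$ let $\Omega(U,\sigma_n)=\{\mathbf{x}\in\mathcal{X}^{V_n}:P^{\sigma_n}_{\mathbf{x}}\in U\}$. For $\mu_n\in\mathrm{Prob}(\mathcal{X}^{V_n})$: local weak$^\ast$ convergence $\mu_n\stackrel{\mathrm{lw}\ast}{\longrightarrow}\mu$ over $\Sigma$ means $|\{v\in V_n:(\Pi_v^{\sigma_n})_\ast\mu_n\in U\}|=(1-o(1))|V_n|$ for every weak$^\ast$ neighbourhood $U$ of $\mu$. LE-convergence $\mu_n\stackrel{\mathrm{le}}{\longrightarrow}\mu$ means $\mu_n\stackrel{\mathrm{lw}\ast}{\longrightarrow}\mu$ and $\mu_n(\Omega(U,\sigma_n))\to1$ for every weak$^\ast$ neighbourhood $U$ of $\mu$. LDE convergence $\mu_n\stackrel{\mathrm{lde}}{\longrightarrow}\mu$ means $\mu_n\times\mu_n\stackrel{\mathrm{le}}{\longrightarrow}\mu\times\mu$ over $\Sigma$, where $\mathcal{X}^{V_n}\times\mathcal{X}^{V_n}=(\mathcal{X}\times\mathcal{X})^{V_n}$ and $\mathcal{X}^G\times\mathcal{X}^G=(\mathcal{X}\times\mathcal{X})^G$.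 The same definitions apply to $\mu_i\in\mathrm{Prob}(\mathcal{X}^{V_{n_i}})$ over a subsequence $(\sigma_{n_i})_{i\ge1}$, $n_1<n_2<\cdots$. On $\mathcal{X}^{V}$, $V$ finite, $d^{(V)}(\mathbf{x},\mathbf{y})=\frac{1}{|V|}\sum_{v\in V}d(x_v,y_v)$. For $F\subseteq\mathcal{X}^V$, $\mathrm{cov}_\delta(F,d^{(V)})$ is the least number of $\delta$-balls in $d^{(V)}$ needed to cover $F$; for $\nu\in\mathrm{Prob}(\mathcal{X}^V)$, $\mathrm{cov}_{\varepsilon,\delta}(\nu,d^{(V)})$ is the least number of $\delta$-balls in $d^{(V)}$ whose union has $\nu$-measure more than $1-\varepsilon$. The sofic entropy is $$\mathrm{h}_\Sigma(\mu)=\sup_{\delta>0}\inf_U\limsup_{n\to\infty}\frac{1}{|V_n|}\log\mathrm{cov}_\delta(\Omega(U,\sigma_n),d^{(V_n)}),$$ with $U$ ranging over weak$^\ast$ neighbourhoods of $\mu$. The model-measure sofic entropy is $$\mathrm{h}^{\mathrm{m}}_\Sigma(\mu)=\sup\Big\{\sup_{\delta,\varepsilon>0}\limsup_{i\to\infty}\frac{1}{|V_{n_i}|}\log\mathrm{cov}_{\varepsilon,\delta}(\mu_i,d^{(V_{n_i})}):\ n_i\uparrow\infty,\ \mu_i\stackrel{\mathrm{lde}}{\longrightarrow}\mu\ \text{over}\ (\sigma_{n_i})_{i\ge1}\Big\}.$$ Finally, $$\widetilde{\mathrm{h}}_\Sigma(\mu)=\sup\Big\{\limsup_{i\to\infty}\frac{1}{|V_{n_i}|}\mathrm{H}_{\mu_i}(\mathcal{P}^{V_{n_i}}):\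 \mathcal{P}\in\mathfrak{P},\ n_i\uparrow\infty,\ \mu_i\stackrel{\mathrm{lw}\ast}{\longrightarrow}\mu\ \text{over}\ (\sigma_{n_i})_{i\ge1}\Big\},$$ where $\mathcal{P}^{V}$ is the partition of $\mathcal{X}^{V}$ into products of cells of $\mathcal{P}$ and $\mathrm{H}_\nu(\mathcal{R})=-\sum_{C\in\mathcal{R}}\nu(C)\log\nu(C)$. Conventions: $\sup\emptyset=-\infty$, $\log0=-\infty$. *)

(* Defs.v *)
From HB Require Import structures.
From mathcomp Require Import all_boot all_order all_algebra perm finmap.
From mathcomp Require Import all_classical all_reals all_analysis.

Set Implicit Arguments.
Unset Strict Implicit.
Unset Printing Implicit Defensive.

Import Order.TTheory GRing.Theory Num.Theory.
Import numFieldNormedType.Exports numFieldTopology.Exports.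

Local Open Scope classical_set_scope.
Local Open Scope ring_scope.

#[short(type="countGroupType")]
HB.structure Definition CountGroup := {G of Countable G & Group G}.

HB.instance Definition _ (G H : countGroupType) := Group.on (G * H)%type.

HB.mixin Record isCompactSpace T & Topological T := {
  compact_setT : compact [set: T] }.

(* The measurable sets of X are its Borel sets (see borel below), so X is a
   standard measurable space. The base point only records that X is nonempty,
   as it must be for its powers to carry probability measures. *)
#[short(type="compactMetricType")]
HB.structure Definition CompactMetric (R : numDomainType) :=
  {X of Metric R X & isCompactSpace X & Pointed X}.

HB.instance Definition _ (I : Type) (T : I -> ptopologicalType) :=
  Pointed.copy (prod_topology T) (forall i, T i).

HB.instance Definition _ (R : realType) (I : countType)
  (T : I -> pseudoPMetricType R) := PseudoMetric.on (prod_topology T).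

HB.instance Definition _ (Y Z : ptopologicalType) := Pointed.on (Y * Z)%type.

Definition borel (Y : ptopologicalType) := g_sigma_algebraType (@open Y).

Lemma continuous_borel (Y Z : ptopologicalType) (f : Y -> Z) :
  continuous f -> measurable_fun [set: borel Y] (f : borel Y -> borel Z).
Proof.
move=> cf; apply: (@measurability _ _ (borel Y) (borel Z) setT f (@open Z)) => //.
move=> _ [A oA <-]; rewrite setTI; apply: sub_sigma_algebra.
by apply: open_comp => // x _; exact: cf.
Qed.

Definition Prob (R : realType) (Y : ptopologicalType) := probability (borel Y) R.

Definition wstar_eval (R : realType) (Y : ptopologicalType) (m : Prob R Y) :
    {ptws {f : Y -> R | continuous f} -> R^o} :=
  fun f => \int[m]_x (sval f x).

(* The coarsest topology making m |-> \int f dm continuous for every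
   continuous real function f; used for compact Y only. *)
HB.instance Definition _ (R : realType) (Y : ptopologicalType) :=
  Choice.on (Prob R Y).
HB.instance Definition _ (R : realType) (Y : ptopologicalType) :=
  Topological.copy (Prob R Y) (initial_topology (@wstar_eval R Y)).

(* A map G -> Sym(V) for some finite nonempty set V; no morphism property. *)
Record symMap (G : Type) := SymMap {
  vertices : finType;
  vertices_gt0 : (0 < #|vertices|)%N;
  sym_act :> G -> {perm vertices} }.

Definition frac (R : realType) (G : Type) (s : symMap G)
    (P : pred (vertices s)) : R :=
  #|[pred v | P v]|%:R / #|vertices s|%:R.

Definition sofic_approximation (R : realType) (G : countGroupType)
    (sigma : nat -> symMap G) : Prop :=
  (forall g h : G,
     frac R (fun v => sigma n g (sigma n h v) == sigma n (g * h)%g v)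
       @[n --> \oo] --> (1 : R)) /\
  (forall g : G, g != 1%g ->
     frac R (fun v => sigma n g v != v) @[n --> \oo] --> (1 : R)).

Section product_map.
Context {G H : Type} (s : symMap G) (t : symMap H).

Definition prod_act (p : G * H) (vw : vertices s * vertices t) :=
  (s p.1 vw.1, t p.2 vw.2).

Lemma prod_act_inj p : injective (prod_act p).
Proof. by move=> [v w] [v' w'] [/perm_inj -> /perm_inj ->]. Qed.

Lemma prod_vertices_gt0 : (0 < #|{: vertices s * vertices t}|)%N.
Proof. by rewrite card_prod muln_gt0 !vertices_gt0. Qed.

Definition prod_map : symMap (G * H) :=
  SymMap prod_vertices_gt0 (fun p => perm (@prod_act_inj p)).

End product_map.

Lemma continuous_ptws (Y Z : topologicalType) (I : eqType) (f : Y -> {ptws I -> Z}) :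
  (forall i, continuous (fun y => f y i)) -> continuous f.
Proof.
move=> cf y; apply/cvg_sup => i U [_ [[A oA <-] Afy AU]].
apply: (filterS AU); apply: (cf i y); exact: open_nbhs_nbhs.
Qed.

Lemma continuous_coord (Z : topologicalType) (I : eqType) (i : I) :
  continuous (fun x : {ptws I -> Z} => x i).
Proof. exact: (@proj_continuous I (fun=> Z) i). Qed.

Section pullback.
Context {R : realType} {G : countGroupType} {X : ptopologicalType}.
Variable s : symMap G.

Definition pullback (v : vertices s) (x : borel {ptws vertices s -> X}) :
    borel {ptws G -> X} :=
  fun g => x (s g v).

Lemma measurable_pullback v : measurable_fun setT (pullback v).
Proof.
apply: (@continuous_borel {ptws vertices s -> X} {ptws G -> X}).
by apply: continuous_ptws => g; exact: continuous_coord.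
Qed.

HB.instance Definition _ v :=
  isMeasurableFun.Build _ _ _ _ (pullback v) (measurable_pullback v).

Section empirical.
Local Open Scope ereal_scope.
Variable x : {ptws vertices s -> X}.

Definition empirical (A : set (borel {ptws G -> X})) : \bar R :=
  (#|vertices s|%:R^-1)%:E * \sum_(v : vertices s) \d_(pullback v x) A.

Let empirical0 : empirical set0 = 0.
Proof. by rewrite /empirical big1 ?mule0// => v _; rewrite measure0. Qed.

Let empirical_ge0 A : 0 <= empirical A.
Proof. by rewrite /empirical mule_ge0 ?lee_fin ?invr_ge0// sume_ge0. Qed.

Let empirical_sigma_additive : semi_sigma_additive empirical.
Proof.
move=> F mF tF mUF; rewrite /empirical.
rewrite [X in X @ \oo --> _](_ : _ = (fun n => (#|vertices s|%:R^-1)%:E *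
    \sum_(0 <= i < n) \sum_(v : vertices s) \d_(pullback v x) (F i))); last first.
  apply/funext => k; rewrite ge0_sume_distrr//. by move=> i _; apply: sume_ge0 => v _; exact: measure_ge0.
apply: cvgeZl => //.
rewrite [X in _ --> X](_ : _ =
    lim ((fun n => \sum_(0 <= i < n) \sum_(v : vertices s)
      (\d_(pullback v x) (F i) : \bar R)) @ \oo)); last first.
  rewrite nneseries_sum//; apply: eq_bigr => /= v _.
  exact: measure_semi_bigcup.
apply: is_cvg_ereal_nneg_natsum => k _.
by apply: sume_ge0 => v _; exact: measure_ge0.
Qed.

HB.instance Definition _ := isMeasure.Build _ _ _ empirical
  empirical0 empirical_ge0 empirical_sigma_additive.

Let empiricalT : empirical setT = 1.
Proof.
rewrite /empirical; under eq_bigr do rewrite diracT.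
rewrite sumEFin sumr_const -EFinM mulVf// pnatr_eq0 -lt0n.
exact: vertices_gt0.
Qed.

HB.instance Definition _ := Measure_isProbability.Build _ _ _ empirical empiricalT.

End empirical.

Definition good_models (U : set (Prob R {ptws G -> X})) :
    set {ptws vertices s -> X} :=
  [set x | U (empirical x)].

End pullback.
Arguments good_models {R G X} s U.

Section convergence.
Context {R : realType} {G : countGroupType} {X : ptopologicalType}.
Variables (sigma : nat -> symMap G).
Variables (mu_ : forall n, Prob R {ptws vertices (sigma n) -> X}).
Variable mu : Prob R {ptws G -> X}.

Definition lwstar_cvg : Prop :=
  forall U : set (Prob R {ptws G -> X}), open_nbhs mu U ->
    frac R (fun v => `[< U (distribution (mu_ n) (pullback v)) >])
      @[n --> \oo] --> (1 : R).

(* Restricting to open neighbourhoods U makes the events below Borel. *)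
Definition le_cvg : Prop :=
  lwstar_cvg /\
  forall U : set (Prob R {ptws G -> X}), open_nbhs mu U ->
    mu_ n (good_models (sigma n) U) @[n --> \oo] --> (1%:E : \bar R).

End convergence.

Section square.
Context {R : realType} {I : countType} {X : compactMetricType R}.
Local Notation XI := ({ptws I -> X}).

Definition zip_config (p : borel XI * borel XI) : borel {ptws I -> (X * X)%type} :=
  fun i => (p.1 i, p.2 i).

Lemma second_countable_config : @second_countable XI.
Proof.
apply: (@compact_second_countable R XI).
have := @tychonoff I (fun=> X) (fun=> setT) (fun=> compact_setT).
by congr compact; apply/seteqP; split.
Qed.

Lemma open_measurable_square (O : set (XI * XI)) :
  open O -> measurable (O : set (borel XI * borel XI)).
Proof.
move=> oO; have [B cB [oB bB]] := second_countable_config.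
pose D := [set bc : set XI * set XI | [/\ B bc.1, B bc.2 & bc.1 `*` bc.2 `<=` O]].
have -> : O = \bigcup_(bc in D) (bc.1 `*` bc.2).
  apply/seteqP; split=> [[x y] Oxy|z [bc [_ _ +] bcz]]; last exact.
  move: oO; rewrite openE => /(_ _ Oxy) [[P Q]/= [Px Qy] PQO].
  have [U [BU Ux] UP] := bB x P Px.
  have [W [BW Wy] WQ] := bB y Q Qy.
  exists (U, W) => //; split => //= -[a b] [/= Ua Wb].
  by apply: PQO; split; [exact: UP|exact: WQ].
have : countable D.
  apply: (@sub_countable _ _ _ (B `*` B)); last exact: countableX.
  by apply: subset_card_le => bc [].
case/pfcard_geP => [->|[f]]; first by rewrite bigcup_set0.
have -> : \bigcup_(bc in D) (bc.1 `*` bc.2) = \bigcup_n ((f n).1 `*` (f n).2).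
  apply/seteqP; split=> z [].
    by move=> bc Dbc; have [n _ <-] := 'surj_f Dbc; exists n.
  by move=> n _; exists (f n) => //; exact: 'funS_f.
apply: bigcupT_measurable => n.
have [B1 B2 _] : D (f n) by exact: 'funS_f.
by apply: measurableX; apply: sub_sigma_algebra; exact: oB.
Qed.

Lemma measurable_zip_config : measurable_fun setT zip_config.
Proof.
apply: (@measurability _ _ _ (borel {ptws I -> (X * X)%type}) setT _ open) => //.
move=> _ [A oA <-]; rewrite setTI; apply: open_measurable_square.
apply: open_comp oA => p _.
suff: continuous (zip_config : XI * XI -> {ptws I -> (X * X)%type}) by apply.
apply: continuous_ptws => i.
have c1 : continuous (fun q : XI * XI => q.1 i).
  move=> q; apply: (@continuous_comp _ _ _ fst (fun x : XI => x i)).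
    exact: cvg_fst.
  exact: continuous_coord.
have c2 : continuous (fun q : XI * XI => q.2 i).
  move=> q; apply: (@continuous_comp _ _ _ snd (fun x : XI => x i)).
    exact: cvg_snd.
  exact: continuous_coord.
by move=> q; exact: (cvg_pair (c1 q) (c2 q)).
Qed.

HB.instance Definition _ :=
  isMeasurableFun.Build _ _ _ _ zip_config measurable_zip_config.

(* The product measure m x m carried over to (X * X)^I = X^I * X^I. *)
Definition square (m : Prob R XI) : Prob R {ptws I -> (X * X)%type} :=
  distribution (m \x m)%E zip_config.

End square.

Definition lde_cvg (R : realType) (G : countGroupType) (X : compactMetricType R)
    (sigma : nat -> symMap G)
    (mu_ : forall n, Prob R {ptws vertices (sigma n) -> X})
    (mu : Prob R {ptws G -> X}) : Prop :=
  le_cvg (fun n => square (mu_ n)) (square mu).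

Section covering.
Context {R : realType} {X : compactMetricType R} {V : finType}.
Implicit Types (x y : {ptws V -> X}) (delta eps : R).

Definition mean_dist x y : R := (\sum_(v : V) mdist (x v) (y v)) / #|V|%:R.

Definition mean_ball x delta : set {ptws V -> X} := [set y | mean_dist x y < delta].

(* A number of balls, or +oo if no finite number suffices; it is 0 exactly for
   F = set0, and then its logarithm lne is -oo. *)
Definition cov delta (F : set {ptws V -> X}) : \bar R :=
  ereal_inf [set k%:R%:E | k in [set k : nat |
    exists c : 'I_k -> {ptws V -> X}, F `<=` \bigcup_i mean_ball (c i) delta]].

Definition mcov eps delta (m : Prob R {ptws V -> X}) : \bar R :=
  ereal_inf [set k%:R%:E | k in [set k : nat |
    exists c : 'I_k -> {ptws V -> X},
      ((1 - eps)%:E < m (\bigcup_i mean_ball (c i) delta))%E]].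

End covering.

Section partitions.
Context {R : realType}.

Definition finite_borel_partition (X : ptopologicalType) (P : set (set X)) : Prop :=
  [/\ finite_set P, P `<=` (@measurable _ (borel X)) & partition P id setT].

Definition power_partition (X : ptopologicalType) (V : finType) (P : set (set X)) :
    set (set {ptws V -> X}) :=
  [set [set x : {ptws V -> X} | forall v, c v (x v)] |
     c in [set c : V -> set X | forall v, P (c v)]].

(* A finite sum as soon as Q is finite; ln 0 = 0, so null cells contribute 0. *)
Definition shannon (Y : ptopologicalType) (m : Prob R Y) (Q : set (set Y)) : R :=
  - \sum_(C \in Q) fine (m C) * ln (fine (m C)).

Definition diameter (X : metricType R) (C : set X) : \bar R :=
  ereal_sup [set (mdist x y)%:E | x in C & y in C].

Definition boundary (X : topologicalType) (C : set X) : set X :=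
  closure C `\` interior C.

End partitions.
Arguments power_partition {X} V P.

Section entropies.
Context {R : realType} {G : countGroupType} {X : compactMetricType R}.
Variables (sigma : nat -> symMap G) (mu : Prob R {ptws G -> X}).
Local Open Scope ereal_scope.

Definition sofic_entropy : \bar R :=
  ereal_sup [set ereal_inf [set limn_esup (fun n =>
        (#|vertices (sigma n)|%:R^-1)%:E * lne (cov delta (good_models (sigma n) U)))
      | U in [set U : set (Prob R {ptws G -> X}) | open_nbhs mu U]]
    | delta in [set delta : R | (0 < delta)%R]].

Definition model_measure_entropy : \bar R :=
  ereal_sup [set h | exists (n_ : nat -> nat)
      (mu_ : forall i, Prob R {ptws vertices (sigma (n_ i)) -> X}),
    [/\ {homo n_ : i j / (i < j)%N},
        lde_cvg (sigma := fun i => sigma (n_ i)) mu_ mu &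
        h = ereal_sup [set limn_esup (fun i =>
            (#|vertices (sigma (n_ i))|%:R^-1)%:E * lne (mcov eps delta (mu_ i)))
          | eps in [set eps : R | (0 < eps)%R]
          & delta in [set delta : R | (0 < delta)%R]]]].

Definition partition_entropy (PP : set (set (set X))) : \bar R :=
  ereal_sup [set h | exists (P : set (set X)) (n_ : nat -> nat)
      (mu_ : forall i, Prob R {ptws vertices (sigma (n_ i)) -> X}),
    [/\ PP P, {homo n_ : i j / (i < j)%N},
        lwstar_cvg (sigma := fun i => sigma (n_ i)) mu_ mu &
        h = limn_esup (fun i =>
          (#|vertices (sigma (n_ i))|%:R^-1)%:E *
          (shannon (mu_ i) (power_partition (vertices (sigma (n_ i))) P))%:E)]].

End entropies.

Definition shift (G : countGroupType) (X : Type) (g : G) (x : {ptws G -> X}) :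
    {ptws G -> X} :=
  fun h => x (h * g)%g.

Definition shift_invariant (R : realType) (G : countGroupType)
    (X : ptopologicalType) (mu : Prob R {ptws G -> X}) : Prop :=
  forall (g : G) (A : set (borel {ptws G -> X})), measurable A ->
    mu (shift g @^-1` A) = mu A.

(* nu is the product measure mu^{x H} on X^(G x H) = (X^G)^H, which is the only
   Borel probability measure with these values on finite-dimensional cylinders. *)
Definition is_coinduction (R : realType) (G H : countGroupType)
    (X : ptopologicalType) (mu : Prob R {ptws G -> X})
    (nu : Prob R {ptws (G * H)%type -> X}) : Prop :=
  forall (F : {fset H}) (A : H -> set (borel {ptws G -> X})),
    (forall h, h \in F -> measurable (A h)) ->
    nu [set x | forall h, h \in F -> A h (fun g => x (g, h))] =
      (\prod_(h <- F) mu (A h))%E.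

(* Main.v *)
Require Import Defs.
From HB Require Import structures.
From mathcomp Require Import all_boot all_order all_algebra perm finmap.
From mathcomp Require Import all_classical all_reals all_analysis.
From mathcomp Require Import measurable_realfun ring lra.

Set Implicit Arguments.
Unset Strict Implicit.
Unset Printing Implicit Defensive.

Import Order.TTheory GRing.Theory Num.Theory.
Import numFieldNormedType.Exports numFieldTopology.Exports.

Local Open Scope classical_set_scope.
Local Open Scope ring_scope.

(** The theorem is proved by the three inequalities

      sofic(nu) <= partition(mu) <= model-measure(nu) <= sofic(nu),

    where [nu] is the co-induction of [mu], that is, the law of independent copies
    of [mu] on the slices indexed by [H].

    Sofic entropy is at most partition entropy ([sofic_le_partition]). Suppose that
    the good models for [nu] on V x W need about exp(c |V| |W|) balls. Keep one model
    for each name with respect to a partition with small cells, and choose a model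
    and a row w in W uniformly at random. The row has a law on X^V. By Gibbs'
    inequality the entropy of its name is at least c |V|, since the names of the
    models are determined by |W| rows ([ln_card_le_row_entropy]). The law is locally
    close to [mu]: permuting rows does not change the average over w, so this average
    may be computed over many slices of a single pullback name, and by the
    independence of slices under [nu] such averages are concentrated
    ([expect_slice_deviation], [average_row_deviation]). This is where [H] has to be
    infinite.

    Partition entropy is at most model-measure entropy
    ([partition_le_model_measure]). Let laws on X^V converge locally to [mu]; they
    may be taken finitely supported ([lwstar_discretize]). Put independent copies of
    them on the rows of V x W. Since the elements of [H] move most w to distinct
    places, the slices of a pullback name are independent at most vertices, and
    since |W| tends to infinity most pairs of vertices read disjoint sets of rows.
    Hence the product laws converge in the LDE sense to [nu] ([product_lde_cvg]),
    where convergence is tested on products of functions of single coordinates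
    ([mono_dense]). The names of the rows have |W| times the entropy of one row. As
    cells have null boundary, most sites are far from the boundaries of cells, so a
    small ball meets few names up to a small Hamming distance, and the law cannot be
    carried by fewer balls than its entropy requires ([entropy_le_covering]).

    Model-measure entropy is at most sofic entropy ([model_measure_le_sofic]): laws
    converging in the LDE sense are carried by good models. *)

Local Notation frac := Defs.frac.

(** * Entropy of laws on finite sets *)

Section finite_distributions.
Context {R : realType}.

Record fdist (A : finType) := FDist {
  fdist_fun :> A -> R;
  fdist_ge0 : forall a, 0 <= fdist_fun a;
  fdist_sum1 : \sum_a fdist_fun a = 1 }.

Definition entropy (A : finType) (p : A -> R) : R := - \sum_a p a * ln (p a).

Lemma ln_prod (I : finType) (f : I -> R) :
  (forall i, 0 < f i) -> ln (\prod_i f i) = \sum_i ln (f i).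
Proof.
move=> f0; suff [_ //] : 0 < \prod_i f i /\ ln (\prod_i f i) = \sum_i ln (f i).
elim/big_ind2 : _ => //=.
- by rewrite ln1.
- by move=> x u y v [x0 xu] [y0 yv]; rewrite mulr_gt0// lnM ?posrE// xu yv.
Qed.

(** The bound [ln u <= u - 1] at [u = q a / p a], averaged against [p]. *)
Lemma gibbs (A : finType) (p q : A -> R) :
  (forall a, 0 <= p a) -> \sum_a p a = 1 -> (forall a, 0 <= q a) ->
  (forall a, 0 < p a -> 0 < q a) -> \sum_a q a <= 1 ->
  entropy p <= - \sum_a p a * ln (q a).
Proof.
move=> p0 p1 q0 pq q1; rewrite /entropy lerN2 -subr_le0 -sumrB.
apply: (@le_trans _ _ (\sum_a (q a - p a))); last first.
  by rewrite sumrB p1 subr_le0.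
apply: ler_sum => a _; have := p0 a; rewrite le_eqVlt => /orP[/eqP <-|pa0].
  by rewrite !mul0r !subr0.
have qa0 := pq _ pa0.
rewrite -mulrBr -ln_div ?posrE//.
have -> : q a - p a = p a * (q a / p a - 1).
  by rewrite mulrBr mulr1 mulrCA divff ?mulr1// gt_eqF.
rewrite ler_pM2l//.
have := @le_ln1Dx R (q a / p a - 1).
rewrite (addrC 1) subrK; apply.
by rewrite ltrDr divr_gt0.
Qed.

(** Gibbs against the mixture of the uniform laws on [S] and on everything. *)
Lemma entropy_le_set (A : finType) (p : fdist A) (S : {set A}) :
  (0 < #|S|)%N ->
  entropy p <= ln 2 + ln #|S|%:R + (\sum_(a | a \notin S) p a) * ln #|A|%:R.
Proof.
move=> S0.
have A0 : (0 < #|A|)%N by apply: leq_trans S0 _; exact: max_card.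
have SR : (0 : R) < #|S|%:R by rewrite ltr0n.
have AR : (0 : R) < #|A|%:R by rewrite ltr0n.
pose q a : R := if a \in S then (2 * #|S|%:R)^-1 else (2 * #|A|%:R)^-1.
have q0 a : 0 < q a by rewrite /q; case: ifP => _; rewrite invr_gt0 mulr_gt0.
have q1 : \sum_a q a <= 1.
  rewrite (bigID (mem S))/= [leRHS](_ : _ = 2^-1 + 2^-1); last by field.
  apply: lerD.
    rewrite (eq_bigr (fun=> (2 * #|S|%:R)^-1)); last by move=> a aS; rewrite /q aS.
    rewrite sumr_const -[_ *+ _]mulr_natr invfM -mulrA mulVf ?mulr1//.
    by rewrite gt_eqF.
  rewrite (eq_bigr (fun=> (2 * #|A|%:R)^-1)); last first.
    by move=> a /negbTE aS; rewrite /q aS.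
  rewrite sumr_const -[_ *+ _]mulr_natr invfM -mulrA ler_piMr ?invr_ge0//.
  rewrite mulrC ler_pdivrMr// mul1r ler_nat.
  exact: max_card.
apply: le_trans (gibbs (fdist_ge0 p) (fdist_sum1 p) (fun a => ltW (q0 a)) (fun a _ => q0 a) q1) _.
rewrite -sumrN.
have lnq a : - (p a * ln (q a)) =
    p a * (ln 2 + (if a \in S then ln #|S|%:R else ln #|A|%:R)).
  rewrite -mulrN /q; case: ifP => _; congr (_ * _);
    by rewrite lnV ?posrE ?mulr_gt0// opprK lnM ?posrE.
rewrite (eq_bigr _ (fun a _ => lnq a)) (bigID (mem S))/=.
rewrite mulr_suml.
have -> : ln 2 + ln #|S|%:R = \sum_a p a * (ln 2 + ln #|S|%:R) :> R.
  by rewrite -mulr_suml fdist_sum1 mul1r.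
rewrite [X in _ <= X + _](bigID (mem S))/= -addrA; apply: lerD.
  by rewrite le_eqVlt; apply/orP; left; apply/eqP; apply: eq_bigr => a ->.
rewrite -big_split/=; apply: ler_sum => a /negbTE ->.
rewrite -mulrDr ler_wpM2l ?fdist_ge0// [leRHS]addrAC lerDl.
by rewrite ln_ge0// ler1n.
Qed.

Section power.
Variables (W A : finType) (p : fdist A).

Definition pow_fun (a : {ffun W -> A}) : R := \prod_w p (a w).

(** Independence of the coordinates, in the form of the distributivity of a
    product over sums. *)
Lemma expect_prod (f : W -> A -> R) :
  \sum_a pow_fun a * \prod_w f w (a w) = \prod_w \sum_b p b * f w b.
Proof.
rewrite bigA_distr_bigA/=; apply: eq_bigr => a _.
by rewrite -big_split.
Qed.

Lemma pow_fun_ge0 a : 0 <= pow_fun a.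
Proof. by apply: prodr_ge0 => w _; exact: fdist_ge0. Qed.

Lemma pow_fun_sum1 : \sum_a pow_fun a = 1.
Proof.
rewrite /pow_fun -(bigA_distr_bigA (fun (_ : W) b => p b)) big1// => w _.
exact: fdist_sum1.
Qed.

Definition fdist_pow := FDist pow_fun_ge0 pow_fun_sum1.

Lemma expect_coord (w : W) (g : A -> R) :
  \sum_a pow_fun a * g (a w) = \sum_b p b * g b.
Proof.
have := expect_prod (fun w' b => if w' == w then g b else 1).
rewrite (bigD1 w)//= eqxx [X in _ * X]big1 => [|w' /negbTE w'w]; last first.
  by rewrite w'w; under eq_bigr do rewrite mulr1; exact: fdist_sum1.
rewrite mulr1 => <-; apply: eq_bigr => a _; congr (_ * _).
rewrite (bigD1 w)//= eqxx big1 ?mulr1// => w' /negbTE w'w.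
by rewrite w'w.
Qed.

(** The logarithm of the density of a power is a sum over the coordinates, each of
    which has law [p]. *)
Lemma entropy_pow : entropy fdist_pow = #|W|%:R * entropy p.
Proof.
rewrite /entropy mulrN; congr (- _).
have lnpow a : pow_fun a * ln (pow_fun a) = \sum_w pow_fun a * ln (p (a w)).
  have [a0|an0] := eqVneq (pow_fun a) 0.
    by rewrite a0 mul0r big1// => w _; rewrite mul0r.
  rewrite -mulr_sumr; congr (_ * _); rewrite /pow_fun.
  have pa w : 0 < p (a w).
    rewrite lt0r fdist_ge0 andbT; apply: contra_neq an0 => pw.
    by rewrite /pow_fun (bigD1 w)//= pw mul0r.
  by rewrite ln_prod.
rewrite (eq_bigr _ (fun a _ => lnpow a)) exchange_big/=.
rewrite (eq_bigr (fun=> \sum_b p b * ln (p b))); last first.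
  by move=> w _; rewrite (expect_coord w (fun b => ln (p b))).
by rewrite sumr_const mulr_natl.
Qed.

End power.

Section image.
Variables (A B : finType) (p : fdist A) (f : A -> B).

Definition image_fun (b : B) : R := \sum_(a | f a == b) p a.

Lemma expect_image (F : B -> R) :
  \sum_b image_fun b * F b = \sum_a p a * F (f a).
Proof.
rewrite [RHS](partition_big f xpredT)//=; apply: eq_bigr => b _.
by rewrite mulr_suml; apply: eq_bigr => a /eqP ->.
Qed.

Lemma image_fun_ge0 b : 0 <= image_fun b.
Proof. by apply: sumr_ge0 => a _; exact: fdist_ge0. Qed.

Lemma image_fun_sum1 : \sum_b image_fun b = 1.
Proof.
have := expect_image (fun=> 1); under eq_bigr do rewrite mulr1.
by move=> ->; under eq_bigr do rewrite mulr1; exact: fdist_sum1.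
Qed.

Definition fdist_image := FDist image_fun_ge0 image_fun_sum1.

End image.

(** Applying [f] at each coordinate of an independent family gives an independent
    family. *)
Lemma expect_pow_image (W A B : finType) (p : fdist A) (f : A -> B)
    (F : {ffun W -> B} -> R) :
  \sum_b pow_fun (fdist_image p f) b * F b =
  \sum_a pow_fun p a * F [ffun w => f (a w)].
Proof.
rewrite [RHS](partition_big (fun a : {ffun W -> A} => [ffun w => f (a w)]) xpredT)//=.
apply: eq_bigr => b _.
rewrite [RHS](eq_bigr (fun a : {ffun W -> A} => pow_fun p a * F b)); last first.
  by move=> a /eqP ->.
rewrite -mulr_suml; congr (_ * _).
rewrite [LHS]/pow_fun/= /image_fun.
rewrite (eq_bigr (fun w => \sum_a p a * (f a == b w)%:R)); last first.
  move=> w _; rewrite big_mkcond/=; apply: eq_bigr => a _.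
  by case: ifP => _; rewrite ?mulr1// mulr0.
rewrite -(expect_prod p (fun w a => (f a == b w)%:R)) [RHS]big_mkcond/=.
apply: eq_bigr => a _; case: eqVneq => [<-|/eqP fab].
  by rewrite big1 ?mulr1// => w _; rewrite ffunE eqxx.
have [w wP] : exists w, f (a w) != b w.
  apply: contrapT => /forallNP h; apply: fab; apply/ffunP => w; rewrite ffunE.
  by apply/eqP; move: (h w); move/negP; rewrite negbK.
by rewrite (bigD1 w)//= (negbTE wP) mul0r mulr0.
Qed.

Lemma markov_fdist (A : finType) (p : fdist A) (f : A -> R) (e : R) :
  0 < e -> (forall a, 0 <= f a) ->
  \sum_(a | e <= f a) p a <= (\sum_a p a * f a) / e.
Proof.
move=> e0 f0; rewrite ler_pdivlMr// mulr_suml.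
rewrite [leRHS](bigID (fun a => e <= f a))/= -[leLHS]addr0; apply: lerD.
  by apply: ler_sum => a ea; rewrite ler_wpM2l ?fdist_ge0.
by apply: sumr_ge0 => a _; rewrite mulr_ge0 ?fdist_ge0.
Qed.

End finite_distributions.
Arguments fdist R A : clear implicits.

Section hamming.
Context {R : realType}.
Variables (V W : finType) (K : nat).
Local Notation names := {ffun W -> {ffun V -> 'I_K}}.

Definition hamming (n n' : names) : nat := \sum_w \sum_v (n w v != n' w v).

Let sum_letter (j : 'I_K) (s : R) : 0 <= s ->
  \sum_(l < K) (if l == j then 1 else s) <= 1 + K%:R * s.
Proof.
move=> s0; rewrite (bigD1 j)//= eqxx lerD2l.
rewrite (eq_bigr (fun=> s)) => [|l /negbTE ->//].
rewrite sumr_const -[X in X <= _]mulr_natl ler_wpM2r// ler_nat.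
by rewrite (leq_trans (max_card _))// card_ord.
Qed.

(** The exponential moment method: the sum of [expR (- t * hamming n n')] over
    all names factors over the sites. *)
Lemma card_hamming_ball (n' : names) (kappa t : R) : 0 <= t ->
  #|[set n : names | (hamming n n')%:R <= kappa * (#|V| * #|W|)%:R :> R]%SET|%:R
  <= expR ((#|V| * #|W|)%:R * (t * kappa + K%:R * expR (- t))).
Proof.
move=> t0; set N := (#|V| * #|W|)%N; set B := [set n : names | _]%SET.
have expE (n : names) : expR (- (t * (hamming n n')%:R)) =
    \prod_w \prod_v (if n w v == n' w v then 1 else expR (- t)) :> R.
  rewrite /hamming natr_sum mulr_sumr -sumrN expR_sum.
  apply: eq_bigr => w _; rewrite natr_sum mulr_sumr -sumrN expR_sum.
  apply: eq_bigr => v _; case: eqVneq => _; first by rewrite mulr0 oppr0 expR0.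
  by rewrite mulr1.
have total : \sum_(n : names) expR (- (t * (hamming n n')%:R)) <=
    expR (N%:R * (K%:R * expR (- t))) :> R.
  under eq_bigr do rewrite expE.
  rewrite -(bigA_distr_bigA (fun w (b : {ffun V -> 'I_K}) =>
    \prod_v (if b v == n' w v then 1 else expR (- t) : R))).
  have -> : expR (N%:R * (K%:R * expR (- t))) =
      \prod_(w : W) \prod_(v : V) expR (K%:R * expR (- t)) :> R.
    by rewrite !prodr_const -exprM expRM_natl.
  apply: ler_prod => w _; apply/andP; split.
    by apply: sumr_ge0 => b _; apply: prodr_ge0 => v _; case: ifP => // _; exact: expR_ge0.
  rewrite -(bigA_distr_bigA (fun v (l : 'I_K) =>
     if l == n' w v then 1 else expR (- t) : R)).
  apply: ler_prod => v _; apply/andP; split.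
    by apply: sumr_ge0 => l _; case: ifP => // _; exact: expR_ge0.
  apply: le_trans (sum_letter _ (expR_ge0 _)) _; exact: expR_ge1Dx.
rewrite mulrDr expRD.
have -> : #|B|%:R = \sum_(n in B) (1 : R) by rewrite sumr_const.
apply: le_trans (_ : \sum_(n in B) (expR (N%:R * (t * kappa)) *
    expR (- (t * (hamming n n')%:R))) <= _).
  apply: ler_sum => n; rewrite inE => nB.
  rewrite -expRD -[leLHS]expR0 ler_expR subr_ge0 mulrCA ler_wpM2l//.
  by rewrite mulrC.
rewrite -mulr_sumr ler_wpM2l ?expR_ge0//.
apply: le_trans total; rewrite [leRHS](bigID (mem B))/= lerDl.
by apply: sumr_ge0 => n _; exact: expR_ge0.
Qed.

End hamming.

(** * Test functions on powers of a compact metric space *)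

Section continuous_real.
Context {R : realType} {T : topologicalType}.
Implicit Types f g : T -> R.

Lemma continuousD' f g : continuous f -> continuous g -> continuous (fun x => f x + g x).
Proof. by move=> cf cg x; apply: cvgD; [exact: cf|exact: cg]. Qed.

Lemma continuousM' f g : continuous f -> continuous g -> continuous (fun x => f x * g x).
Proof. by move=> cf cg x; apply: cvgM; [exact: cf|exact: cg]. Qed.

Lemma continuous_sum' (I : Type) (r : seq I) (f : I -> T -> R) :
  (forall i, continuous (f i)) -> continuous (fun x => \sum_(i <- r) f i x).
Proof.
move=> cf; elim: r => [|i r ih].
  by under [X in continuous X]eq_fun do rewrite big_nil; exact: cst_continuous.
under [X in continuous X]eq_fun do rewrite big_cons.
exact: continuousD'.
Qed.

Lemma continuous_prod' (I : Type) (r : seq I) (f : I -> T -> R) :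
  (forall i, continuous (f i)) -> continuous (fun x => \prod_(i <- r) f i x).
Proof.
move=> cf; elim: r => [|i r ih].
  by under [X in continuous X]eq_fun do rewrite big_nil; exact: cst_continuous.
under [X in continuous X]eq_fun do rewrite big_cons.
exact: continuousM'.
Qed.

End continuous_real.

Section metric_functions.
Context {R : realType} {X : metricType R}.

Lemma lipschitz1_continuous (f : X -> R) :
  (forall x y, f x <= f y + mdist x y) -> continuous f.
Proof.
move=> fl x; apply/cvgrPdist_lt => e e0.
have : \forall y \near x, mdist x y < e by apply/metricType_numDomainType.nbhs_mdistP; exists e.
apply: filterS => y xy.
rewrite ltr_norml; apply/andP; split.
  by have := fl y x; rewrite metric_sym; lra.
by have := fl x y; lra.
Qed.

Lemma mdist_continuous (c : X) : continuous (fun x => mdist x c).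
Proof.
apply: lipschitz1_continuous => x y.
by rewrite addrC metric_triangle.
Qed.

End metric_functions.

Lemma compact_ptws (R : realType) (J : eqType) (X : compactMetricType R) :
  compact [set: {ptws J -> X}].
Proof.
have := @tychonoff J (fun=> X) (fun=> setT) (fun=> compact_setT).
by congr compact; apply/seteqP; split.
Qed.

Section cylinder_topology.
Context {R : realType} {J : eqType} {X : metricType R}.
Local Notation XJ := {ptws J -> X}.

Definition close_on (E : seq J) (r : R) (u u' : XJ) : Prop :=
  forall e, e \in E -> mdist (u e) (u' e) < r.

Lemma nbhs_close_on (u : XJ) (E : seq J) (r : R) : 0 < r ->
  nbhs u [set u' | close_on E r u u'].
Proof.
move=> r0; elim: E => [|e E ih].
  by apply: (@filterS _ (nbhs u) _ setT) => [u' _ e|]; [|exact: filterT].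
have he : nbhs u [set u' | mdist (u e) (u' e) < r].
  apply: (@continuous_coord X J e u [set y | mdist (u e) y < r]).
  by apply/metricType_numDomainType.nbhs_mdistP; exists r.
have FF : Filter (nbhs u) by exact: nbhs_filter.
have h := @filterI _ (nbhs u) FF _ _ he ih.
apply: (@filterS _ (nbhs u) FF _ _ _ h) => u' [h1 h2] e'.
by rewrite inE => /orP[/eqP ->//|e'E]; exact: h2.
Qed.

Lemma nbhs_cylinder (u : XJ) (A : set XJ) : nbhs u A ->
  exists E r, 0 < r /\ forall u', close_on E r u u' -> A u'.
Proof.
pose F := filter_from [set Er : seq J * R | 0 < Er.2]
  (fun Er => [set u' | close_on Er.1 Er.2 u u']).
have FF : Filter F.
  apply: filter_from_filter; first by exists ([::], 1) => /=.
  move=> [E r] [E' r'] /= r0 r'0.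
  exists (E ++ E', Num.min r r') => /=; first by rewrite lt_min r0.
  move=> u' h; split=> e eE.
    by have := h e; rewrite mem_cat eE lt_min => /(_ isT) /andP[].
  by have := h e; rewrite mem_cat eE orbT lt_min => /(_ isT) /andP[].
have : F --> u.
  apply/cvg_sup => i U [_ [[B oB <-] Bu BU]].
  have : nbhs (u i) B by exact: open_nbhs_nbhs.
  move=> /metricType_numDomainType.nbhs_mdistP [r /= r0 rB].
  exists ([:: i], r) => //= u' h; apply: BU; apply: rB => /=.
  by apply: h; rewrite inE.
by move=> /[apply] -[[E r] /= r0 h]; exists E, r.
Qed.

End cylinder_topology.

(** Uniform continuity for the product topology, which need not be metrizable
    here: closeness is measured on finitely many coordinates. *)
Lemma uniform_cylinder (R : realType) (J : eqType) (X : compactMetricType R)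
    (f : {ptws J -> X} -> R) (eps : R) : continuous f -> 0 < eps ->
  exists E r, 0 < r /\ forall u u', close_on E r u u' -> `|f u - f u'| < eps.
Proof.
move=> cf e0.
(* The filter of larger sets of coordinates and smaller radii: along it the
   modulus of continuity holds near each point, hence uniformly by compactness. *)
pose F := filter_from [set Er : seq J * R | 0 < Er.2]
  (fun Er => [set Er' : seq J * R | {subset Er.1 <= Er'.1} /\ 0 < Er'.2 <= Er.2]).
have FF : ProperFilter F.
  apply: filter_from_proper; last by move=> [E r] /= r0; exists (E, r); split => //=; rewrite r0 lexx.
  apply: filter_from_filter; first by exists ([::], 1) => /=.
  move=> [E r] [E' r'] /= r0 r'0.
  exists (E ++ E', Num.min r r') => /=; first by rewrite lt_min r0.
  move=> [E2 r2]/= [sub /andP[r20]]; rewrite le_min => /andP[h1 h2].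
  by split; split; rewrite ?r20 ?h1 ?h2// => e eE; apply: sub; rewrite mem_cat eE ?orbT.
have /compact_near_coveringP := @compact_ptws R J X.
move=> /(_ _ F (fun Er u => forall u', close_on Er.1 Er.2 u u' -> `|f u - f u'| < eps)).
have key : forall u : {ptws J -> X}, setT u -> \forall u' \near u & Er \near F,
    forall u'', close_on Er.1 Er.2 u' u'' -> `|f u' - f u''| < eps.
  move=> u _.
  have : nbhs u [set u' | `|f u - f u'| < eps / 2].
    by have /cvgrPdist_lt := cf u; apply; rewrite divr_gt0.
  move=> /nbhs_cylinder [E [r [r0 h]]].
  have r20 : 0 < r / 2 by rewrite divr_gt0.
  exists ([set u' | close_on E (r / 2) u u'],
          [set Er' : seq J * R | {subset E <= Er'.1} /\ 0 < Er'.2 <= r / 2]).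
    split => /=; first exact: nbhs_close_on.
    by exists (E, r / 2).
  move=> [u' [E' r']] /= [h1 [h2 /andP[h3 h4]]] u'' h5.
  have a1 : `|f u - f u'| < eps / 2.
    by apply: h => e eE; have := h1 e eE; lra.
  have a2 : `|f u - f u''| < eps / 2.
    apply: h => e eE; have := h1 e eE; have := h5 e (h2 e eE).
    by have := metric_triangle (u e) (u' e) (u'' e); lra.
  have -> : f u' - f u'' = (f u - f u'') - (f u - f u') by ring.
  by apply: (le_lt_trans (ler_normB _ _)); lra.
move=> /(_ _ key) h.
have pos : F [set Er | 0 < Er.2].
  by exists ([::], 1) => //= -[E r] /= [_ /andP[]].
have [[E r] [/= hEr r0]] := filter_ex (filterI h pos).
by exists E, r; split => // u u'; exact: hEr.
Qed.

Section partition_of_unity.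
Context {R : realType} {X : compactMetricType R}.

Lemma finite_net (r : R) : 0 < r ->
  exists s : seq X, forall x, exists2 c, c \in s & mdist x c < r.
Proof.
move=> r0.
pose F := filter_from setT (fun s : seq X => [set s' : seq X | {subset s <= s'}]).
have FF : ProperFilter F.
  apply: filter_from_proper; last by move=> s _; exists s.
  apply: filter_from_filter; first by exists [::].
  move=> s s' _ _; exists (s ++ s') => // t st.
  by split => e es; apply: st; rewrite mem_cat es ?orbT.
have /compact_near_coveringP := @compact_setT R X.
move=> /(_ _ F (fun s x => exists2 c, c \in s & mdist x c < r)) [].
  move=> x _; exists ([set x' | mdist x x' < r], [set s : seq X | {subset [:: x] <= s}]).
    split => /=; last by exists [:: x].
    by apply/metricType_numDomainType.nbhs_mdistP; exists r.
  move=> [x' s]/= [h1 h2]; exists x; first by apply: h2; rewrite inE.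
  by rewrite metric_sym.
by move=> s _ /(_ s (fun _ => id)) h; exists s => x; exact: h.
Qed.

(** The tents [1 / k.+1 - d(x, c)] around the points of a finite net, normalized by
    their sum; the functions [phi (k, j)] with [N k <= j] are zero. *)
Lemma partition_of_unity :
  exists (phi : nat * nat -> X -> R) (N : nat -> nat) (c : nat -> nat -> X),
  [/\ forall i, continuous (phi i), forall i x, 0 <= phi i x <= 1,
      forall k x, \sum_(j < N k) phi (k, val j) x = 1 &
      forall k j x, phi (k, j) x != 0 -> mdist x (c k j) < k.+1%:R^-1].
Proof.
have net k : {s : seq X | forall x, exists2 c, c \in s & mdist x c < k.+1%:R^-1 :> R}.
  by apply: cid; apply: finite_net; rewrite invr_gt0.
pose N k := size (sval (net k)).
pose c k j := nth point (sval (net k)) j.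
pose theta k j x : R := Num.max 0 (k.+1%:R^-1 - mdist x (c k j)).
pose S k x : R := \sum_(j < N k) theta k j x.
pose phi (i : nat * nat) x : R :=
  if (i.2 < N i.1)%N then theta i.1 i.2 x / S i.1 x else 0.
have theta0 k j x : 0 <= theta k j x by rewrite /theta le_max lexx.
have S0 k x : 0 < S k x.
  have [y /(nthP point)[j jN <-] jx] := svalP (net k) x.
  rewrite /S (bigD1 (Ordinal jN))//= ltr_pwDl//; last by apply: sumr_ge0.
  by rewrite /theta lt_max subr_gt0 /c jx orbT.
have ctheta k j : continuous (theta k j).
  move=> x; apply: (@continuous_max R X (fun=> 0) (fun x => k.+1%:R^-1 - mdist x (c k j))).
    exact: cst_continuous.
  apply: cvgB; first exact: cvg_cst.
  exact: mdist_continuous.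
have cS k : continuous (S k).
  by apply: continuous_sum' => j.
exists phi, N, c; split.
- move=> [k j]; have [jN|jN] := boolP (j < N k)%N; last first.
    rewrite (_ : phi _ = fun=> 0); first exact: cst_continuous.
    by apply/funext => x; rewrite /phi/= (negbTE jN).
  rewrite (_ : phi _ = fun x => theta k j x / S k x); last first.
    by apply/funext => x; rewrite /phi/= jN.
  move=> x; apply: cvgM; first exact: ctheta.
  by apply: cvgV; [rewrite gt_eqF|exact: cS].
- move=> [k j] x; rewrite /phi/=; case: ifP => [jN|_]; last by rewrite lexx; exact: ler01.
  rewrite divr_ge0//=; last exact/ltW.
  rewrite ler_pdivrMr// mul1r /S.
  by rewrite (bigD1 (Ordinal jN))//= lerDl sumr_ge0.
- move=> k x; under eq_bigr => j _ do rewrite /phi/= ltn_ord.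
  rewrite -mulr_suml -/(S k x) divff//.
  by rewrite gt_eqF.
- move=> k j x; rewrite /phi/=; case: ifP => _; last by rewrite eqxx.
  rewrite mulf_eq0 negb_or => /andP[].
  rewrite /theta; have [_|] := leP (k.+1%:R^-1 - mdist x (c k j)) 0.
    by rewrite eqxx.
  by rewrite subr_gt0.
Qed.

End partition_of_unity.

Section monomials.
Context {R : realType} {X : compactMetricType R}.
Variable phi : nat * nat -> X -> R.

(** The list [t] consists of pairs of a coordinate and the index of a function of
    the family [phi], to be evaluated at that coordinate. *)
Definition mono (J : Type) (t : seq (J * (nat * nat))) (u : {ptws J -> X}) : R :=
  \prod_(e <- t) phi e.2 (u e.1).

Hypothesis cphi : forall i, continuous (phi i).
Hypothesis phi01 : forall i x, 0 <= phi i x <= 1.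

Lemma mono_continuous (J : eqType) t : continuous (@mono J t).
Proof.
apply: continuous_prod' => -[j i] u /=.
apply: (@continuous_comp _ _ _ (fun u : {ptws J -> X} => u j) (phi i)).
  exact: continuous_coord.
exact: cphi.
Qed.

Lemma mono01 (J : Type) t (u : {ptws J -> X}) : 0 <= mono t u <= 1.
Proof.
rewrite /mono; elim/big_ind : _ => [|x y /andP[x0 x1] /andP[y0 y1]|e _] //.
  by rewrite ler01 lexx.
by rewrite mulr_ge0//= -[leRHS]mulr1 ler_pM.
Qed.

End monomials.

(** A continuous [f] is uniformly close to a function of finitely many
    coordinates. Products of partitions of unity over these coordinates sum to 1,
    and interpolate the values of [f] at tuples of points of a finite net. *)
Lemma mono_dense (R : realType) (X : compactMetricType R) :
  exists phi : nat * nat -> X -> R,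
  [/\ forall i, continuous (phi i), forall i x, 0 <= phi i x <= 1 &
    forall (J : eqType) (f : {ptws J -> X} -> R) (eps : R),
      continuous f -> 0 < eps ->
      exists (I : finType) (a : I -> R) (t : I -> seq (J * (nat * nat))),
        forall u, `|f u - \sum_i a i * mono phi (t i) u| <= eps].
Proof.
have [phi [N [c [cphi phi01 phi1 phic]]]] := @partition_of_unity R X.
exists phi; split => // J f eps cf e0.
have [E [r [r0 fE]]] := uniform_cylinder cf e0.
pose k := Num.truncn r^-1.
have kr : k.+1%:R^-1 <= r.
  rewrite -[leRHS]invrK lef_pV2 ?posrE ?invr_gt0//.
  by rewrite ltW// truncnS_gt.
pose D := undup E.
pose xi (g : {ffun 'I_(size D) -> 'I_(N k)}) : {ptws J -> X} := fun e =>
  if insub (index e D) is Some i then c k (g i) else point.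
pose t (g : {ffun 'I_(size D) -> 'I_(N k)}) :=
  [seq (tnth (in_tuple D) i, (k, val (g i))) | i <- enum 'I_(size D)].
exists {ffun 'I_(size D) -> 'I_(N k)}, (fun g => f (xi g)), t.
move=> u.
have monoE g : mono phi (t g) u = \prod_(i < size D) phi (k, val (g i)) (u (tnth (in_tuple D) i)).
  by rewrite /mono big_map big_enum.
have sum1 : \sum_g mono phi (t g) u = 1.
  under eq_bigr do rewrite monoE.
  rewrite -(bigA_distr_bigA (fun i j => phi (k, val j) (u (tnth (in_tuple D) i)))).
  by rewrite big1// => i _; exact: phi1.
have -> : f u = \sum_g f u * mono phi (t g) u by rewrite -mulr_sumr sum1 mulr1.
rewrite -sumrB; apply: (le_trans (ler_norm_sum _ _ _)).
have -> : eps = \sum_g eps * mono phi (t g) u by rewrite -mulr_sumr sum1 mulr1.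
apply: ler_sum => g _.
have m0 : 0 <= mono phi (t g) u by case/andP : (mono01 phi01 (t g) u).
rewrite -mulrBl normrM (ger0_norm m0).
have [->|gn0] := eqVneq (mono phi (t g) u) 0; first by rewrite !mulr0.
rewrite ler_wpM2r// ltW// fE// => e eE.
have eD : e \in D by rewrite mem_undup.
have iD : (index e D < size D)%N by rewrite index_mem.
rewrite /xi insubT /=.
apply: lt_le_trans kr.
apply: phic; apply: contra_neq gn0 => p0.
rewrite monoE (bigD1 (Ordinal iD))//=.
rewrite (_ : tnth _ _ = e); first by rewrite p0 mul0r.
by rewrite (tnth_nth e)/= nth_index.
Qed.

(** * Integrals of bounded functions *)

Section expectation.
Context d (T : measurableType d) (R : realType) (m : probability T R).
Implicit Types f g : T -> R.

Definition bounded_measurable f :=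
  measurable_fun setT f /\ exists M : R, forall x, `|f x| <= M.

Lemma bounded_measurable_cst (a : R) : bounded_measurable (fun=> a).
Proof. by split; [exact: measurable_cst|exists `|a|]. Qed.

Lemma bounded_measurableD f g : bounded_measurable f -> bounded_measurable g ->
  bounded_measurable (fun x => f x + g x).
Proof.
move=> [mf [M fM]] [mg [N gN]]; split; first exact: measurable_funD.
exists (M + N) => x; apply: (le_trans (ler_normD _ _)).
by apply: lerD.
Qed.

Lemma bounded_measurableM f g : bounded_measurable f -> bounded_measurable g ->
  bounded_measurable (fun x => f x * g x).
Proof.
move=> [mf [M fM]] [mg [N gN]]; split; first exact: measurable_funM.
by exists (M * N) => x; rewrite normrM ler_pM.
Qed.

Lemma bounded_measurableB f g : bounded_measurable f -> bounded_measurable g ->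
  bounded_measurable (fun x => f x - g x).
Proof.
move=> bf bg; have := bounded_measurableD bf
  (bounded_measurableM (bounded_measurable_cst (-1)) bg).
by under eq_fun do rewrite mulN1r.
Qed.

Lemma bounded_measurable_sum (I : Type) (r : seq I) (f : I -> T -> R) :
  (forall i, bounded_measurable (f i)) ->
  bounded_measurable (fun x => \sum_(i <- r) f i x).
Proof.
move=> bf; elim: r => [|i r ih].
  by under eq_fun do rewrite big_nil; exact: bounded_measurable_cst.
by under eq_fun do rewrite big_cons; exact: bounded_measurableD.
Qed.

Lemma bounded_measurable_prod (I : Type) (r : seq I) (f : I -> T -> R) :
  (forall i, bounded_measurable (f i)) ->
  bounded_measurable (fun x => \prod_(i <- r) f i x).
Proof.
move=> bf; elim: r => [|i r ih].
  by under eq_fun do rewrite big_nil; exact: bounded_measurable_cst.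
by under eq_fun do rewrite big_cons; exact: bounded_measurableM.
Qed.

Lemma bounded_measurable_integrable f :
  bounded_measurable f -> m.-integrable setT (EFin \o f).
Proof.
move=> [mf [M fM]]; apply: measurable_bounded_integrable => //.
  by rewrite (le_lt_trans (probability_le1 m measurableT))// ltry.
exists M; split; first exact: num_real.
by move=> N MN x _; apply: le_trans (fM x) _; exact: ltW.
Qed.

Local Notation E f := (\int[m]_x f x).

Lemma expect_cst (a : R) : E (fun=> a) = a.
Proof. by rewrite Rintegral_cst// (_ : fine _ = 1) ?mulr1//; have := probability_setT m; move=> /= ->. Qed.

Lemma expectD f g : bounded_measurable f -> bounded_measurable g ->
  E (fun x => f x + g x) = E f + E g.
Proof. by move=> bf bg; apply: RintegralD => //; exact: bounded_measurable_integrable. Qed.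

Lemma expectB f g : bounded_measurable f -> bounded_measurable g ->
  E (fun x => f x - g x) = E f - E g.
Proof. by move=> bf bg; apply: RintegralB => //; exact: bounded_measurable_integrable. Qed.

Lemma expectZ (a : R) f : bounded_measurable f -> E (fun x => a * f x) = a * E f.
Proof. by move=> bf; apply: RintegralZl => //; exact: bounded_measurable_integrable. Qed.

Lemma expect_sum (I : Type) (r : seq I) (f : I -> T -> R) :
  (forall i, bounded_measurable (f i)) ->
  E (fun x => \sum_(i <- r) f i x) = \sum_(i <- r) E (f i).
Proof.
move=> bf; elim: r => [|i r ih].
  rewrite big_nil -[RHS](expect_cst 0).
  by apply: eq_Rintegral => x _; rewrite big_nil.
rewrite big_cons -ih -expectD//; last exact: bounded_measurable_sum.
by apply: eq_Rintegral => x _; rewrite big_cons.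
Qed.

Lemma expect_le f g : bounded_measurable f -> bounded_measurable g ->
  (forall x, f x <= g x) -> E f <= E g.
Proof.
move=> bf bg fg; apply: le_Rintegral => //; exact: bounded_measurable_integrable.
Qed.

Lemma expect_close f g (e : R) : bounded_measurable f -> bounded_measurable g ->
  (forall x, `|f x - g x| <= e) -> `|E f - E g| <= e.
Proof.
move=> bf bg fg; rewrite ler_norml; apply/andP; split.
  rewrite lerBrDr addrC lerBlDl -[e in leRHS]expect_cst -expectD//; last exact: bounded_measurable_cst.
  apply: expect_le => //; first by apply: bounded_measurableD => //; exact: bounded_measurable_cst.
  by move=> x; have := fg x; rewrite ler_norml => /andP[]; lra.
rewrite lerBlDr -[e in leRHS]expect_cst -expectD//; last exact: bounded_measurable_cst.
apply: expect_le => //; first by apply: bounded_measurableD => //; exact: bounded_measurable_cst.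
by move=> x; have := fg x; rewrite ler_norml => /andP[]; lra.
Qed.

Let expect_fin_ge0 (A : finType) (p : A -> R) (x : A -> T) :
  (forall a, 0 <= p a) ->
  (forall S, measurable S -> m S = (\sum_a (p a)%:E * \d_(x a) S)%E) ->
  forall f, bounded_measurable f -> (forall x, 0 <= f x) ->
  E f = \sum_a p a * f (x a).
Proof.
move=> p0 mE f [mf _] f0.
have [a0 _|A0] := pickP A; last first.
  have := probability_setT m; rewrite mE// big_pred0// => /eqP.
  by rewrite eq_sym onee_eq0.
pose z i := nth a0 (enum A) i.
pose mm i : {measure set T -> \bar R} :=
  mscale (NngNum (p0 (z i))) (\d_(x (z i))).
have sumE (F : A -> \bar R) : (\sum_(i < #|A|) F (z i) = \sum_a F a)%E.
  by rewrite -[RHS]big_enum/= (big_nth a0) big_mkord cardE.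
have mfE : measurable_fun setT (EFin \o f) by exact/measurable_EFinP.
have f0E y : setT y -> (0 <= (EFin \o f) y)%E by rewrite lee_fin.
rewrite /Rintegral (@eq_measure_integral _ _ _ setT (msum mm #|A|)); last first.
  move=> S mS _; transitivity (\sum_a (p a)%:E * \d_(x a) S)%E; first exact: mE.
  by rewrite -(sumE (fun a => (p a)%:E * \d_(x a) S)%E).
rewrite ge0_integral_measure_sum//.
rewrite -[RHS]/(fine (\sum_a p a * f (x a))%:E) -sumEFin; congr fine.
rewrite -(sumE (fun a => (p a * f (x a))%:E)); apply: eq_bigr => i _.
rewrite ge0_integral_mscale// integral_dirac// diracT mul1e.
by [].
Qed.

(** The formula holds for nonnegative functions, and adding a constant reduces a
    bounded function to this case. *)
Lemma expect_fin (A : finType) (p : A -> R) (x : A -> T) :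
  (forall a, 0 <= p a) ->
  (forall S, measurable S -> m S = (\sum_a (p a)%:E * \d_(x a) S)%E) ->
  forall f, bounded_measurable f -> E f = \sum_a p a * f (x a).
Proof.
move=> p0 mE f bf; have [_ [M fM]] := bf.
have bM := bounded_measurable_cst M.
have h g : bounded_measurable g -> (forall x, 0 <= g x) ->
  E g = \sum_a p a * g (x a) by exact: expect_fin_ge0.
have : E (fun x => f x + M) - E (fun=> M) = E f.
  by rewrite expectD// addrK.
move=> <-; rewrite !h//; last 3 first.
- by move=> y; apply: le_trans (fM y).
- exact: bounded_measurableD.
- by move=> y; have := fM y; rewrite ler_norml => /andP[]; lra.
by rewrite -sumrB; apply: eq_bigr => a _; rewrite -mulrBr addrK.
Qed.

End expectation.

(** * The weak* topology and finitely supported laws *)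

Section prob_topological.
Context {R : realType} {Y : ptopologicalType}.
Implicit Types m : Prob R Y.

Lemma continuous_bounded_measurable (f : Y -> R) :
  compact [set: Y] -> continuous f -> bounded_measurable (f : borel Y -> R).
Proof.
move=> cY cf; split.
  apply: (@measurability _ _ (borel Y) R setT f (@RGenOInfty.G R)).
    exact: RGenOInfty.measurableE.
  move=> _ [_ [x ->] <-]; rewrite setTI; apply: sub_sigma_algebra; by apply: open_comp => // y _; exact: cf.
have : compact (f @` [set: Y] : set R^o).
  by apply: continuous_compact => //; apply: continuous_subspaceT.
move=> /compact_bounded[M [_ Mf]]; exists (M + 1) => y.
apply: Mf => //; first by rewrite ltrDl.
Qed.

Lemma wstar_eval_continuous (f : {f : Y -> R | continuous f}) :
  continuous (fun m => \int[m]_y (sval f y) : R).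
Proof.
move=> m; apply: (@continuous_comp _ _ _ (@wstar_eval R Y)
  (fun u : {ptws {f : Y -> R | continuous f} -> R^o} => u f)).
  exact: initial_continuous.
exact: (@continuous_coord R^o {classic {f : Y -> R | continuous f}} f).
Qed.

Lemma open_nbhs_wstar (f : Y -> R) m0 (e : R) : continuous f -> 0 < e ->
  open_nbhs m0 [set m : Prob R Y | `|\int[m]_y f y - \int[m0]_y f y| < e].
Proof.
move=> cf e0; split; last by rewrite /= subrr normr0.
pose F m : R^o := \int[m]_y f y.
have cF : continuous F by move=> m; exact: (@wstar_eval_continuous (exist _ f cf) m).
rewrite (_ : [set m : Prob R Y | _] = F @^-1` ball (F m0) e).
  by apply: open_comp => [m _|]; [exact: cF|exact: ball_open].
by apply/seteqP; split => m /=; rewrite /ball/= distrC.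
Qed.

Lemma nbhs_wstar m0 (U : set (Prob R Y)) : open_nbhs m0 U ->
  exists (n : nat) (f : 'I_n -> Y -> R) (r : R),
  [/\ forall i, continuous (f i), 0 < r &
    forall m, (forall i, `|\int[m]_y f i y - \int[m0]_y f i y| < r) -> U m].
Proof.
move=> [[Z oZ <-] Zm0].
have : nbhs (@wstar_eval R Y m0) Z by exact: open_nbhs_nbhs.
move=> /(@nbhs_cylinder R {classic {f : Y -> R | continuous f}} R^o) [E [r [r0 h]]].
exists (size E), (fun i => sval (tnth (in_tuple E) i)), r; split => //.
  by move=> i; exact: (svalP (tnth (in_tuple E) i)).
move=> m hm; apply: h => e /(nthP e)[j jE <-].
have := hm (Ordinal jE); rewrite (tnth_nth e).
by [].
Qed.

(** A family of test functions whose linear span is uniformly dense in the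
    continuous functions determines the weak* neighbourhoods. *)
Lemma nbhs_wstar_dense (K : eqType) (test : K -> Y -> R) m0 (U : set (Prob R Y)) :
  compact [set: Y] -> (forall t, continuous (test t)) ->
  (forall (f : Y -> R) (eps : R), continuous f -> 0 < eps ->
    exists (I : finType) (a : I -> R) (t : I -> K),
      forall y, `|f y - \sum_i a i * test (t i) y| <= eps) ->
  open_nbhs m0 U ->
  exists (s : seq K) (r : R), 0 < r /\
    forall m, (forall t, t \in s -> `|\int[m]_y test t y - \int[m0]_y test t y| < r) ->
    U m.
Proof.
move=> cY ct dense /nbhs_wstar [n [f [r [cf r0 fU]]]].
have bt t : bounded_measurable (test t : borel Y -> R).
  exact: continuous_bounded_measurable.
have one i : exists (s : seq K) (r' : R), 0 < r' /\ forall m,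
    (forall t, t \in s -> `|\int[m]_y test t y - \int[m0]_y test t y| < r') ->
    `|\int[m]_y f i y - \int[m0]_y f i y| < r.
  have r40 : 0 < r / 4 by rewrite divr_gt0.
  have [I [a [t at_]]] := dense _ _ (cf i) r40.
  have bf : bounded_measurable (f i : borel Y -> R).
    exact: continuous_bounded_measurable.
  have bs : bounded_measurable ((fun y => \sum_i a i * test (t i) y) : borel Y -> R).
    apply: bounded_measurable_sum => j.
    by apply: bounded_measurableM => //; exact: bounded_measurable_cst.
  have Es m : \int[m]_y (\sum_i a i * test (t i) y) = \sum_i a i * \int[m]_y test (t i) y.
    rewrite expect_sum; last first.
      by move=> j; apply: bounded_measurableM => //; exact: bounded_measurable_cst.
    by apply: eq_bigr => j _; rewrite expectZ.
  pose A := 1 + \sum_i `|a i|.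
  have A0 : 0 < A by rewrite ltr_pwDl// sumr_ge0.
  exists (map t (enum I)), (r / 4 / A); split; first by rewrite divr_gt0.
  move=> m hm.
  have h0 := expect_close m0 bf bs at_.
  have h1 := expect_close m bf bs at_.
  have h2 : `|\int[m]_y (\sum_i a i * test (t i) y) -
      \int[m0]_y (\sum_i a i * test (t i) y)| <= r / 4.
    rewrite !Es -sumrB (le_trans (ler_norm_sum _ _ _))//.
    apply: (@le_trans _ _ (\sum_i `|a i| * (r / 4 / A))).
      apply: ler_sum => j _; rewrite -mulrBr normrM ler_wpM2l// ltW//.
      by apply: hm; apply: map_f; rewrite mem_enum.
    rewrite -mulr_suml mulrCA ler_piMr//; first exact: ltW.
    by rewrite ler_pdivrMr// mul1r /A lerDr.
  move: h0 h1 h2; rewrite !ler_norml ltr_norml.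
  move=> /andP[h0 h0'] /andP[h1 h1'] /andP[h2 h2'].
  by apply/andP; split; lra.
have {one} [s one] := choice one.
have {one} [r' one] := choice one.
exists (flatten [seq s i | i <- enum 'I_n]), (\big[Num.min/1]_i r' i); split.
  by elim/big_ind : _ => // [x y x0 y0|i _]; [rewrite lt_min x0|case: (one i)].
move=> m hm; apply: fU => i; apply: (one i).2 => t ts.
apply: (@lt_le_trans _ _ (\big[Num.min/1]_i r' i)).
  by apply: hm; apply/flattenP; exists (s i) => //; apply: map_f; rewrite mem_enum.
exact: bigmin_le_cond.
Qed.

Section finitely_supported.
Variables (A : finType) (p : fdist R A) (x : A -> Y).
Local Open Scope ereal_scope.

Definition fin_law (S : set (borel Y)) : \bar R := \sum_a (p a)%:E * \d_(x a : borel Y) S.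

Let fin_law0 : fin_law set0 = 0.
Proof. by rewrite /fin_law big1// => a _; rewrite measure0 mule0. Qed.

Let fin_law_ge0 S : 0 <= fin_law S.
Proof. by apply: sume_ge0 => a _; rewrite mule_ge0 ?lee_fin ?fdist_ge0. Qed.

Let fin_law_sigma_additive : semi_sigma_additive fin_law.
Proof.
move=> F mF tF mUF; rewrite /fin_law.
rewrite [X in X @ \oo --> _](_ : _ = (fun n =>
    \sum_a \sum_(0 <= i < n) (p a)%:E * \d_(x a : borel Y) (F i))); last first.
  by apply/funext => k; rewrite exchange_big.
apply: cvg_nnesum => [a _|a _].
  apply: nearW => n; apply: sume_ge0 => i _.
  by rewrite mule_ge0 ?lee_fin ?fdist_ge0.
under eq_fun do rewrite -ge0_sume_distrr//.
apply: cvgeZl => //.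
exact: measure_semi_sigma_additive.
Qed.

HB.instance Definition _ := isMeasure.Build _ _ _ fin_law
  fin_law0 fin_law_ge0 fin_law_sigma_additive.

Let fin_lawT : fin_law setT = 1.
Proof.
rewrite /fin_law; under eq_bigr do rewrite diracT mule1.
by rewrite sumEFin fdist_sum1.
Qed.

HB.instance Definition _ := Measure_isProbability.Build _ _ _ fin_law fin_lawT.

End finitely_supported.

Lemma expect_fin_law (A : finType) (p : fdist R A) (x : A -> Y) (f : borel Y -> R) :
  bounded_measurable f -> \int[fin_law p x]_y f y = \sum_a p a * f (x a).
Proof. by move=> bf; apply: expect_fin => //; exact: fdist_ge0. Qed.

Lemma fin_lawE (A : finType) (p : fdist R A) (x : A -> Y) (S : set Y) :
  fin_law p x S = (\sum_(a | x a \in S) p a)%:E.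
Proof.
rewrite /fin_law -sumEFin [RHS]big_mkcond/=; apply: eq_bigr => a _.
by rewrite diracE; case: ifP => _; rewrite ?mule1 ?mule0.
Qed.

End prob_topological.

(** * Empirical distributions and squares *)

Lemma bounded_measurable_comp d1 d2 (T1 : measurableType d1) (T2 : measurableType d2)
    (R : realType) (h : T1 -> T2) (f : T2 -> R) :
  measurable_fun setT h -> bounded_measurable f -> bounded_measurable (f \o h).
Proof.
move=> mh [mf [M fM]]; split; first exact: measurableT_comp.
by exists M => x; exact: fM.
Qed.

Lemma expect_distribution d1 d2 (T1 : measurableType d1) (T2 : measurableType d2)
    (R : realType) (m : probability T1 R) (h : {mfun T1 >-> T2}) (f : T2 -> R) :
  bounded_measurable f -> \int[distribution m h]_y f y = \int[m]_x f (h x).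
Proof.
move=> bf; rewrite /Rintegral integral_distribution//.
  by case: bf => mf _; exact/measurable_EFinP.
apply: (@bounded_measurable_integrable _ _ _ _ (f \o h)).
exact: bounded_measurable_comp.
Qed.

Section empirical_lemmas.
Context {R : realType} {G : countGroupType} {X : ptopologicalType}.
Variable s : symMap G.
Local Notation V := (vertices s).

Lemma continuous_pullback (v : V) :
  continuous (pullback v : {ptws V -> X} -> {ptws G -> X}).
Proof. by apply: continuous_ptws => g; exact: continuous_coord. Qed.

Lemma expect_empirical (x : {ptws V -> X}) (f : borel {ptws G -> X} -> R) :
  bounded_measurable f ->
  \int[empirical x]_y f y = (\sum_(v : V) f (pullback v x)) / #|V|%:R.
Proof.
move=> bf; rewrite (@expect_fin _ _ _ _ V (fun=> #|V|%:R^-1) (fun v => pullback v x))//.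
  by rewrite -mulr_sumr mulrC.
move=> S mS; rewrite -ge0_sume_distrr//.
Qed.

Lemma empirical_continuous : compact [set: {ptws G -> X}] ->
  continuous (@empirical R G X s : {ptws V -> X} -> Prob R {ptws G -> X}).
Proof.
move=> cG; apply: continuous_comp_initial.
apply: (@continuous_ptws _ R^o {classic {f : {ptws G -> X} -> R | continuous f}}) => f.
rewrite (_ : (fun y => _) = (fun y : {ptws V -> X} =>
   (\sum_(v : V) sval f (pullback v y)) * #|V|%:R^-1 : R)); last first.
  apply/funext => y /=; rewrite /wstar_eval expect_empirical//.
  by apply: continuous_bounded_measurable => //; exact: (svalP f).
apply: continuousM'; last exact: cst_continuous.
apply: continuous_sum' => v y.
apply: (@continuous_comp _ _ _ (pullback v : {ptws V -> X} -> {ptws G -> X}) (sval f)).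
  exact: continuous_pullback.
exact: (svalP f).
Qed.

Lemma measurable_good_models (U : set (Prob R {ptws G -> X})) :
  compact [set: {ptws G -> X}] -> open U ->
  measurable (good_models s U : set (borel {ptws V -> X})).
Proof.
move=> cG oU; apply: sub_sigma_algebra; apply: open_comp => // x _.
exact: empirical_continuous.
Qed.

End empirical_lemmas.

Section square_lemmas.
Context {R : realType} {I : countType} {X : compactMetricType R}.
Local Notation XI := {ptws I -> X}.
Local Notation XXI := {ptws I -> (X * X)%type}.

Definition zip_fst (z : XXI) : XI := fun i => (z i).1.
Definition zip_snd (z : XXI) : XI := fun i => (z i).2.

Lemma zip_fst_continuous : continuous zip_fst.
Proof.
apply: continuous_ptws => i z.
apply: (@continuous_comp _ _ _ (fun z : XXI => z i) fst); last exact: cvg_fst.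
exact: continuous_coord.
Qed.

Lemma zip_snd_continuous : continuous zip_snd.
Proof.
apply: continuous_ptws => i z.
apply: (@continuous_comp _ _ _ (fun z : XXI => z i) snd); last exact: cvg_snd.
exact: continuous_coord.
Qed.

Lemma compact_zip : compact [set: XXI].
Proof.
have c2 : compact [set: X * X].
  have -> : [set: X * X] = [set: X] `*` [set: X] by apply/seteqP; split.
  by apply: compact_setX; exact: compact_setT.
have := @tychonoff I (fun=> (X * X)%type) (fun=> setT) (fun=> c2).
by congr compact; apply/seteqP; split.
Qed.

(** Fubini for a product of functions of the two members of the pair. *)
Lemma expect_square (m : Prob R XI) (f g : borel XI -> R) :
  bounded_measurable f -> bounded_measurable g ->
  \int[square m]_z (f (zip_fst z) * g (zip_snd z)) =
  (\int[m]_x f x) * (\int[m]_x g x).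
Proof.
move=> bf bg.
have bfz : bounded_measurable (f \o zip_fst : borel XXI -> R).
  apply: (@bounded_measurable_comp _ _ (borel XXI) (borel XI)) => //.
  by apply: continuous_borel; exact: zip_fst_continuous.
have bgz : bounded_measurable (g \o zip_snd : borel XXI -> R).
  apply: (@bounded_measurable_comp _ _ (borel XXI) (borel XI)) => //.
  by apply: continuous_borel; exact: zip_snd_continuous.
rewrite /square expect_distribution; last exact: bounded_measurableM bfz bgz.
have bf1 : bounded_measurable (f \o fst : borel XI * borel XI -> R).
  exact: bounded_measurable_comp.
have bg1 : bounded_measurable (g \o snd : borel XI * borel XI -> R).
  exact: bounded_measurable_comp.
have bfg := bounded_measurableM bf1 bg1.
have intfg := bounded_measurable_integrable (m \x m)%E bfg.
have e12 := integral12_prod_meas1 intfg.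
transitivity (fine (\int[m]_x \int[m]_y ((f x)%:E * (g y)%:E))%E).
  by apply: congr1 (esym e12).
have ig := bounded_measurable_integrable m bg.
have if_ := bounded_measurable_integrable m bf.
rewrite -[RHS]/(fine ((\int[m]_x f x) * (\int[m]_x g x))%:E); congr fine.
rewrite EFinM /Rintegral.
have fg : (\int[m]_y (EFin \o g) y)%E \is a fin_num by exact: integrable_fin_num.
have ff : (\int[m]_y (EFin \o f) y)%E \is a fin_num by exact: integrable_fin_num.
rewrite !fineK//.
transitivity (\int[m]_x ((f x)%:E * \int[m]_y (g y)%:E))%E.
  apply: eq_integral => x _; rewrite -integralZl//.
by rewrite -(fineK fg) integralZr.
Qed.

End square_lemmas.

(** * Independence of the slices of the co-induced process *)

Section unit_interval_functions.
Context d (T : measurableType d) (R : realType).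

Lemma indic_bounded_measurable (A : set T) :
  measurable A -> bounded_measurable (\1_A : T -> R).
Proof.
move=> mA; split; first exact: measurable_indic.
by exists 1 => x; rewrite indicE; case: (_ \in _); rewrite ?normr1 ?normr0.
Qed.

Lemma indic01 (A : set T) x : 0 <= (\1_A x : R) <= 1.
Proof. by rewrite indicE; case: (_ \in _); rewrite ?lexx ?ler01. Qed.

Lemma expect_indic (m : probability T R) (A : set T) :
  measurable A -> \int[m]_x (\1_A x : R) = fine (m A).
Proof. by move=> mA; rewrite /Rintegral integral_indic// setIT. Qed.

(** Values are rounded down to multiples of [1 / n.+1]; the value 1 accounts for
    the last of the [n.+2] steps. *)
Lemma simple_approx (phi : T -> R) (n : nat) :
  measurable_fun setT phi -> (forall x, 0 <= phi x <= 1) ->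
  exists A : 'I_n.+2 -> set T, (forall k, measurable (A k)) /\
    forall x, `|phi x - \sum_(k < n.+2) (k%:R / n.+1%:R) * \1_(A k) x| <= n.+1%:R^-1.
Proof.
move=> mphi phi01.
pose A (k : 'I_n.+2) := phi @^-1` `[k%:R / n.+1%:R, k.+1%:R / n.+1%:R[%classic.
exists A; split.
  by move=> k; rewrite -[A k]setTI; apply: mphi => //; exact: measurable_itv.
move=> x; have /andP[p0 p1] := phi01 x.
have n0 : (0 : R) < n.+1%:R by rewrite ltr0n.
have np0 : 0 <= phi x * n.+1%:R by rewrite mulr_ge0.
have /andP[k0l k0r] := truncn_itv np0.
set k0 := Num.truncn _ in k0l k0r.
have k0n : (k0 < n.+2)%N.
  rewrite ltnS -(ler_nat R) (le_trans k0l)// ler_piMl//.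
have inA (k : 'I_n.+2) : (A k x) <-> (val k = k0).
  rewrite /A/= in_itv/= ler_pdivrMr// ltr_pdivlMr//; split.
    move=> /andP[h1 h2]; apply/eqP; rewrite eqn_leq -(ltnS k k0) -(ltnS k0 k); apply/andP; split.
      by rewrite -(ltr_nat R) (le_lt_trans h1).
    by rewrite -(ltr_nat R) (le_lt_trans k0l).
  by move=> ->; rewrite k0l k0r.
rewrite (bigD1 (Ordinal k0n))//= big1 ?addr0; last first.
  move=> k kk0; rewrite indicE memNset ?mulr0// => /inA kE.
  by move/eqP: kk0; apply; exact/val_inj.
rewrite indicE mem_set ?mulr1; last exact/inA.
have -> : phi x - k0%:R / n.+1%:R = (phi x * n.+1%:R - k0%:R) / n.+1%:R.
  by rewrite mulrBl mulfK// gt_eqF.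
rewrite normrM (ger0_norm (_ : 0 <= n.+1%:R^-1))//.
rewrite ler_piMl// ger0_norm; first by rewrite lerBlDl natr1 ltW.
by rewrite subr_ge0.
Qed.

End unit_interval_functions.

Section coinduction.
Context {R : realType} {G H : countGroupType} {X : compactMetricType R}.
Variables (mu : Prob R {ptws G -> X}) (nu : Prob R {ptws (G * H)%type -> X}).

Definition slice (h : H) (y : {ptws (G * H)%type -> X}) : {ptws G -> X} :=
  fun g => y (g, h).

Lemma slice_continuous h : continuous (slice h).
Proof. by apply: continuous_ptws => g; exact: continuous_coord. Qed.

Lemma slice_bounded_measurable h (f : borel {ptws G -> X} -> R) :
  bounded_measurable f ->
  bounded_measurable (f \o slice h : borel {ptws (G * H)%type -> X} -> R).
Proof.
move=> bf; apply: (@bounded_measurable_comp _ _ (borel {ptws (G * H)%type -> X})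
  (borel {ptws G -> X})) => //.
by apply: continuous_borel; exact: slice_continuous.
Qed.

Hypothesis coind : is_coinduction mu nu.
Variable r : seq H.
Hypothesis ur : uniq r.

(** The product of the indicators is the indicator of a cylinder, whose mass is
    prescribed by the definition of the co-induction. *)
Let indic_case (A : H -> set (borel {ptws G -> X})) :
  (forall h, measurable (A h)) ->
  \int[nu]_y (\prod_(h <- r) (\1_(A h) (slice h y) : R)) =
  \prod_(h <- r) (\int[mu]_x (\1_(A h) x : R)).
Proof.
move=> mA.
pose F : {fset H} := [fset h in r]%fset.
have inF h : (h \in F) = (h \in r) by rewrite inE.
pose B := [set y : borel {ptws (G * H)%type -> X} |
  forall h, h \in F -> A h (fun g => y (g, h))].
have bF : bounded_measurable ((fun y => \prod_(h <- r) (\1_(A h) (slice h y) : R))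
    : borel {ptws (G * H)%type -> X} -> R).
  apply: bounded_measurable_prod => h; apply: slice_bounded_measurable.
  exact: indic_bounded_measurable.
have FE y : \prod_(h <- r) (\1_(A h) (slice h y) : R) = \1_B y.
  have [By|By] := pselect (B y).
    rewrite [RHS]indicE mem_set// big_seq big1// => h hr.
    by rewrite indicE mem_set//; apply: By; rewrite inF.
  rewrite [RHS]indicE memNset//.
  have [h hr Ah] : exists2 h, h \in r & ~ A h (slice h y).
    apply: contrapT => nh; apply: By => h; rewrite inF => hr.
    by apply: contrapT => Ah; apply: nh; exists h.
  by rewrite (bigD1_seq h)//= indicE memNset// mul0r.
have mB : measurable B.
  rewrite (_ : B = setT `&` (fun y => \prod_(h <- r) (\1_(A h) (slice h y) : R)) @^-1` [set 1]).
    by case: bF => mF _; apply: mF.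
  rewrite setTI; apply/seteqP; split => y /=; rewrite FE indicE.
    by move=> By; rewrite mem_set.
  by case: (boolP (y \in B)) => [/set_mem//|_ /eqP]; rewrite eq_sym oner_eq0.
transitivity (\int[nu]_y (\1_B y : R)).
  by apply: eq_Rintegral => y _; exact: FE.
rewrite expect_indic//.
transitivity (fine (\prod_(h <- F) mu (A h))%E).
  apply: (f_equal (@fine R)); have := coind (F := F) (fun h _ => mA h).
  by move=> e; exact e.
rewrite (perm_big r)/=; last first.
  by apply: uniq_perm => [||h]; [exact: fset_uniq| |rewrite inF].
rewrite (eq_bigr (fun h => (fine (mu (A h)))%:E)); last first.
  by move=> h _; rewrite fineK// fin_num_measure.
rewrite prodEFin/=; apply: eq_bigr => h _.
by rewrite expect_indic.
Qed.

(** Independence of the slices, extended from events to [0, 1]-valued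
    functions by replacing one factor at a time by step functions. *)
Lemma expect_coinduction (f : H -> borel {ptws G -> X} -> R) :
  (forall h, measurable_fun setT (f h)) -> (forall h x, 0 <= f h x <= 1) ->
  \int[nu]_y (\prod_(h <- r) f h (slice h y)) = \prod_(h <- r) \int[mu]_x f h x.
Proof.
pose good (f : H -> borel {ptws G -> X} -> R) :=
  (forall h, measurable_fun setT (f h)) /\ (forall h x, 0 <= f h x <= 1).
have goodb f' h : good f' -> bounded_measurable (f' h).
  move=> [m b]; split; first exact: m.
  by exists 1 => x; case/andP: (b h x) => b0 b1; rewrite ger0_norm.
(* Induction on a list [s] containing the indices of all the factors that are not
   indicators. *)
suff: forall (s : seq H) f, good f ->
    (forall h, h \in r -> h \notin s -> exists2 A, measurable A & f h = \1_A) ->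
    \int[nu]_y (\prod_(h <- r) f h (slice h y)) = \prod_(h <- r) \int[mu]_x f h x.
  by move=> /(_ r f) + mf f01; apply => // h ->.
elim=> [|h0 s ih] {}f gf hf.
  have /choice[A AP] : forall h, exists A, measurable A /\ (h \in r -> f h = \1_A).
    move=> h; have [hr|hr] := boolP (h \in r); last by exists set0.
    by have [A mA fA] := hf h hr isT; exists A.
  transitivity (\int[nu]_y (\prod_(h <- r) (\1_(A h) (slice h y) : R))).
    apply: eq_Rintegral => y _; rewrite big_seq [RHS]big_seq; apply: eq_bigr => h hr.
    by rewrite (AP h).2.
  rewrite indic_case; last by move=> h; exact: (AP h).1.
  by rewrite big_seq [RHS]big_seq; apply: eq_bigr => h hr; rewrite (AP h).2.
have [h0r|h0r] := boolP (h0 \in r); last first.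
  apply: ih => // h hr hs; apply: hf => //; rewrite inE negb_or hs andbT.
  by apply: contraNneq h0r => <-.
pose upd phi h := if h == h0 then phi else f h.
pose rest y : R := \prod_(h <- [seq h <- r | h != h0]) f h (slice h y).
pose C : R := \prod_(h <- r | h != h0) \int[mu]_x f h x.
have LE phi y : \prod_(h <- r) upd phi h (slice h y) = phi (slice h0 y) * rest y.
  rewrite (bigD1_seq h0)//= /upd eqxx /rest big_filter; congr (_ * _).
  by apply: eq_bigr => h /negbTE ->.
have ME phi : \prod_(h <- r) \int[mu]_x upd phi h x = \int[mu]_x phi x * C.
  rewrite (bigD1_seq h0)//= /upd eqxx; congr (_ * _).
  by apply: eq_bigr => h /negbTE ->.
have updf : upd (f h0) = f.
  by apply/funext => h; rewrite /upd; case: eqP => [->|].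
have ind (A : set (borel {ptws G -> X})) : measurable A ->
    \int[nu]_y ((\1_A (slice h0 y) : R) * rest y) = \int[mu]_x (\1_A x : R) * C.
  move=> mA; rewrite -ME -ih.
  - by apply: eq_Rintegral => y _; rewrite LE.
  - split=> h; rewrite /upd; case: ifP => _.
    + exact: measurable_indic.
    + exact: gf.1.
    + exact: indic01.
    + exact: gf.2.
  - move=> h hr hs; rewrite /upd; case: eqVneq => [_|hh0]; first by exists A.
    by apply: hf => //; rewrite inE negb_or hh0.
have brest : bounded_measurable (rest : borel {ptws (G * H)%type -> X} -> R).
  by apply: bounded_measurable_prod => h; apply: slice_bounded_measurable; exact: goodb.
have rest01 y : 0 <= rest y <= 1.
  rewrite /rest; elim/big_ind : _ => [|a b /andP[a0 a1] /andP[b0 b1]|h _].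
  - by rewrite ler01 lexx.
  - by rewrite mulr_ge0//= -[leRHS]mulr1 ler_pM.
  - exact: gf.2.
have C01 : `|C| <= 1.
  suff /andP[C0 C1] : 0 <= C <= 1 by rewrite ger0_norm.
  rewrite /C; elim/big_ind : _ => [|a b /andP[a0 a1] /andP[b0 b1]|h _].
  - by rewrite ler01 lexx.
  - by rewrite mulr_ge0//= -[leRHS]mulr1 ler_pM.
  - apply/andP; split.
      by apply: Rintegral_ge0 => x _; case/andP: (gf.2 h x).
    rewrite -(expect_cst mu 1); apply: expect_le; first exact: goodb.
      exact: bounded_measurable_cst.
    by move=> x; case/andP: (gf.2 h x).
have bf0 := slice_bounded_measurable h0 (goodb _ h0 gf).
rewrite -{1 2}updf ME.
under eq_Rintegral do rewrite LE.
(* Both sides are linear in the factor at [h0], which is close to a combination of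
   indicators. *)
apply/eqP; rewrite -subr_eq0 -normr_le0; apply/ler_addgt0Pl => e e0; rewrite addr0.
pose n := Num.truncn (2 / e).
have ne : 2 * n.+1%:R^-1 <= e.
  rewrite ler_pdivrMr// mulrC -ler_pdivrMr//.
  by rewrite ltW// truncnS_gt.
have [A [mA Aphi]] := simple_approx n (gf.1 h0) (gf.2 h0).
pose phin x := \sum_(k < n.+2) (k%:R / n.+1%:R) * (\1_(A k) x : R).
have bphin : bounded_measurable phin.
  apply: bounded_measurable_sum => k; apply: bounded_measurableM.
    exact: bounded_measurable_cst.
  exact: indic_bounded_measurable.
have bphinS := slice_bounded_measurable h0 bphin.
have eqn : \int[nu]_y (phin (slice h0 y) * rest y) = \int[mu]_x phin x * C.
  transitivity (\int[nu]_y (\sum_(k < n.+2) (k%:R / n.+1%:R) * ((\1_(A k) (slice h0 y) : R) * rest y))).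
    apply: eq_Rintegral => y _; rewrite /phin mulr_suml; apply: eq_bigr => k _.
    by rewrite mulrA.
  have bk k : bounded_measurable ((fun y => (\1_(A k) (slice h0 y) : R) * rest y)
      : borel {ptws (G * H)%type -> X} -> R).
    apply: bounded_measurableM => //; apply: slice_bounded_measurable.
    exact: indic_bounded_measurable.
  rewrite expect_sum; last first.
    by move=> k; apply: bounded_measurableM => //; exact: bounded_measurable_cst.
  rewrite [in RHS]expect_sum; last first.
    move=> k; apply: bounded_measurableM; first exact: bounded_measurable_cst.
    exact: indic_bounded_measurable.
  rewrite mulr_suml; apply: eq_bigr => k _.
  rewrite expectZ// ind// [in RHS]expectZ ?mulrA//.
  exact: indic_bounded_measurable.
have c1 : `|\int[nu]_y (f h0 (slice h0 y) * rest y) -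
            \int[nu]_y (phin (slice h0 y) * rest y)| <= n.+1%:R^-1.
  apply: expect_close; [exact: bounded_measurableM|exact: bounded_measurableM|].
  move=> y; rewrite -mulrBl normrM -[leRHS]mulr1 ler_pM//.
  by case/andP: (rest01 y) => b0 b1; rewrite ger0_norm.
have c2 : `|\int[mu]_x (f h0 x) * C - \int[mu]_x (phin x) * C| <= n.+1%:R^-1.
  rewrite -mulrBl normrM -[leRHS]mulr1 ler_pM//.
  by apply: expect_close => //; exact: goodb.
apply: le_trans ne.
move: c1 c2; rewrite eqn.
set a := \int[nu]_y _; set b := \int[mu]_x _ * C; set c := \int[mu]_x _ * C.
set q := n.+1%:R^-1.
rewrite !ler_norml => /andP[? ?] /andP[? ?].
by apply/andP; split; lra.
Qed.

End coinduction.

(** * Model-measure entropy is at most sofic entropy *)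

Lemma real_between (R : realType) (c : R) (y : \bar R) : (c%:E < y)%E ->
  exists2 c' : R, c < c' & (c'%:E < y)%E.
Proof.
case: y => [r| |//].
  rewrite lte_fin => cr; exists ((c + r) / 2); first by rewrite midf_lt.
  by rewrite lte_fin midf_lt.
by move=> _; exists (c + 1); [rewrite ltrDl|exact: ltry].
Qed.

Section limsup.
Context {R : realType}.
Local Open Scope ereal_scope.

Lemma frequently_gt_limn_esup (u : (\bar R)^nat) c n0 : c < limn_esup u ->
  exists2 n, (n0 <= n)%N & c < u n.
Proof.
move=> cu.
have : c < ereal_sup (u @` [set k | (n0 <= k)%N]).
  apply: (lt_le_trans cu); apply: ereal_inf_lbound => /=.
  by exists [set k | (n0 <= k)%N] => //; exists n0.
by move=> /ereal_sup_gt[_ [n /= nn0 <-] cn]; exists n.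
Qed.

Lemma limn_esup_ge (u : (\bar R)^nat) c :
  (forall n0, exists2 n, (n0 <= n)%N & c <= u n) -> c <= limn_esup u.
Proof.
move=> h; apply: le_ereal_inf_tmp => _ [A [n0 _ n0A] <-].
have [n n0n cn] := h n0; apply: (le_trans cn).
by apply: ereal_sup_ubound; exists n => //; exact: n0A.
Qed.

Lemma lee_of_real (x y : \bar R) : (forall c : R, c%:E < x -> c%:E <= y) -> x <= y.
Proof.
case: x y => [x| |] [y| |] // h; rewrite ?leey ?leNye//.
- rewrite lee_fin leNgt; apply/negP => yx.
  have := h ((x + y) / 2)%R; rewrite lte_fin lee_fin; lra.
- by have := h (x - 1)%R; rewrite lte_fin ltrBlDr ltrDl ltr01 => /(_ isT).
- have := h (y + 1)%R; rewrite ltry lee_fin => /(_ isT).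
  by rewrite gerDl ler10.
- by have := h 0%R; rewrite ltry => /(_ isT).
Qed.

Lemma limn_esup_le_subseq (u v : (\bar R)^nat) (n_ : nat -> nat) :
  {homo n_ : i j / (i < j)%N} -> (\forall i \near \oo, u i <= v (n_ i)) ->
  limn_esup u <= limn_esup v.
Proof.
move=> n_mono [i0 _ h]; apply: lee_of_real => c cu.
apply: limn_esup_ge => n0.
have [i i0i ci] := frequently_gt_limn_esup (maxn i0 n0) cu.
exists (n_ i); last by apply: le_trans (ltW ci) _; apply: h => /=; rewrite (leq_trans _ i0i)// leq_maxl.
have -> : (n0 <= n_ i)%N; last by [].
apply: (@leq_trans i); first by rewrite (leq_trans _ i0i)// leq_maxr.
elim: {+}i => // j ih; apply: (leq_ltn_trans ih); exact: n_mono.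
Qed.

End limsup.

Section wstar_pushforward.
Context {R : realType} {G : countGroupType} {X : compactMetricType R}.

(** Taking the first marginal of a law on pairs is weak* continuous and commutes
    with empirical distributions, so [U] pulls back to a neighbourhood of the
    square that only sees the first member of a pair of models. *)
Lemma first_marginal_nbhs (U : set (Prob R {ptws G -> X})) (mu : Prob R {ptws G -> X}) :
  open_nbhs mu U ->
  exists U' : set (Prob R {ptws G -> (X * X)%type}), open_nbhs (square mu) U' /\
    forall (s : symMap G) (x y : {ptws vertices s -> X}),
      good_models s U' (zip_config (x, y)) <-> good_models s U x.
Proof.
move=> [[Z oZ <-] Zmu].
pose F (th : Prob R {ptws G -> (X * X)%type}) : {ptws {f : {ptws G -> X} -> R | continuous f} -> R^o} :=
  fun f => \int[th]_z sval f (zip_fst z).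
have cfz (f : {f : {ptws G -> X} -> R | continuous f}) :
    continuous (sval f \o zip_fst : {ptws G -> (X * X)%type} -> R).
  move=> z; apply: continuous_comp; first exact: zip_fst_continuous.
  exact: (svalP f).
have cF : continuous F.
  apply: (@continuous_ptws _ R^o {classic {f : {ptws G -> X} -> R | continuous f}}) => f.
  exact: (@wstar_eval_continuous _ _ (exist _ _ (cfz f))).
have bf (f : {f : {ptws G -> X} -> R | continuous f}) :
    bounded_measurable (sval f : borel {ptws G -> X} -> R).
  exact: (continuous_bounded_measurable (@compact_ptws R G X) (svalP f)).
exists (F @^-1` Z); split.
  split; first by apply: open_comp => // th _; exact: cF.
  rewrite /=; suff -> : F (square mu) = wstar_eval mu by [].
  apply/funext => f; rewrite /F /wstar_eval.
  have := expect_square mu (bf f) (bounded_measurable_cst _ 1).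
  rewrite expect_cst mulr1 => <-.
  by apply: eq_Rintegral => z _; rewrite mulr1.
move=> s x y; rewrite /good_models/=.
suff -> : F (empirical (zip_config (x, y))) = wstar_eval (empirical x) by [].
apply/funext => f; rewrite /F /wstar_eval !expect_empirical//.
exact: (continuous_bounded_measurable (@compact_zip R G X) (cfz f)).
Qed.

End wstar_pushforward.

Section square_good.
Context {R : realType} {G : countGroupType} {X : compactMetricType R}.
Variable s : symMap G.

Lemma square_good_fst (m : Prob R {ptws vertices s -> X})
    (U : set (Prob R {ptws G -> X})) (U' : set (Prob R {ptws G -> (X * X)%type})) :
  open U ->
  (forall x y, good_models s U' (zip_config (x, y)) <-> good_models s U x) ->
  square m (good_models s U') = m (good_models s U).
Proof.
move=> oU UU'.
have -> : square m (good_models s U') = (m \x m)%E (good_models s U `*` setT).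
  suff <- : zip_config @^-1` good_models s U' = good_models s U `*` setT by [].
  apply/seteqP; split => -[x y] /=.
    by move=> h; split => //; exact: (UU' x y).1.
  by case=> h _; exact: (UU' x y).2.
rewrite product_measure1E//; last first.
  by apply: measurable_good_models => //; exact: compact_ptws.
by rewrite -[RHS]mule1; congr (_ * _)%E; exact: probability_setT.
Qed.

End square_good.

Section covering_lemmas.
Context {R : realType} {X : compactMetricType R} {V : finType}.
Local Notation XV := {ptws V -> X}.

Lemma open_mean_ball (x : XV) (delta : R) : open (mean_ball x delta).
Proof.
rewrite (_ : mean_ball x delta = (fun y => mean_dist x y) @^-1` [set r | r < delta])//.
apply: open_comp; last exact: open_lt.
move=> y _; apply: continuousM'; last exact: cst_continuous.
apply: continuous_sum' => v {}y.
apply: (@continuous_comp _ _ _ (fun y : XV => y v) (fun z => mdist (x v) z)).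
  exact: continuous_coord.
have := @mdist_continuous R X (x v) (y v).
by under eq_fun do rewrite metric_sym.
Qed.

Lemma measurable_mean_balls k (c : 'I_k -> XV) (delta : R) :
  measurable (\bigcup_i mean_ball (c i) delta : set (borel XV)).
Proof.
by apply: sub_sigma_algebra; apply: bigcup_open => i _; exact: open_mean_ball.
Qed.

Lemma mcov_le_cov (eps delta : R) (m : Prob R XV) (F : set (borel XV)) :
  measurable F -> ((1 - eps)%:E < m F)%E -> (mcov eps delta m <= cov delta F)%E.
Proof.
move=> mF mFe; apply: ereal_inf_le_tmp => _ [k [c Fc] <-]; exists k => //.
exists c; apply: (lt_le_trans mFe); apply: le_measure => //; rewrite ?inE//.
exact: measurable_mean_balls.
Qed.

Lemma cov_ge0 (delta : R) (F : set XV) : (0 <= cov delta F)%E.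
Proof. by apply: le_ereal_inf_tmp => _ [k _ <-]; rewrite lee_fin. Qed.

Lemma mcov_ge0 (eps delta : R) (m : Prob R XV) : (0 <= mcov eps delta m)%E.
Proof. by apply: le_ereal_inf_tmp => _ [k _ <-]; rewrite lee_fin. Qed.

End covering_lemmas.

(** By LDE convergence the good models have almost full measure, so that a cover of
    them is a cover for the model measures. *)
Lemma model_measure_le_sofic (R : realType) (G : countGroupType)
    (X : compactMetricType R) (sigma : nat -> symMap G) (mu : Prob R {ptws G -> X}) :
  (model_measure_entropy sigma mu <= sofic_entropy sigma mu)%E.
Proof.
apply: ge_ereal_sup => _ [n_ [mu_ [n_mono [_ lde] ->]]].
apply: ge_ereal_sup => _ [eps /= e0 [delta /= d0 <-]].
apply: (@le_trans _ _ (ereal_inf [set limn_esup (fun n =>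
    (#|vertices (sigma n)|%:R^-1)%:E * lne (cov delta (good_models (sigma n) U)))%E
  | U in [set U : set (Prob R {ptws G -> X}) | open_nbhs mu U]])); last first.
  by apply: ereal_sup_ubound; exists delta.
apply: le_ereal_inf_tmp => _ [U oU <-].
apply: (limn_esup_le_subseq n_mono).
have [U' [oU' UU']] := first_marginal_nbhs oU.
have := lde _ oU'.
move=> /(_ [set x | (1 - eps)%:E < x]%E) [].
  apply: open_nbhs_nbhs; split; first exact: open_ereal_gt_ereal.
  by rewrite /= lte_fin ltrBlDr ltrDl.
move=> i0 _ h; exists i0 => // i /= i0i.
have hi : ((1 - eps)%:E < mu_ i (good_models (sigma (n_ i)) U))%E.
  apply: (lt_le_trans (h i i0i)); rewrite le_eqVlt; apply/orP; left; apply/eqP.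
  exact: (square_good_fst (mu_ i) oU.1 (UU' _)).
rewrite lee_wpmul2l ?lee_fin ?invr_ge0// lee_lne ?in_itv/= ?leey ?mcov_ge0 ?cov_ge0//.
apply: mcov_le_cov => //; apply: measurable_good_models; last exact: oU.1.
exact: compact_ptws.
Qed.

(** * Partitions and names *)

(** A finite Borel partition as a measurable map onto a finite ordinal, so that names
    and entropies become statements about finite functions. *)
Record labelling (X : ptopologicalType) (P : set (set X)) := Labelling {
  labels : nat;
  label :> X -> 'I_labels;
  label_cells : P = [set [set x | label x = j] | j in setT];
  label_surj : forall j, exists x, label x = j;
  label_measurable : forall j, measurable ([set x | label x = j] : set (borel X)) }.

Lemma labellingP (X : ptopologicalType) (P : set (set X)) (l : labelling P) C :
  P C <-> exists j, C = [set x | l x = j].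
Proof.
have e := congr1 (fun S => S C) (label_cells l).
rewrite /= in e; split => [|[j ->]].
  by rewrite [X in X -> _]e => -[j _ <-]; exists j.
by have := congr1 (fun S => S [set x | l x = j]) (label_cells l) => /= ->; exists j.
Qed.

Lemma finite_borel_partition_labelling (X : ptopologicalType) (P : set (set X)) :
  finite_borel_partition P -> inhabited (labelling P).
Proof.
move=> [fP mP [cP tP nP]].
have [s us Ps] : exists2 s : seq (set X), uniq s & P = [set` s].
  have /finite_fsetP[F PF] := fP; exists (enum_fset F); first exact: fset_uniq.
  by [].
have ex x : exists2 C, C \in s & C x.
  have : cover P id x by rewrite cP.
  by move=> [C PC Cx]; exists C => //; move: PC; rewrite Ps.
have exi x : exists i : 'I_(size s), tnth (in_tuple s) i x.
  have [C Cs Cx] := ex x; have iC : (index C s < size s)%N by rewrite index_mem.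
  by exists (Ordinal iC); rewrite (tnth_nth C)/= nth_index.
have [l lP] := choice exi.
have tnthP i : P (tnth (in_tuple s) i) by rewrite Ps/=; exact: mem_tnth.
have luniq x i : tnth (in_tuple s) i x -> l x = i.
  move=> ix; have e : tnth (in_tuple s) (l x) = tnth (in_tuple s) i.
    by apply: tP => //; exists x; split => //; exact: lP.
  apply/eqP; rewrite -val_eqE /=; rewrite !(tnth_nth set0)/= in e.
  by rewrite -(nth_uniq set0 (ltn_ord (l x)) (ltn_ord i) us) e.
have cellE i : [set x | l x = i] = tnth (in_tuple s) i.
  by apply/seteqP; split => x /= => [<-|]; [exact: lP|exact: luniq].
constructor; apply: (@Labelling _ _ (size s) l).
- rewrite Ps; apply/seteqP; split => C /=.
    move=> /(nthP set0)[i iC <-]; exists (Ordinal iC) => //.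
    by rewrite cellE (tnth_nth set0).
  by move=> [i _ <-]; rewrite cellE; exact: mem_tnth.
- move=> j; have [x jx] := nP _ (tnthP j); exists x; exact: luniq.
- by move=> j; rewrite cellE; exact: mP.
Qed.

Section names.
Context {R : realType} {X : compactMetricType R} {V : finType}.
Context {P : set (set X)}.
Variable l : labelling P.
Local Notation XV := {ptws V -> X}.

Definition name (x : XV) : {ffun V -> 'I_(labels l)} := [ffun v => l (x v)].

Definition name_cell (b : {ffun V -> 'I_(labels l)}) : set XV :=
  [set x | name x = b].

Lemma name_cellE b : name_cell b = [set x : XV | forall v, [set y | l y = b v] (x v)].
Proof.
apply/seteqP; split => x /=; first by move=> <- v; rewrite ffunE.
by move=> h; apply/ffunP => v; rewrite ffunE; exact: h.
Qed.

Lemma measurable_name_cell b : measurable (name_cell b : set (borel XV)).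
Proof.
rewrite name_cellE.
have -> : [set x : XV | forall v, [set y | l y = b v] (x v)] =
    \bigcap_(v in [set: V]) ((fun x : XV => x v) @^-1` [set y | l y = b v]).
  by apply/seteqP; split => x h v; [move=> _|]; exact: h.
apply: fin_bigcap_measurable; first exact: finite_finset.
move=> v _; rewrite -[X in measurable X]setTI.
apply: (@continuous_borel XV X (fun x => x v)) => //; last exact: label_measurable.
exact: continuous_coord.
Qed.

Lemma name_surj b : exists x, name x = b.
Proof.
have [x xP] := choice (fun v => label_surj (b v)).
by exists x; apply/ffunP => v; rewrite ffunE; exact: xP.
Qed.

(** Every label is used, so distinct names have distinct cells and the two sums
    have the same terms. *)
Lemma shannon_name (m : Prob R XV) :
  shannon m (power_partition V P) = entropy (fun b => fine (m (name_cell b))).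
Proof.
rewrite /shannon /entropy; congr (- _).
have ur : uniq [seq name_cell b | b <- enum {ffun V -> 'I_(labels l)}].
  rewrite map_inj_uniq ?enum_uniq// => b b' bb'.
  have [x xb] := name_surj b.
  by have : name_cell b x by []; rewrite bb' /name_cell/= xb.
rewrite (_ : power_partition V P = [set` [seq name_cell b | b <- enum {ffun V -> 'I_(labels l)}]]).
  by rewrite -fsbig_seq// big_map big_enum.
apply/seteqP; split => C /=.
  move=> [c cP <-].
  have cl v : exists j, c v = [set y | l y = j].
    exact/(labellingP l)/cP.
  have [j jP] := choice cl.
  apply/mapP; exists [ffun v => j v]; first by rewrite mem_enum.
  rewrite name_cellE; apply/seteqP; split => x /= h v; have := h v.
    by rewrite jP ffunE.
  by rewrite jP ffunE.
move=> /mapP[b _ ->]; exists (fun v => [set y | l y = b v]).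
  by move=> v /=; apply/(labellingP l); exists (b v).
by rewrite name_cellE.
Qed.

End names.

Section finite_law_names.
Context {R : realType} {X : compactMetricType R} {V : finType}.
Context {P : set (set X)} (l : labelling P).

Lemma shannon_fin_law (A : finType) (p : fdist R A) (x : A -> {ptws V -> X}) :
  shannon (fin_law p x) (power_partition V P) =
  entropy (fdist_image p (fun a => name l (x a))).
Proof.
rewrite (shannon_name l); congr entropy; apply/funext => b.
rewrite -[X in fine X]/(fin_law p x (name_cell b)) fin_lawE/= /image_fun; apply: eq_bigl => a.
by apply/idP/eqP => [/set_mem|] //; exact: mem_set.
Qed.

End finite_law_names.

(** * Local weak* convergence through test functions *)

Section frac_lemmas.
Context {R : realType} {G : Type} (s : symMap G).
Local Notation V := (vertices s).
Local Notation frac := (@Defs.frac R G s).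

Lemma vertices_gt0R : (0 : R) < #|V|%:R.
Proof. by rewrite ltr0n vertices_gt0. Qed.

Lemma fracE (P : pred V) : frac P = (\sum_v (P v)%:R) / #|V|%:R.
Proof. by rewrite /Defs.frac -sum1_card natr_sum big_mkcond/=; congr (_ / _); apply: eq_bigr => v _; rewrite inE; case: (P v). Qed.

Lemma frac_ge0 (P : pred V) : 0 <= frac P.
Proof. by rewrite divr_ge0. Qed.

Lemma frac_predC (P : pred V) : frac P = 1 - frac (predC P).
Proof.
rewrite !fracE; apply/eqP; rewrite eq_sym subr_eq -mulrDl -big_split/=.
rewrite (eq_bigr (fun=> 1)) => [|v _]; last by case: (P v); rewrite ?addr0 ?add0r.
by rewrite sumr_const divff// gt_eqF// vertices_gt0R.
Qed.

Lemma frac_le1 (P : pred V) : frac P <= 1.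
Proof. by rewrite frac_predC gerBl frac_ge0. Qed.

Lemma le_frac (P Q : pred V) : subpred P Q -> frac P <= frac Q.
Proof.
move=> PQ; rewrite !fracE ler_wpM2r// ler_sum// => v _; rewrite ler_nat.
by case Pv : (P v) => //; rewrite (PQ v Pv).
Qed.

Lemma frac_has (T : eqType) (r : seq T) (Q : T -> pred V) :
  frac (fun v => has (Q^~ v) r) <= \sum_(t <- r) frac (Q t).
Proof.
elim: r => [|t r ih]; first by rewrite big_nil fracE big1 ?mul0r.
rewrite big_cons; apply: le_trans (lerD (lexx _) ih); rewrite !fracE -mulrDl.
rewrite ler_wpM2r// -big_split/= ler_sum// => v _; rewrite -natrD ler_nat.
by case: (Q t v); case: (has _ _).
Qed.

Lemma frac_markov (f : V -> R) (e : R) : 0 < e -> (forall v, 0 <= f v) ->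
  frac (fun v => e <= f v) <= (\sum_v f v) / #|V|%:R / e.
Proof.
move=> e0 f0; rewrite fracE mulrAC ler_wpM2r// ler_pdivlMr// mulr_suml.
apply: ler_sum => v _; case: (leP e (f v)) => h; first by rewrite mul1r.
by rewrite mul0r.
Qed.

End frac_lemmas.

Lemma cvg_to1 (R : realType) (u : nat -> R) :
  (forall n, u n <= 1) ->
  (forall e, 0 < e -> \forall n \near \oo, 1 - u n <= e) <-> (u n @[n --> \oo] --> (1 : R)).
Proof.
move=> u1; split=> [h|h e e0].
  apply/cvgrPdist_le => e e0; have := h e e0; apply: filterS => n.
  by rewrite ger0_norm// subr_ge0.
have /cvgrPdist_le := h => /(_ e e0); apply: filterS => n; apply: le_trans.
exact: ler_norm.
Qed.

(** A weak* neighbourhood is controlled by finitely many functions of a dense family,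
    and the exceptional vertices of these functions add up. *)
Lemma lwstar_of_tests (R : realType) (G : countGroupType) (X : ptopologicalType)
    (K : eqType) (test : K -> {ptws G -> X} -> R)
    (sigma : nat -> symMap G)
    (mu_ : forall n, Prob R {ptws vertices (sigma n) -> X}) (mu : Prob R {ptws G -> X}) :
  compact [set: {ptws G -> X}] -> (forall t, continuous (test t)) ->
  (forall (f : {ptws G -> X} -> R) (eps : R), continuous f -> 0 < eps ->
    exists (I : finType) (a : I -> R) (t : I -> K),
      forall y, `|f y - \sum_i a i * test (t i) y| <= eps) ->
  (forall t e, 0 < e -> \forall n \near \oo,
     frac R (fun v => e <= `|\int[mu_ n]_x test t (pullback v x) - \int[mu]_y test t y|) <= e) ->
  lwstar_cvg mu_ mu.
Proof.
move=> cG ct dense h U oU.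
have [r [e [e0 eU]]] := nbhs_wstar_dense cG ct dense oU.
have bt t : bounded_measurable (test t : borel {ptws G -> X} -> R).
  exact: continuous_bounded_measurable.
apply/cvg_to1 => [n|e' e'0]; first exact: frac_le1.
pose e2 := Num.min e (e' / (size r).+1%:R).
have e20 : 0 < e2 by rewrite lt_min e0 divr_gt0.
have : \forall n \near \oo, forall t, t \in r ->
    frac R (fun v : vertices (sigma n) => e2 <= `|\int[mu_ n]_x test t (pullback v x) - \int[mu]_y test t y|) <= e2.
  elim: (r) => [|t r' ih]; first exact: nearW.
  apply: filterS2 (h t e2 e20) ih => n h1 h2 t'.
  by rewrite inE => /orP[/eqP ->//|]; exact: h2.
apply: filterS => n hn; rewrite frac_predC opprB addrC subrK.
apply: (@le_trans _ _ (\sum_(t <- r) frac R (fun v : vertices (sigma n) =>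
    e2 <= `|\int[mu_ n]_x test t (pullback v x) - \int[mu]_y test t y|))).
  apply: le_trans (frac_has _ _); apply: le_frac => v /=.
  apply: contraR => /hasPn hv; apply/asboolP; apply: eU => t tr.
  rewrite expect_distribution//.
  have := hv t tr; rewrite -ltNge => /lt_le_trans; apply.
  by rewrite ge_min lexx.
apply: (@le_trans _ _ (\sum_(t <- r) e2)).
  by rewrite big_seq [leRHS]big_seq; apply: ler_sum => t tr; exact: hn.
rewrite big_const_seq count_predT iter_addr_0 -mulr_natr.
apply: (@le_trans _ _ (e' / (size r).+1%:R * (size r)%:R)).
  by rewrite ler_wpM2r// ge_min lexx orbT.
rewrite -mulrA ler_piMr//; first exact: ltW.
by rewrite mulrC ler_pdivrMr// mul1r ler_nat.
Qed.

(** A continuous function and a threshold cut out a weak* neighbourhood. *)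
Lemma lwstar_tests (R : realType) (G : countGroupType) (X : ptopologicalType)
    (sigma : nat -> symMap G)
    (mu_ : forall n, Prob R {ptws vertices (sigma n) -> X}) (mu : Prob R {ptws G -> X})
    (f : {ptws G -> X} -> R) :
  compact [set: {ptws G -> X}] -> continuous f -> lwstar_cvg mu_ mu ->
  forall e, 0 < e -> \forall n \near \oo,
     frac R (fun v => e <= `|\int[mu_ n]_x f (pullback v x) - \int[mu]_y f y|) <= e.
Proof.
move=> cG cf h e e0.
have bf : bounded_measurable (f : borel {ptws G -> X} -> R).
  exact: continuous_bounded_measurable.
have hc := h _ (open_nbhs_wstar mu cf e0).
have := (cvg_to1 (fun n => frac_le1 _)).2 hc e e0.
apply: filterS => n; apply: le_trans; rewrite [in leRHS]frac_predC opprB addrC subrK.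
apply: le_frac => v /=; rewrite leNgt; apply: contra => /asboolP/=.
by rewrite expect_distribution.
Qed.

(** * Averages over slices and the law of a random row *)

Lemma infinite_injection (T : choiceType) : infinite_set [set: T] ->
  exists h : nat -> T, injective h.
Proof.
move=> infT.
have /choice[fresh freshP] : forall s : seq T, exists x, x \notin s.
  move=> s; apply: contrapT => /forallNP all_s; apply: infT.
  apply: (@sub_finite_set _ _ [set` s]); last exact: finite_seq.
  by move=> x _ /=; have /negP := all_s x; rewrite negbK.
pose g := fix g n := if n is n'.+1 then fresh (g n') :: g n' else [::].
have gin i n : (i < n)%N -> fresh (g i) \in g n.
  elim: n => // n ih; rewrite ltnS leq_eqVlt => /orP[/eqP ->|/ih h].
    by rewrite /= inE eqxx.
  by rewrite /= inE h orbT.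
exists (fresh \o g) => i j /= e; have [/gin ij|/gin ji|//] := ltngtP i j.
  by have := freshP (g j); rewrite -e ij.
by have := freshP (g i); rewrite e ji.
Qed.

Lemma jensen_square (R : realType) (I : finType) (u : I -> R) :
  (\sum_i u i) ^+ 2 <= #|I|%:R * \sum_i u i ^+ 2.
Proof.
rewrite expr2 mulr_suml.
apply: (@le_trans _ _ (\sum_i \sum_j (u i ^+ 2 + u j ^+ 2) / 2)).
  apply: ler_sum => i _; rewrite mulr_sumr; apply: ler_sum => j _.
  have := sqr_ge0 (u i - u j); nra.
rewrite (eq_bigr (fun i => (#|I|%:R * u i ^+ 2 + \sum_j u j ^+ 2) / 2)); last first.
  move=> i _; rewrite -mulr_suml; congr (_ / _).
  by rewrite big_split/= sumr_const mulr_natl.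
rewrite -mulr_suml big_split/= -mulr_sumr sumr_const -[X in _ + X]mulr_natl.
set S := \sum_i _; lra.
Qed.

Section slice_averages.
Context {R : realType} {G H : countGroupType} {X : compactMetricType R}.
Variables (mu : Prob R {ptws G -> X}) (nu : Prob R {ptws (G * H)%type -> X}).
Hypothesis coind : is_coinduction mu nu.
Variables (f : {ptws G -> X} -> R).
Hypothesis cf : continuous f.
Hypothesis f01 : forall x, 0 <= f x <= 1.
Variables (m : nat) (h_ : 'I_m.+1 -> H).
Hypothesis h_inj : injective h_.

(** The error made when the mean of [f] under [mu] is estimated from the slices
    [h_ i] of one point. *)
Definition slice_deviation (y : {ptws (G * H)%type -> X}) : R :=
  m.+1%:R^-1 * (\sum_i f (slice (h_ i) y)) - \int[mu]_x f x.

Lemma slice_deviation_continuous : continuous slice_deviation.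
Proof.
apply: continuousD'; last exact: cst_continuous.
apply: continuousM'; first exact: cst_continuous.
apply: continuous_sum' => i y.
apply: continuous_comp; first exact: slice_continuous.
exact: cf.
Qed.

Let bf : bounded_measurable (f : borel {ptws G -> X} -> R).
Proof. exact: (continuous_bounded_measurable (@compact_ptws R G X) cf). Qed.

Lemma expect_unit_itv (p : Prob R {ptws G -> X}) : 0 <= \int[p]_x f x <= 1.
Proof.
apply/andP; split; first by apply: Rintegral_ge0 => x _; case/andP: (f01 x).
rewrite -(expect_cst p 1); apply: expect_le => //; first exact: bounded_measurable_cst.
by move=> x; case/andP: (f01 x).
Qed.

(** The slices are independent and identically distributed under [nu], so the
    variance of their average is the variance of one slice divided by [m.+1]. *)
Lemma expect_slice_deviation : \int[nu]_y (slice_deviation y ^+ 2) <= m.+1%:R^-1.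
Proof.
set I := \int[mu]_x f x.
have n0 : (0 : R) < m.+1%:R by rewrite ltr0n.
have bs i : bounded_measurable (f \o slice (h_ i) : borel {ptws (G * H)%type -> X} -> R).
  exact: slice_bounded_measurable.
have b1 i : bounded_measurable ((fun y => f (slice (h_ i) y) - I)
    : borel {ptws (G * H)%type -> X} -> R).
  by apply: bounded_measurableB; [exact: bs|exact: bounded_measurable_cst].
have E1 i : \int[nu]_y f (slice (h_ i) y) = I.
  have := @expect_coinduction _ _ _ _ _ _ coind [:: h_ i] isT (fun=> f) (fun=> bf.1) (fun=> f01).
  rewrite big_seq1 /I => <-; apply: eq_Rintegral => y _.
  by rewrite big_seq1.
have E2 i j : i != j -> \int[nu]_y (f (slice (h_ i) y) * f (slice (h_ j) y)) = I * I.
  move=> ij.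
  have ur : uniq [:: h_ i; h_ j].
    by rewrite /= inE andbT; apply: contra_neq ij => /h_inj.
  have := @expect_coinduction _ _ _ _ _ _ coind _ ur (fun=> f) (fun=> bf.1) (fun=> f01).
  rewrite big_cons big_seq1 /I => <-; apply: eq_Rintegral => y _.
  by rewrite big_cons big_seq1.
have sqE y : slice_deviation y ^+ 2 =
    m.+1%:R^-2 * \sum_i \sum_j (f (slice (h_ i) y) - I) * (f (slice (h_ j) y) - I).
  rewrite /slice_deviation -/I.
  have -> : m.+1%:R^-1 * (\sum_i f (slice (h_ i) y)) - I =
      m.+1%:R^-1 * \sum_i (f (slice (h_ i) y) - I).
    rewrite sumrB mulrBr sumr_const card_ord -[I *+ _]mulr_natl mulrA mulVf ?mul1r//.
  rewrite exprMn exprVn expr2; congr (_ * _).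
  by rewrite expr2 mulr_suml; apply: eq_bigr => i _; rewrite mulr_sumr.
have bij i j : bounded_measurable ((fun y => (f (slice (h_ i) y) - I) *
    (f (slice (h_ j) y) - I)) : borel {ptws (G * H)%type -> X} -> R).
  exact: bounded_measurableM.
have bsum i : bounded_measurable ((fun y => \sum_j (f (slice (h_ i) y) - I) *
    (f (slice (h_ j) y) - I)) : borel {ptws (G * H)%type -> X} -> R).
  exact: bounded_measurable_sum.
have -> : \int[nu]_y (slice_deviation y ^+ 2) = m.+1%:R^-2 *
    \sum_i \sum_j \int[nu]_y ((f (slice (h_ i) y) - I) * (f (slice (h_ j) y) - I)).
  transitivity (\int[nu]_y (m.+1%:R^-2 * \sum_i \sum_j
      (f (slice (h_ i) y) - I) * (f (slice (h_ j) y) - I))).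
    by apply: eq_Rintegral => y _; exact: sqE.
  rewrite expectZ; last exact: bounded_measurable_sum.
  rewrite expect_sum//; congr (_ * _); apply: eq_bigr => i _.
  by rewrite expect_sum.
have cov0 i j : i != j ->
    \int[nu]_y ((f (slice (h_ i) y) - I) * (f (slice (h_ j) y) - I)) = 0.
  move=> ij.
  have bcst (c : R) : bounded_measurable ((fun=> c) : borel {ptws (G * H)%type -> X} -> R).
    exact: bounded_measurable_cst.
  transitivity (\int[nu]_y ((f (slice (h_ i) y) * f (slice (h_ j) y) - I * f (slice (h_ i) y)) -
      (I * f (slice (h_ j) y) - I * I))).
    by apply: eq_Rintegral => y _; ring.
  have bI k : bounded_measurable ((fun y => I * f (slice (h_ k) y))
      : borel {ptws (G * H)%type -> X} -> R).
    by apply: bounded_measurableM => //; exact: bs.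
  have bff : bounded_measurable ((fun y => f (slice (h_ i) y) * f (slice (h_ j) y))
      : borel {ptws (G * H)%type -> X} -> R).
    by apply: bounded_measurableM; exact: bs.
  have EZ k : \int[nu]_y (I * f (slice (h_ k) y)) = I * I.
    by rewrite expectZ ?E1//; exact: bs.
  rewrite expectB; last 2 first.
  - exact: bounded_measurableB.
  - exact: bounded_measurableB.
  by rewrite expectB// [X in _ - X]expectB// E2// !EZ expect_cst; ring.
have var1 i : \int[nu]_y ((f (slice (h_ i) y) - I) * (f (slice (h_ i) y) - I)) <= 1.
  rewrite -(expect_cst nu 1); apply: expect_le; [exact: bij|exact: bounded_measurable_cst|].
  move=> y; have /andP[a0 a1] := f01 (slice (h_ i) y).
  have /andP[b0 b1'] := expect_unit_itv mu; rewrite -/I in b0 b1'.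
  by nra.
apply: (@le_trans _ _ (m.+1%:R^-2 * \sum_(i < m.+1) 1)).
  rewrite ler_wpM2l ?invr_ge0 ?exprn_ge0//; apply: ler_sum => i _.
  rewrite (bigD1 i)//= big1 ?addr0// => j ji; apply: cov0.
  by rewrite eq_sym.
rewrite sumr_const card_ord expr2 invfM -mulrA -[_ *+ _]mulr_natl mulr1 mulVf ?mulr1//.
Qed.

Section averaging.
Variables (s : symMap G) (t : symMap H).
Local Notation V := (vertices s).
Local Notation W := (vertices t).
Variables (A : finType) (A0 : (0 < #|A|)%N).
Variable x : A -> {ptws vertices (prod_map s t) -> X}.

Definition row (a : A) (w : W) : {ptws V -> X} := fun v => x a (v, w).

Lemma pullback_slice a v w h :
  slice h (pullback ((v, w) : vertices (prod_map s t)) (x a)) = pullback v (row a (t h w)).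
Proof. by apply/funext => g; rewrite /slice /pullback/= permE. Qed.

(** Each [t (h_ i)] permutes the rows, so averaging [f] over all rows is the same
    as averaging over the rows [t (h_ i) w] for all [i] and [w]. The average of
    [f] at [v] thus deviates by the mean of slice deviations, and Jensen applies. *)
Lemma average_row_deviation :
  (\sum_v ((\sum_a \sum_w f (pullback v (row a w))) / (#|A| * #|W|)%:R
     - \int[mu]_x f x) ^+ 2) / #|V|%:R <=
  (\sum_a \int[empirical (x a)]_y (slice_deviation y ^+ 2)) / #|A|%:R.
Proof.
set I := \int[mu]_x f x.
have n0 : (0 : R) < m.+1%:R by rewrite ltr0n.
have A0R : (0 : R) < #|A|%:R by rewrite ltr0n.
have W0 : (0 : R) < #|W|%:R := vertices_gt0R t.
have V0 : (0 : R) < #|V|%:R := vertices_gt0R s.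
pose D v (aw : A * W) := slice_deviation (pullback ((v, aw.2) : vertices (prod_map s t)) (x aw.1)).
have DE v a : \sum_w D v (a, w) = \sum_w f (pullback v (row a w)) - #|W|%:R * I.
  rewrite /D /slice_deviation sumrB -/I sumr_const mulr_natl; congr (_ - _).
  rewrite -mulr_sumr exchange_big/=.
  rewrite (eq_bigr (fun=> \sum_w f (pullback v (row a w)))); last first.
    move=> i _; under eq_bigr do rewrite pullback_slice.
    by rewrite [RHS](reindex_inj (@perm_inj _ (t (h_ i)))).
  by rewrite sumr_const card_ord -(mulr_natl (\sum_w f (pullback v (row a w)))) mulrA mulVf ?mul1r.
have SE v : (\sum_a \sum_w f (pullback v (row a w))) / (#|A| * #|W|)%:R - I =
    (\sum_aw D v aw) / (#|A| * #|W|)%:R.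
  rewrite -(pair_bigA _ (fun a w => D v (a, w)))/=.
  under [in RHS]eq_bigr do rewrite DE.
  rewrite sumrB sumr_const -[_ *+ #|A|]mulr_natl mulrBl; congr (_ - _).
  by rewrite natrM mulrA mulrAC divff ?mul1r// gt_eqF// mulr_gt0.
have AW0 : (0 : R) < (#|A| * #|W|)%:R by rewrite natrM mulr_gt0.
have bd2 : bounded_measurable ((fun y => slice_deviation y ^+ 2)
    : borel {ptws (G * H)%type -> X} -> R).
  apply: (continuous_bounded_measurable (@compact_ptws R (G * H)%type X)).
  by move=> y; apply: continuousM'; exact: slice_deviation_continuous.
under [in leRHS]eq_bigr do rewrite expect_empirical//.
rewrite -mulr_suml.
apply: (@le_trans _ _ ((\sum_v (\sum_aw D v aw ^+ 2) / (#|A| * #|W|)%:R) / #|V|%:R)).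
  rewrite ler_wpM2r ?invr_ge0 ?(ltW V0)//; apply: ler_sum => v _.
  rewrite SE exprMn exprVn ler_pdivrMr ?exprn_gt0// expr2 mulrA divfK ?gt_eqF//.
  rewrite mulrC.
  by have := jensen_square (D v); rewrite card_prod expr2 => /le_trans; apply; rewrite mulrC.
rewrite -mulr_suml exchange_big/= -(pair_bigA _ (fun a w => \sum_v D v (a, w) ^+ 2))/=.
rewrite le_eqVlt; apply/orP; left; apply/eqP.
rewrite natrM card_prod natrM !invfM.
rewrite (eq_bigr (fun a => \sum_(vw : vertices (prod_map s t)) slice_deviation (pullback vw (x a)) ^+ 2)); last first.
  move=> a _; rewrite exchange_big/= (pair_bigA _ (fun v w => D v (a, w) ^+ 2))/=.
  by apply: eq_bigr => -[v w] _.
ring.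
Qed.

End averaging.

End slice_averages.

Section uniform.
Context {R : realType} (A : finType) (A0 : (0 < #|A|)%N).

Lemma uniform_ge0 (a : A) : 0 <= #|A|%:R^-1 :> R.
Proof. by rewrite invr_ge0. Qed.

Lemma uniform_sum1 : \sum_(a : A) #|A|%:R^-1 = 1 :> R.
Proof. by rewrite sumr_const -(mulr_natl (#|A|%:R^-1 : R)) divff// pnatr_eq0 -lt0n. Qed.

Definition uniform := FDist uniform_ge0 uniform_sum1.

End uniform.

Section mean_dist_lemmas.
Context {R : realType} {X : compactMetricType R} {V : finType}.

Lemma mean_dist_lt (x y : {ptws V -> X}) (delta : R) : (0 < #|V|)%N ->
  (forall v, mdist (x v) (y v) < delta) -> mean_dist x y < delta.
Proof.
move=> V0 xy; have V0R : (0 : R) < #|V|%:R by rewrite ltr0n.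
rewrite /mean_dist ltr_pdivrMr// mulr_natr -sumr_const.
have [v0 _] : exists v : V, true by move: V0 => /card_gt0P[v _]; exists v.
rewrite (bigD1 v0)//= [ltRHS](bigD1 v0)//= ltr_leD// ler_sum// => v _.
exact: ltW.
Qed.

Lemma mdist_diameter (C : set X) (delta : R) x y : (diameter C < delta%:E)%E ->
  C x -> C y -> mdist x y < delta.
Proof.
move=> Cd Cx Cy; rewrite -lte_fin; apply: le_lt_trans Cd.
by apply: ereal_sup_ubound; exists x => //; exists y.
Qed.

(** Choosing one model per name gives a family with distinct names, whose balls
    cover once the cells are small. *)
Lemma distinct_name_cover (P : set (set X)) (l : labelling P) (delta : R)
    (F : set {ptws V -> X}) : (0 < #|V|)%N ->
  (forall C, P C -> (diameter C < delta%:E)%E) ->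
  exists (A : finType) (x : A -> {ptws V -> X}),
    [/\ forall a, F (x a), injective (fun a => name l (x a)) &
        (cov delta F <= #|A|%:R%:E)%E].
Proof.
move=> V0 small.
pose A : finType := {b : {ffun V -> 'I_(labels l)} | `[< exists x, F x /\ name l x = b >]}.
have ex (a : A) : exists x, F x /\ name l x = val a by exact/asboolP/(valP a).
have [x xP] := choice ex.
exists A, x; split.
- by move=> a; exact: (xP a).1.
- by move=> a a'; rewrite (xP a).2 (xP a').2; exact: val_inj.
- apply: ereal_inf_lbound; exists #|A| => //.
  exists (fun i => x (enum_val i)) => y Fy.
  have yA : `[< exists x, F x /\ name l x = name l y >] by apply/asboolP; exists y.
  exists (enum_rank (Sub (name l y) yA : A)) => //=.
  rewrite enum_rankK; apply: mean_dist_lt => // v.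
  apply: (mdist_diameter (C := [set z | l z = l (y v)])) => //.
    by apply: small; apply/(labellingP l); exists (l (y v)).
  have [_] := xP (Sub (name l y) yA : A); rewrite /= => /ffunP/(_ v).
  by rewrite !ffunE.
Qed.

End mean_dist_lemmas.

(** Gibbs against the product of the average row law: distinct names force the
    average row to have entropy at least [ln #|A| / #|W|]. *)
Lemma ln_card_le_row_entropy (R : realType) (G H : countGroupType)
    (X : compactMetricType R) (s : symMap G) (t : symMap H)
    (P : set (set X)) (l : labelling P) (A : finType)
    (x : A -> {ptws vertices (prod_map s t) -> X})
    (AW0 : (0 < #|{: A * vertices t}|)%N) :
  injective (fun a => name l (x a)) ->
  ln #|A|%:R <= #|vertices t|%:R *
    entropy (fdist_image (@uniform R _ AW0) (fun aw => name l (row x aw.1 aw.2))).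
Proof.
move=> inj; set W := vertices t.
have A0 : (0 < #|A|)%N by move: AW0; rewrite card_prod muln_gt0 => /andP[].
have W0 : (0 < #|W|)%N by exact: vertices_gt0.
have A0R : (0 : R) < #|A|%:R by rewrite ltr0n.
have W0R : (0 : R) < #|W|%:R by rewrite ltr0n.
set nm := fun aw : A * W => name l (row x aw.1 aw.2).
set q := fdist_image _ _.
have qpos a w : 0 < q (nm (a, w)).
  rewrite /q/= /image_fun (bigD1 (a, w))//= ltr_pwDl//.
    by rewrite invr_gt0 ltr0n.
  by apply: sumr_ge0 => aw _; rewrite invr_ge0.
pose q' a := \prod_w q (nm (a, w)).
have q'0 a : 0 < q' a by exact: prodr_gt0.
have q'1 : \sum_a q' a <= 1.
  rewrite -(pow_fun_sum1 W q).
  pose emb a : {ffun W -> {ffun vertices s -> 'I_(labels l)}} := [ffun w => nm (a, w)].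
  have embI : injective emb.
    move=> a a' /ffunP e; apply: inj; apply/ffunP => -[v w]; rewrite !ffunE.
    by have := e w; rewrite !ffunE => /ffunP/(_ v); rewrite !ffunE.
  rewrite (eq_bigr (fun a => pow_fun q (emb a))); last first.
    by move=> a _; apply: eq_bigr => w _; rewrite ffunE.
  rewrite [leLHS](_ : _ = \sum_(n in emb @: predT) pow_fun q n); last first.
    rewrite big_imset/=; last by move=> a a' _ _; exact: embI.
    by [].
  rewrite [leRHS](bigID (mem (emb @: predT)))/= lerDl.
  by apply: sumr_ge0 => n _; exact: pow_fun_ge0.
have u := @uniform R A A0.
have -> : ln #|A|%:R = entropy (@uniform R A A0).
  rewrite /entropy/= sumr_const -(mulr_natl (_ * _)) mulrA divff ?mul1r ?gt_eqF//.
  by rewrite lnV ?opprK// posrE.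
apply: le_trans (gibbs (fdist_ge0 _) (fdist_sum1 _) (fun a => ltW (q'0 a))
  (fun a _ => q'0 a) q'1) _.
rewrite /entropy mulrN lerN2 /= (expect_image _ nm (fun b => ln (q b)))/=.
rewrite -(pair_bigA _ (fun a w => #|{: A * W}|%:R^-1 * ln (q (nm (a, w)))))/=.
rewrite mulr_sumr le_eqVlt; apply/orP; left; apply/eqP; apply: eq_bigr => a _.
rewrite /q' ln_prod//.
rewrite -mulr_sumr mulrA; congr (_ * _).
by rewrite card_prod natrM invfM mulrCA divff ?mulr1// gt_eqF.
Qed.

Section average_row_law.
Context {R : realType} {G H : countGroupType} {X : compactMetricType R}.
Variables (s : symMap G) (t : symMap H).
Context {P : set (set X)} (l : labelling P) (delta c : R).
Hypothesis small : forall C, P C -> (diameter C < delta%:E)%E.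
Variables (mu : Prob R {ptws G -> X}) (U : set (Prob R {ptws (G * H)%type -> X})).

(** The law [m] is that of a uniform row of a uniform model, the models being good
    for [U] with one model for each name that occurs. Good models whose slices
    average correctly make [m] locally close to [mu]. *)
Lemma average_row_law :
  (c%:E < (#|vertices (prod_map s t)|%:R^-1)%:E *
    lne (cov delta (good_models (prod_map s t) U)))%E ->
  exists m : Prob R {ptws vertices s -> X},
    c <= #|vertices s|%:R^-1 * shannon m (power_partition (vertices s) P) /\
    forall (f : {ptws G -> X} -> R) (k : nat) (h_ : 'I_k.+1 -> H) (B : R),
      continuous f -> (forall x, 0 <= f x <= 1) ->
      (forall p, U p -> \int[p]_y (slice_deviation mu f h_ y ^+ 2) <= B) ->
      (\sum_v (\int[m]_x f (pullback v x) - \int[mu]_x f x) ^+ 2) / #|vertices s|%:R <= B.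
Proof.
have V0 := vertices_gt0R (R := R) s; have W0 := vertices_gt0R (R := R) t.
have N0 := vertices_gt0R (R := R) (prod_map s t).
have [A [x [xU x_inj covA]]] := distinct_name_cover l
  (good_models (prod_map s t) U) (vertices_gt0 (prod_map s t)) small.
move=> cU.
have cA : (c%:E < (#|vertices (prod_map s t)|%:R^-1)%:E * lne (#|A|%:R%:E : \bar R))%E.
  apply: (lt_le_trans cU); rewrite lee_wpmul2l ?lee_fin ?invr_ge0//.
  by rewrite lee_lne ?in_itv/= ?leey ?cov_ge0 ?lee_fin ?ler0n.
have A0 : (0 < #|A|)%N.
  rewrite lt0n; apply/eqP => A0; move: cA; rewrite A0 le0_lneNy//.
  by rewrite gt0_muleNy ?lte_fin ?invr_gt0.
have A0R : (0 : R) < #|A|%:R by rewrite ltr0n.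
have AW0 : (0 < #|{: A * vertices t}|)%N by rewrite card_prod muln_gt0 A0 vertices_gt0.
have clnA : c * (#|vertices s|%:R * #|vertices t|%:R) <= ln #|A|%:R.
  move: cA; rewrite lne_EFin// -EFinM lte_fin => /ltW.
  by rewrite card_prod natrM mulrC ler_pdivlMr ?mulr_gt0.
pose r aw := row x aw.1 aw.2.
exists (fin_law (@uniform R _ AW0) r : Prob R {ptws vertices s -> X}); split.
  rewrite (shannon_fin_law l) ler_pdivlMl// -(ler_pM2l W0).
  apply: le_trans (ln_card_le_row_entropy AW0 x_inj).
  by apply: le_trans clnA; rewrite le_eqVlt; apply/orP; left; apply/eqP; ring.
move=> f k h_ B cf f01 UB.
have bf v : bounded_measurable ((fun y => f (pullback v y)) : borel {ptws vertices s -> X} -> R).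
  apply: (continuous_bounded_measurable (@compact_ptws R (vertices s) X)) => y.
  by apply: continuous_comp; [exact: continuous_pullback|exact: cf].
have := average_row_deviation mu cf h_ A0 x.
rewrite (eq_bigr (fun v => (\int[fin_law (@uniform R _ AW0) r]_y f (pullback v y) - \int[mu]_y f y) ^+ 2)); last first.
  move=> v _; rewrite expect_fin_law//=; congr ((_ - _) ^+ 2).
  rewrite -mulr_sumr mulrC card_prod; congr (_ * _).
  by rewrite (pair_bigA _ (fun a w => f (pullback v (row x a w)))).
move=> /le_trans; apply.
rewrite ler_pdivrMr// mulr_natr -sumr_const; apply: ler_sum => a _.
by apply: UB; exact: xU.
Qed.

End average_row_law.

Lemma open_nbhs_all (T : topologicalType) (K : eqType) (r : seq K) (x : T)
    (U : K -> set T) :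
  (forall i, open_nbhs x (U i)) ->
  open_nbhs x [set y | forall i, i \in r -> U i y].
Proof.
move=> oU; elim: r => [|i r ih].
  rewrite (_ : [set y | _] = setT); first by split => //; exact: openT.
  by apply/seteqP; split.
have -> : [set y | forall j, j \in i :: r -> U j y] =
    U i `&` [set y | forall j, j \in r -> U j y].
  apply/seteqP; split => y.
    move=> h; split; first by apply: h; rewrite inE eqxx.
    by move=> j jr; apply: h; rewrite inE jr orbT.
  by move=> [h1 h2] j; rewrite inE => /orP[/eqP ->//|]; exact: h2.
by split; [apply: openI; [exact: (oU i).1|exact: ih.1]|split; [exact: (oU i).2|exact: ih.2]].
Qed.

(** * Sofic entropy is at most partition entropy *)

(** For each neighbourhood [U k] of [nu] in a suitable countable list there is a
    vertex set on which the good models need many balls; the random rows of these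
    models form a sequence that converges locally to [mu] and has large entropy.
    As [H] is infinite, the slice deviations can be averaged over arbitrarily many
    slices. *)
Lemma sofic_le_partition (R : realType) (G H : countGroupType)
    (sigma : nat -> symMap G) (tau : nat -> symMap H) (X : compactMetricType R)
    (mu : Prob R {ptws G -> X}) (nu : Prob R {ptws (G * H)%type -> X})
    (PP : set (set (set X))) :
  is_coinduction mu nu ->
  (forall P, PP P -> finite_borel_partition P) ->
  (forall delta : R, 0 < delta ->
     exists2 P, PP P & forall C, P C -> (diameter C < delta%:E)%E) ->
  infinite_set [set: H] ->
  (sofic_entropy (fun n => prod_map (sigma n) (tau n)) nu <=
    partition_entropy sigma mu PP)%E.
Proof.
move=> coind fbP small infH.
have [h h_inj] := infinite_injection infH.
have [phi [cphi phi01 dense]] := mono_dense X.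
have cmono t : continuous (mono phi t : {ptws G -> X} -> R) by exact: mono_continuous.
have mono01' t (x : {ptws G -> X}) : 0 <= mono phi t x <= 1 by exact: mono01.
pose hm (m : nat) (i : 'I_m.+1) := h i.
have hm_inj m : injective (@hm m) by move=> i j /h_inj /val_inj.
pose K : countType := (seq (G * (nat * nat)) * nat)%type.
pose Dev (i : K) (y : {ptws (G * H)%type -> X}) : R :=
  slice_deviation mu (mono phi i.1) (@hm i.2) y ^+ 2.
have cDev i : continuous (Dev i).
  by move=> y; apply: continuousM'; exact: slice_deviation_continuous.
(* [U k] makes the first [k.+1] squared deviations, in an enumeration of the pairs
   of a test function and a number of slices, close to their means. *)
pose U (k : nat) : set (Prob R {ptws (G * H)%type -> X}) :=
  [set p : Prob R {ptws (G * H)%type -> X} | forall i, i \in pmap (@choice.unpickle K) (iota 0 k.+1) ->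
    `|\int[p]_y Dev i y - \int[nu]_y Dev i y| < k.+1%:R^-1].
have oU k : open_nbhs nu (U k).
  apply: open_nbhs_all => i; apply: open_nbhs_wstar; first exact: cDev.
  by rewrite invr_gt0.
have inU (i : K) k : (choice.pickle i <= k)%N -> i \in pmap (@choice.unpickle K) (iota 0 k.+1).
  move=> ik; rewrite mem_pmap; apply/mapP; exists (choice.pickle i); last by rewrite choice.pickleK.
  by rewrite mem_iota.
apply: lee_of_real => c /ereal_sup_gt[_ [delta /= d0 <-] cinf].
have [P PPP Psmall] := small _ d0.
have [l] := finite_borel_partition_labelling (fbP P PPP).
pose s n := prod_map (sigma n) (tau n).
have freq k n0 : exists n, (n0 <= n)%N /\
    (c%:E < (#|vertices (s n)|%:R^-1)%:E * lne (cov delta (good_models (s n) (U k))))%E.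
  have cU : (c%:E < limn_esup (fun n => (#|vertices (s n)|%:R^-1)%:E *
      lne (cov delta (good_models (s n) (U k)))))%E.
    by apply: (lt_le_trans cinf); apply: ereal_inf_lbound; exists (U k) => //; exact: oU.
  by have [n n0n cn] := frequently_gt_limn_esup n0 cU; exists n.
have /choice[pick1 pickP] : forall kn : nat * nat, exists n, (kn.2 <= n)%N /\
    (c%:E < (#|vertices (s n)|%:R^-1)%:E * lne (cov delta (good_models (s n) (U kn.1))))%E.
  by move=> kn; exact: freq.
pose n_ := fix n_ k := if k is k'.+1 then pick1 (k, (n_ k').+1) else pick1 (0, 0)%N.
have n_mono : {homo n_ : i j / (i < j)%N}.
  apply: (@homo_ltn _ _ (fun a b => (a < b)%N)) => [j i k|i]; first exact: ltn_trans.
  exact: (pickP (i.+1, (n_ i).+1)).1.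
have n_P k : (c%:E < (#|vertices (s (n_ k))|%:R^-1)%:E *
    lne (cov delta (good_models (s (n_ k)) (U k))))%E.
  by case: k => [|k]; exact: (pickP _).2.
have exm k := average_row_law l Psmall mu (n_P k).
pose mu_ k := sval (cid (exm k)).
have mu_P k := svalP (cid (exm k)).
apply: (@le_trans _ _ (limn_esup (fun i => (#|vertices (sigma (n_ i))|%:R^-1)%:E *
    (shannon (mu_ i) (power_partition (vertices (sigma (n_ i))) P))%:E)%E)); last first.
  apply: ereal_sup_ubound; exists P, n_, mu_; split => //.
  apply: (@lwstar_of_tests R G X _ (fun t : seq (G * (nat * nat)) => mono phi t)
    (fun i => sigma (n_ i)) mu_ mu (@compact_ptws R G X) cmono).
    by move=> f eps cf e0; exact: dense.
  move=> t e e0.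
  (* By Markov, squared deviations of mean at most [e ^+ 3] exceed [e ^+ 2] at a
     fraction at most [e] of the vertices. Half of [e ^+ 3] bounds the variance of
     the average over [m.+1] slices, half the tolerance of [U k]. *)
  pose m := Num.truncn (2 / e ^+ 3).
  have e30 : 0 < e ^+ 3 by exact: exprn_gt0.
  have mle k : (m <= k)%N -> k.+1%:R^-1 <= e ^+ 3 / 2.
    move=> mk; rewrite -[leRHS]invrK lef_pV2 ?posrE ?invr_gt0 ?divr_gt0// invf_div.
    by rewrite (le_trans (ltW (truncnS_gt _)))// ler_nat ltnS.
  exists (maxn m (choice.pickle ((t, m) : K))) => // k /=; rewrite geq_max => /andP[mk pk].
  have [_ /(_ (mono phi t) m (@hm m) (m.+1%:R^-1 + k.+1%:R^-1)) bound] := mu_P k.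
  have {}bound : (\sum_v (\int[mu_ k]_x mono phi t (pullback v x) - \int[mu]_x mono phi t x) ^+ 2)
      / #|vertices (sigma (n_ k))|%:R <= e ^+ 3.
    apply: (@le_trans _ _ (m.+1%:R^-1 + k.+1%:R^-1)); last first.
      by have := lerD (mle m (leqnn m)) (mle _ mk); rewrite -splitr.
    apply: bound => // p Up.
    pose F y := slice_deviation mu (mono phi t) (@hm m) y ^+ 2.
    have h1 : \int[p]_y F y - \int[nu]_y F y < k.+1%:R^-1.
      by have := Up (t, m) (inU _ _ pk); rewrite ltr_norml => /andP[].
    have h2 : \int[nu]_y F y <= m.+1%:R^-1.
      have := @expect_slice_deviation _ _ _ _ mu nu coind _ (cmono t) (mono01' t) m (@hm m) (hm_inj m).
      by [].
    by rewrite -[leLHS](subrK (\int[nu]_y F y)) addrC lerD// ltW.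
  have e20 : 0 < e ^+ 2 by exact: exprn_gt0.
  have := frac_markov (s := sigma (n_ k)) (f := fun v =>
    (\int[mu_ k]_x mono phi t (pullback v x) - \int[mu]_x mono phi t x) ^+ 2) e20
    (fun v => sqr_ge0 _).
  move=> /le_trans h2; apply: (@le_trans _ _ (frac R (fun v : vertices (sigma (n_ k)) => e ^+ 2 <=
    (\int[mu_ k]_x mono phi t (pullback v x) - \int[mu]_x mono phi t x) ^+ 2))).
    apply: le_frac => v /= ev; rewrite -(real_normK (num_real (_ - _))).
    by rewrite lerXn2r ?nnegrE// ltW.
  apply: h2; rewrite ler_pdivrMr// -exprS; exact: bound.
apply: limn_esup_ge => n0; exists n0 => //.
by rewrite -EFinM lee_fin; exact: (mu_P n0).1.
Qed.

(** * Replacing laws on configurations by finitely supported ones *)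

Section discretization.
Context {R : realType} {X : compactMetricType R} {V : finType}.
Context {P P' : set (set X)} (l : labelling P) (l' : labelling P').
Variable m : Prob R {ptws V -> X}.
Local Notation XV := {ptws V -> X}.

Definition joint_names : finType :=
  ({ffun V -> 'I_(labels l)} * {ffun V -> 'I_(labels l')})%type.
(** The name with respect to [l] carries the entropy, and the name with respect to
    [l'] determines the point of [X] at each vertex up to a small error. *)
Definition joint_name (y : XV) : joint_names := (name l y, name l' y).
Definition joint_cell (a : joint_names) : set (borel XV) := [set y | joint_name y = a].
Definition joint_weight (a : joint_names) : R := fine (m (joint_cell a)).

Lemma measurable_joint_cell a : measurable (joint_cell a).
Proof.
rewrite (_ : joint_cell a = name_cell a.1 `&` name_cell a.2).
  by apply: measurableI; exact: measurable_name_cell.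
apply/seteqP; split => y; first by rewrite /joint_cell/= => <-.
by case: a => b b' [/= yb yb']; rewrite /joint_cell/= /joint_name yb yb'.
Qed.

Let indicE' (f : joint_names -> R) y :
  f (joint_name y) = \sum_a f a * (\1_(joint_cell a) y : R).
Proof.
rewrite (bigD1 (joint_name y))//= big1 => [|a /eqP ay].
  by rewrite indicE mem_set// mulr1 addr0.
by rewrite indicE memNset ?mulr0// => yE; apply: ay.
Qed.

Let bind (f : joint_names -> R) a :
  bounded_measurable (fun y => f a * (\1_(joint_cell a) y : R)).
Proof.
apply: bounded_measurableM; first exact: bounded_measurable_cst.
by apply: indic_bounded_measurable; exact: measurable_joint_cell.
Qed.

Lemma bounded_measurable_joint_name (f : joint_names -> R) :
  bounded_measurable ((fun y => f (joint_name y)) : borel XV -> R).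
Proof.
rewrite (_ : (fun y => _) = fun y => \sum_a f a * (\1_(joint_cell a) y : R)).
  exact: bounded_measurable_sum.
by apply/funext => y; exact: indicE'.
Qed.

Lemma expect_joint_name (f : joint_names -> R) :
  \int[m]_y f (joint_name y) = \sum_a joint_weight a * f a.
Proof.
transitivity (\int[m]_y (\sum_a f a * (\1_(joint_cell a) y : R))).
  by apply: eq_Rintegral => y _; exact: indicE'.
rewrite expect_sum//; apply: eq_bigr => a _.
rewrite expectZ; last by apply: indic_bounded_measurable; exact: measurable_joint_cell.
by rewrite expect_indic; [rewrite mulrC|exact: measurable_joint_cell].
Qed.

Lemma joint_weight_ge0 a : 0 <= joint_weight a.
Proof. by rewrite fine_ge0. Qed.

Lemma joint_weight_sum1 : \sum_a joint_weight a = 1.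
Proof.
have := expect_joint_name (fun=> 1); rewrite expect_cst => ->.
by apply: eq_bigr => a _; rewrite mulr1.
Qed.

Definition joint_fdist := FDist joint_weight_ge0 joint_weight_sum1.

(** Replacing a law on configurations by point masses, one in each cell of a
    fine partition, keeps the entropy of the coarse names. *)
Lemma discretize : exists x : joint_names -> XV,
  shannon (fin_law joint_fdist x) (power_partition V P) =
    shannon m (power_partition V P) /\
  forall (r e : R) (f : borel XV -> R), (forall C, P' C -> (diameter C < r%:E)%E) ->
    bounded_measurable f ->
    (forall y y' : XV, (forall v, mdist (y v) (y' v) < r) -> `|f y - f y'| <= e) ->
    `|\int[fin_law joint_fdist x]_y f y - \int[m]_y f y| <= e.
Proof.
(* Empty cells have weight 0, so the point chosen for them is irrelevant. *)
have /choice[x xP] : forall a, exists y, forall y', joint_name y' = a -> joint_name y = a.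
  move=> a; have [[y ya]|na] := pselect (exists y, joint_name y = a); first by exists y.
  by exists point => y' y'a; exfalso; apply: na; exists y'.
have w0 a : joint_name (x a) != a -> joint_weight a = 0.
  move=> xa; rewrite /joint_weight (_ : joint_cell a = set0) ?measure0//.
  apply/seteqP; split => // y ya.
  by move/eqP : xa; apply; exact: xP ya.
exists x; split.
  rewrite (shannon_fin_law l) (shannon_name l); congr entropy; apply/funext => b.
  have -> : fine (m (name_cell b)) = \int[m]_y ((joint_name y).1 == b)%:R.
    rewrite -expect_indic; last exact: measurable_name_cell.
    apply: eq_Rintegral => y _; rewrite indicE; congr (nat_of_bool _)%:R.
    by apply/idP/eqP => [/set_mem|] //; exact: mem_set.
  rewrite (expect_joint_name (fun a => (a.1 == b)%:R)) /= /image_fun big_mkcond/=.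
  apply: eq_bigr => a _; have [xa|/w0 ->] := eqVneq (joint_name (x a)) a; last first.
    by rewrite mul0r if_same.
  have -> : name l (x a) = a.1 := congr1 fst xa.
  by case: ifP => _; rewrite ?mulr1 ?mulr0.
move=> r e f small bf fe.
rewrite expect_fin_law// -(expect_joint_name (f \o x)) distrC.
apply: expect_close => //; first exact: (bounded_measurable_joint_name (f \o x)).
move=> y; apply: fe => v.
have [_ /ffunP/(_ v)] : joint_name (x (joint_name y)) = joint_name y by exact: xP.
rewrite !ffunE => e2.
apply: (mdist_diameter (C := [set z | l' z = l' (y v)])) => //.
by apply: small; apply/(labellingP l'); exists (l' (y v)).
Qed.

End discretization.

(** The auxiliary partitions have cells of diameter less than [1 / n.+1], which is
    eventually below the modulus of continuity of any given test function. *)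
Lemma lwstar_discretize (R : realType) (G : countGroupType) (X : compactMetricType R)
    (sigma : nat -> symMap G) (mu_ : forall n, Prob R {ptws vertices (sigma n) -> X})
    (mu : Prob R {ptws G -> X}) (PP : set (set (set X))) (P : set (set X)) :
  (forall P, PP P -> finite_borel_partition P) ->
  (forall delta : R, 0 < delta ->
     exists2 P, PP P & forall C, P C -> (diameter C < delta%:E)%E) ->
  PP P -> lwstar_cvg mu_ mu ->
  exists (A : nat -> finType) (p : forall n, fdist R (A n))
    (x : forall n, A n -> {ptws vertices (sigma n) -> X}),
    lwstar_cvg (fun n => fin_law (p n) (x n) : Prob R {ptws vertices (sigma n) -> X}) mu /\
    forall n, shannon (fin_law (p n) (x n)) (power_partition (vertices (sigma n)) P) =
      shannon (mu_ n) (power_partition (vertices (sigma n)) P).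
Proof.
move=> fbP small PPP lw.
have [l] := finite_borel_partition_labelling (fbP P PPP).
have /choice[l' l'small] : forall n, exists l' : {P' : set (set X) & labelling P'},
    forall C, projT1 l' C -> (diameter C < (n.+1%:R^-1 : R)%:E)%E.
  move=> n; have n0 : (0 : R) < n.+1%:R^-1 by rewrite invr_gt0.
  have [P' PPP' sm] := small _ n0.
  by have [l'] := finite_borel_partition_labelling (fbP P' PPP'); exists (existT _ P' l').
pose exx n := cid (discretize l (projT2 (l' n)) (mu_ n)).
exists (fun n => joint_names l (projT2 (l' n))), (fun n => joint_fdist l (projT2 (l' n)) (mu_ n)),
  (fun n => sval (exx n)); split; last by move=> n; exact: (svalP (exx n)).1.
have [phi [cphi phi01 dense]] := mono_dense X.
have cmono t : continuous (mono phi t : {ptws G -> X} -> R) by exact: mono_continuous.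
apply: (lwstar_of_tests (@compact_ptws R G X) cmono).
  by move=> f eps cf e0; exact: dense.
move=> t e e0; have e20 : 0 < e / 2 by rewrite divr_gt0.
have [E [r [r0 rE]]] := uniform_cylinder (cmono t) e20.
have [n0 _ hn0] := lwstar_tests (@compact_ptws R G X) (cmono t) lw e20.
exists (maxn n0 (Num.truncn r^-1)) => // n /=; rewrite geq_max => /andP[/hn0 h1 rn].
have rn' : n.+1%:R^-1 <= r.
  rewrite -[leRHS]invrK lef_pV2 ?posrE ?invr_gt0//.
  by rewrite (le_trans (ltW (truncnS_gt _)))// ler_nat ltnS.
apply: le_trans (_ : e / 2 <= e); last by rewrite ler_pdivrMr// ler_peMr ?ler1n// ltW.
apply: le_trans h1; apply: le_frac => v /= ev.
have := (svalP (exx n)).2 n.+1%:R^-1 (e / 2) (fun y => mono phi t (pullback v y)) (l'small n).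
have bf : bounded_measurable ((fun y => mono phi t (pullback v y))
    : borel {ptws vertices (sigma n) -> X} -> R).
  apply: (continuous_bounded_measurable (@compact_ptws R _ X)) => y.
  by apply: continuous_comp; [exact: continuous_pullback|exact: cmono].
move=> /(_ bf) h2.
have {}h2 := h2 (fun y y' yy' => ltW (rE _ _ (fun e _ => lt_le_trans (yy' _) rn'))).
move: ev h2; set a := \int[_]_y _; set b := \int[_]_y _; set c := \int[_]_y _.
move=> ev h2; have := ler_distD b a c; lra.
Qed.

(** * Products over sites of independent rows *)

Lemma prod_by_class (R : comPzRingType) (I J : eqType) (r : seq I) (q : seq J)
    (f : I -> J) (F : I -> R) :
  uniq q -> (forall i, i \in r -> f i \in q) ->
  \prod_(i <- r) F i = \prod_(j <- q) \prod_(i <- r | f i == j) F i.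
Proof.
move=> uq rq.
under [RHS]eq_bigr do rewrite big_mkcond/=.
rewrite exchange_big/= big_seq [RHS]big_seq; apply: eq_bigr => i ir.
rewrite (bigD1_seq (f i)) ?rq//= eqxx big1 ?mulr1// => j /negbTE.
by rewrite eq_sym => ->.
Qed.

Section site_products.
Context {R : realType} {W A : finType} (p : fdist R A).
Local Notation E F := (\sum_(a : {ffun W -> A}) pow_fun p a * F a).

(** The part of [\prod_(h <- r) f h (a (kappa h))] that reads the site [w]. *)
Definition site_factor (T : eqType) (r : seq T) (kappa : T -> W) (f : T -> A -> R)
  (w : W) (b : A) : R := \prod_(h <- r | kappa h == w) f h b.

Lemma site_factorE (T : eqType) (r : seq T) (kappa : T -> W) (f : T -> A -> R)
    (a : {ffun W -> A}) :
  \prod_(h <- r) f h (a (kappa h)) = \prod_w site_factor r kappa f w (a w).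
Proof.
rewrite (prod_by_class (q := index_enum W) (f := kappa)); [|exact: index_enum_uniq|by move=> i _; rewrite mem_index_enum].
by apply: eq_bigr => w _; apply: eq_bigr => h /eqP ->.
Qed.

Lemma expect_distinct_sites (T : eqType) (r : seq T) (kappa : T -> W) (f : T -> A -> R) :
  uniq r -> {in r &, injective kappa} ->
  E (fun a : {ffun W -> A} => \prod_(h <- r) f h (a (kappa h))) =
  \prod_(h <- r) \sum_b p b * f h b.
Proof.
move=> ur kinj.
rewrite (eq_bigr (fun a => pow_fun p a * \prod_w site_factor r kappa f w (a w))); last first.
  by move=> a _; rewrite -site_factorE.
rewrite (expect_prod p).
have -> : \prod_(h <- r) (\sum_b p b * f h b) =
    \prod_(h <- r) \sum_b p b * site_factor r kappa f (kappa h) b.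
  rewrite big_seq [RHS]big_seq; apply: eq_bigr => h hr; apply: eq_bigr => b _.
  rewrite /site_factor big_mkcond (bigD1_seq h)//= eqxx big_seq_cond big1 ?mulr1//.
  move=> h' /andP[h'r h'h]; case: eqP => // e.
  by move: h'h; rewrite (kinj _ _ h'r hr e) eqxx.
rewrite -(big_map kappa xpredT (fun w => \sum_b p b * site_factor r kappa f w b)).
have um : uniq (map kappa r) by rewrite map_inj_in_uniq.
rewrite (big_uniq _ um)/= [LHS](bigID (mem (map kappa r)))/=.
rewrite [X in _ * X]big1 ?mulr1// => w wr.
rewrite (eq_bigr p) => [|b _]; first exact: fdist_sum1.
rewrite /site_factor big_seq_cond big1 ?mulr1// => h /andP[hr /eqP kw].
by move: wr; rewrite -kw map_f.
Qed.

(** Products over disjoint sets of sites are independent. *)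
Lemma expect_disjoint_sites (T : eqType) (r r' : seq T) (kappa kappa' : T -> W)
    (f f' : T -> A -> R) :
  (forall h h', h \in r -> h' \in r' -> kappa h != kappa' h') ->
  E (fun a : {ffun W -> A} => (\prod_(h <- r) f h (a (kappa h))) *
      \prod_(h <- r') f' h (a (kappa' h))) =
  E (fun a : {ffun W -> A} => \prod_(h <- r) f h (a (kappa h))) *
  E (fun a : {ffun W -> A} => \prod_(h <- r') f' h (a (kappa' h))).
Proof.
move=> disj.
rewrite [LHS](eq_bigr (fun a => pow_fun p a *
    \prod_w (site_factor r kappa f w (a w) * site_factor r' kappa' f' w (a w)))); last first.
  by move=> a _; rewrite big_split/= -!site_factorE.
rewrite [X in _ = X * _](eq_bigr (fun a => pow_fun p a * \prod_w site_factor r kappa f w (a w))); last first.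
  by move=> a _; rewrite -site_factorE.
rewrite [X in _ = _ * X](eq_bigr (fun a => pow_fun p a * \prod_w site_factor r' kappa' f' w (a w))); last first.
  by move=> a _; rewrite -site_factorE.
rewrite (expect_prod p (fun w b => site_factor r kappa f w b * site_factor r' kappa' f' w b)).
rewrite !(expect_prod p) -big_split/=; apply: eq_bigr => w _.
have [/hasP[h hr /eqP hw]|/hasPn nw] := boolP (has (fun h => kappa h == w) r).
  have one b : site_factor r' kappa' f' w b = 1.
    rewrite /site_factor big_seq_cond big1// => h' /andP[h'r' /eqP h'w].
    by have := disj _ _ hr h'r'; rewrite hw h'w eqxx.
  under eq_bigr do rewrite one mulr1.
  by under [X in _ * X]eq_bigr do rewrite one mulr1; rewrite fdist_sum1 mulr1.
have one b : site_factor r kappa f w b = 1.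
  rewrite /site_factor big_seq_cond big1// => h' /andP[h'r' h'w].
  by have := nw _ h'r'; rewrite h'w.
under eq_bigr do rewrite one mul1r.
by under [X in X * _]eq_bigr do rewrite one mulr1; rewrite fdist_sum1 mul1r.
Qed.

End site_products.

Section mono_slices.
Context {R : realType} {X : compactMetricType R} {G H : countGroupType}.
Variable phi : nat * nat -> X -> R.
Implicit Type t : seq ((G * H) * (nat * nat)).

Definition slice_indices t : seq H := undup [seq e.1.2 | e <- t].
Definition slice_part t h : seq (G * (nat * nat)) :=
  [seq (e.1.1, e.2) | e <- t & e.1.2 == h].

Lemma mono_slices t (y : {ptws (G * H)%type -> X}) :
  mono phi t y = \prod_(h <- slice_indices t) mono phi (slice_part t h) (slice h y).
Proof.
rewrite /mono (prod_by_class (q := slice_indices t) (f := fun e => e.1.2)).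
- apply: eq_bigr => h _; rewrite big_map big_filter; apply: eq_bigr => -[[g h'] k]/= /eqP ->.
  by [].
- exact: undup_uniq.
- by move=> e et; rewrite mem_undup; exact: (map_f (fun e => e.1.2)).
Qed.

Hypothesis cphi : forall i, continuous (phi i).
Hypothesis phi01 : forall i x, 0 <= phi i x <= 1.

Lemma expect_coinduction_mono (mu : Prob R {ptws G -> X})
    (nu : Prob R {ptws (G * H)%type -> X}) t : is_coinduction mu nu ->
  \int[nu]_y mono phi t y =
  \prod_(h <- slice_indices t) \int[mu]_x mono phi (slice_part t h) x.
Proof.
move=> coind; rewrite -(expect_coinduction coind (undup_uniq _)).
- by apply: eq_Rintegral => y _; rewrite mono_slices.
- move=> h; have cm : continuous (mono phi (slice_part t h) : {ptws G -> X} -> R).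
    exact: mono_continuous.
  by case: (continuous_bounded_measurable (@compact_ptws R G X) cm).
- by move=> h x; exact: mono01.
Qed.

End mono_slices.

(** The factors are exchanged one at a time. *)
Lemma dist_prod_le (R : realType) (I : Type) (r : seq I) (a b : I -> R) :
  (forall i, 0 <= a i <= 1) -> (forall i, 0 <= b i <= 1) ->
  `|\prod_(i <- r) a i - \prod_(i <- r) b i| <= \sum_(i <- r) `|a i - b i|.
Proof.
move=> a01 b01; have p01 (c : I -> R) (s : seq I) : (forall i, 0 <= c i <= 1) -> 0 <= \prod_(i <- s) c i <= 1.
  move=> c01; elim/big_ind : _ => [|x y /andP[x0 x1] /andP[y0 y1]|i _] //.
    by rewrite ler01 lexx.
  by rewrite mulr_ge0//= -[leRHS]mulr1 ler_pM.
elim: r => [|i r ih]; first by rewrite !big_nil subrr normr0.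
rewrite !big_cons.
set pa := \prod_(j <- r) a j in ih *; set pb := \prod_(j <- r) b j in ih *.
have -> : a i * pa - b i * pb = (a i - b i) * pa + b i * (pa - pb) by ring.
apply: (le_trans (ler_normD _ _)); rewrite !normrM; apply: lerD.
  have /andP[p0 p1] := p01 a r a01.
  by rewrite ler_piMr// ger0_norm.
apply: le_trans ih; have /andP[b0 b1] := b01 i.
by rewrite ler_piMl// ger0_norm.
Qed.

(** * Sofic approximations of infinite groups *)

Section vanishing.
Context {R : realType}.
Implicit Types u v : nat -> R.

(** One-sided, being meant for nonnegative sequences. *)
Definition vanishing u := forall e : R, 0 < e -> \forall n \near \oo, u n <= e.

Lemma vanishing_le u v : vanishing v -> (forall n, u n <= v n) -> vanishing u.
Proof. by move=> hv uv e e0; apply: filterS (hv e e0) => n; exact: le_trans. Qed.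

Lemma vanishing0 : vanishing (fun=> 0).
Proof. by move=> e e0; apply: nearW => _; exact: ltW. Qed.

Lemma vanishingD u v : vanishing u -> vanishing v -> vanishing (fun n => u n + v n).
Proof.
move=> hu hv e e0; have e20 : 0 < e / 2 by rewrite divr_gt0.
apply: filterS2 (hu _ e20) (hv _ e20) => n h1 h2.
by rewrite (splitr e) lerD.
Qed.

Lemma vanishing_sum (T : eqType) (r : seq T) (u : T -> nat -> R) :
  (forall i, i \in r -> vanishing (u i)) -> vanishing (fun n => \sum_(i <- r) u i n).
Proof.
elim: r => [_|i r ih ur].
  by apply: vanishing_le vanishing0 _ => n; rewrite big_nil.
apply: (@vanishing_le _ (fun n => u i n + \sum_(j <- r) u j n)) => [|n]; last by rewrite big_cons.
apply: vanishingD; first by apply: ur; rewrite inE eqxx.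
by apply: ih => j jr; apply: ur; rewrite inE jr orbT.
Qed.

Lemma vanishingZ (c : R) u : 0 <= c -> vanishing u -> vanishing (fun n => c * u n).
Proof.
move=> c0 hu e e0; have c1 : 0 < c + 1 by rewrite ltr_wpDl.
apply: filterS (hu (e / (c + 1)) _) => [n h|]; last by rewrite divr_gt0.
apply: (@le_trans _ _ (c * (e / (c + 1)))); first by rewrite ler_wpM2l.
rewrite mulrCA ler_piMr//; first exact: ltW.
by rewrite ler_pdivrMr// mul1r lerDl.
Qed.

End vanishing.

Lemma frac_or (R : realType) (G : Type) (s : symMap G) (P Q : pred (vertices s)) :
  frac R (fun v => P v || Q v) <= frac R P + frac R Q.
Proof.
rewrite !fracE -mulrDl ler_wpM2r// -big_split/= ler_sum// => v _.
by rewrite -natrD ler_nat; case: (P v); case: (Q v).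
Qed.

Section sofic_distinct.
Context {R : realType} {H : countGroupType} (tau : nat -> symMap H).
Hypothesis sofic : sofic_approximation R tau.

Lemma sofic_subsequence (n_ : nat -> nat) : {homo n_ : i j / (i < j)%N} ->
  sofic_approximation R (fun i => tau (n_ i)).
Proof.
move=> n_mono; have ge_n i : (i <= n_ i)%N.
  elim: i => // i ih; apply: (leq_ltn_trans ih); exact: n_mono.
have sub (u : nat -> R) : (u n @[n --> \oo] --> (1 : R)) -> (u (n_ i) @[i --> \oo] --> (1 : R)).
  move=> cu; apply: (@cvg_comp _ _ _ n_ u _ _ _ _ cu).
  move=> A [N _ NA]; exists N => // i /= Ni; apply: NA => /=.
  exact: leq_trans (ge_n i).
by case: sofic => s1 s2; split => [g h|g g1]; [apply: (sub _ (s1 g h))|apply: (sub _ (s2 g g1))].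
Qed.

Let vanishing_predC (P : forall n, pred (vertices (tau n))) :
  (frac R (P n) @[n --> \oo] --> (1 : R)) -> vanishing (fun n => frac R (predC (P n))).
Proof.
move=> h e e0; have := (cvg_to1 (fun n => frac_le1 (P n))).2 h e e0.
by apply: filterS => n; rewrite frac_predC opprB addrC subrK.
Qed.

(** If [tau h w = tau h' w] then, wherever the homomorphism property holds,
    [h^-1 * h'] fixes [w], which is rare for an element other than the identity. *)
Lemma sofic_coincidence (h h' : H) : h != h' ->
  vanishing (fun n => frac R (fun w => tau n h w == tau n h' w)).
Proof.
move=> hh'; have [s1 s2] := sofic.
have k1 : (h^-1 * h')%g != 1%g.
  apply: contra_neq hh' => e; apply: (mulgI h^-1%g).
  by rewrite e mulVg.
have v4 := vanishingD (vanishingD (vanishing_predC (s1 1%g 1%g))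
  (vanishing_predC (s1 h^-1%g h))) (vanishingD (vanishing_predC (s1 h^-1%g h'))
  (vanishing_predC (s2 _ k1))).
apply: (vanishing_le v4) => n.
set P1 := predC _; set P2 := predC _; set P3 := predC _; set P4 := predC _.
apply: (@le_trans _ _ (frac R (fun w => P1 w || P2 w) + frac R (fun w => P3 w || P4 w))); last first.
  by apply: lerD; exact: frac_or.
apply: le_trans (frac_or _ _ _); apply: le_frac => w /eqP e /=.
apply: contraT; rewrite !negb_or !negbK => /andP[/andP[/eqP e1 /eqP e2] /andP[/eqP e3 e4]].
have e5 : tau n 1%g w = w.
  by apply: (@perm_inj _ (tau n 1%g)); rewrite e1 mulg1.
by move: e4; rewrite -e3 -e e2 mulVg e5 eqxx.
Qed.

Lemma sofic_injective (r : seq H) : uniq r ->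
  vanishing (fun n => frac R (fun w => ~~ uniq [seq tau n h w | h <- r])).
Proof.
elim: r => [_|h r ih /= /andP[hr ur]].
  by apply: vanishing_le vanishing0 _ => n; rewrite fracE big1 ?mul0r.
apply: (vanishing_le (vanishingD (vanishing_sum (r := r)
   (u := fun h' n => frac R (fun w => tau n h w == tau n h' w)) _) (ih ur))).
  move=> h' h'r; apply: sofic_coincidence; apply: contraNneq hr => -> //.
move=> n /=; apply: le_trans (lerD (frac_has _ _) (lexx _)).
apply: le_trans (frac_or _ _ _); apply: le_frac => w /=.
rewrite negb_and negbK => /orP[/mapP[h' h'r e]|->]; last by rewrite orbT.
by apply/orP; left; apply/hasP; exists h' => //; rewrite e.
Qed.

(** Some vertex is moved to as many places as desired by elements of [H]. *)
Lemma sofic_card : infinite_set [set: H] ->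
  vanishing (fun n => (#|vertices (tau n)|%:R^-1 : R)).
Proof.
move=> /infinite_injection[h h_inj] e e0.
pose N := Num.truncn e^-1.
have ur : uniq [seq h i | i <- iota 0 N.+1] by rewrite map_inj_uniq ?iota_uniq.
have : \forall n \near \oo, frac R (fun w => ~~ uniq [seq tau n h w | h <- [seq h i | i <- iota 0 N.+1]]) <= 1 / 2.
  by apply: (sofic_injective ur); rewrite divr_gt0.
apply: filterS => n hn.
have [w hw] : exists w, uniq [seq tau n h w | h <- [seq h i | i <- iota 0 N.+1]].
  apply: contrapT => /forallNP nu; suff : (1 : R) <= 1 / 2 by lra.
  apply: le_trans hn; rewrite fracE (eq_bigr (fun=> 1)) => [|w _].
    by rewrite sumr_const divff// gt_eqF// vertices_gt0R.
  by have /negP -> := nu w.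
have Ncard : (N.+1 <= #|vertices (tau n)|)%N.
  by have := max_card (mem [seq tau n h w | h <- [seq h i | i <- iota 0 N.+1]]);
    rewrite (card_uniqP hw) !size_map size_iota.
rewrite -[leRHS]invrK lef_pV2 ?posrE ?invr_gt0 ?vertices_gt0R//.
by rewrite (le_trans (ltW (truncnS_gt _)))// ler_nat.
Qed.

End sofic_distinct.

Section frac_prod.
Context {R : realType} {G H : Type} (s : symMap G) (t : symMap H).

Lemma frac_prod_fst (P : pred (vertices s)) :
  frac R (fun vw : vertices (prod_map s t) => P vw.1) = frac R P.
Proof.
rewrite !fracE -(pair_bigA _ (fun v (w : vertices t) => (P v)%:R))/=.
rewrite card_prod natrM (eq_bigr (fun v => (P v)%:R * #|vertices t|%:R)); last first.
  by move=> v _; rewrite sumr_const mulr_natr.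
rewrite -mulr_suml invfM mulrACA [X in _ * X]divff ?mulr1//.
by rewrite gt_eqF// vertices_gt0R.
Qed.

Lemma frac_prod_snd (P : pred (vertices t)) :
  frac R (fun vw : vertices (prod_map s t) => P vw.2) = frac R P.
Proof.
rewrite !fracE -(pair_bigA _ (fun (v : vertices s) w => (P w)%:R))/=.
rewrite card_prod natrM sumr_const -[X in X / _]mulr_natl invfM mulrACA divff ?mul1r//.
by rewrite gt_eqF// vertices_gt0R.
Qed.

End frac_prod.

(** * The law of independent rows *)

Section pair_tests.
Context {R : realType} {X : compactMetricType R}.
Variable phi : nat * nat -> X -> R.
Hypothesis cphi : forall i, continuous (phi i).
Hypothesis phi01 : forall i x, 0 <= phi i x <= 1.

Definition pair_mono (I : countType)
    (t : seq (I * (nat * nat)) * seq (I * (nat * nat))) (z : {ptws I -> (X * X)%type}) : R :=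
  mono phi t.1 (zip_fst z) * mono phi t.2 (zip_snd z).

Lemma pair_mono_continuous (I : countType) t : continuous (@pair_mono I t).
Proof.
move=> z; apply: continuousM' => {}z.
  by apply: continuous_comp; [exact: zip_fst_continuous|exact: mono_continuous].
by apply: continuous_comp; [exact: zip_snd_continuous|exact: mono_continuous].
Qed.

Lemma pair_mono01 (I : countType) t (z : {ptws I -> (X * X)%type}) : 0 <= pair_mono t z <= 1.
Proof.
rewrite /pair_mono; have /andP[a0 a1] := mono01 phi01 t.1 (zip_fst z).
have /andP[b0 b1] := mono01 phi01 t.2 (zip_snd z).
by rewrite mulr_ge0//= -[leRHS]mulr1 ler_pM.
Qed.

(** [(X * X)^I] is [X^(I + I)], where products of test functions are dense. *)
Lemma pair_mono_dense :
  (forall (J : eqType) (f : {ptws J -> X} -> R) (eps : R),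
      continuous f -> 0 < eps ->
      exists (I : finType) (a : I -> R) (t : I -> seq (J * (nat * nat))),
        forall u, `|f u - \sum_i a i * mono phi (t i) u| <= eps) ->
  forall (I : countType) (f : {ptws I -> (X * X)%type} -> R) (eps : R),
    continuous f -> 0 < eps ->
    exists (K : finType) (a : K -> R)
      (t : K -> seq (I * (nat * nat)) * seq (I * (nat * nat))),
      forall z, `|f z - \sum_i a i * pair_mono (t i) z| <= eps.
Proof.
move=> dense I f eps cf e0.
pose j (u : {ptws (I + I)%type -> X}) : {ptws I -> (X * X)%type} :=
  fun i => (u (inl i), u (inr i)).
have cj : continuous j.
  apply: continuous_ptws => i u.
  exact: (cvg_pair (@continuous_coord X (I + I)%type (inl i) u)
    (@continuous_coord X (I + I)%type (inr i) u)).
have cfj : continuous (f \o j) by move=> u; apply: continuous_comp; [exact: cj|exact: cf].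
have [K [a [t at_]]] := dense _ _ _ cfj e0.
pose lpart (r : seq ((I + I) * (nat * nat))) : seq (I * (nat * nat)) :=
  pmap (fun e => if e.1 is inl i then Some (i, e.2) else None) r.
pose rpart (r : seq ((I + I) * (nat * nat))) : seq (I * (nat * nat)) :=
  pmap (fun e => if e.1 is inr i then Some (i, e.2) else None) r.
exists K, a, (fun k => (lpart (t k), rpart (t k))) => z.
pose u : {ptws (I + I)%type -> X} := fun e =>
  match e with inl i => (z i).1 | inr i => (z i).2 end.
have ju : j u = z by apply/funext => i; rewrite /j/=; case: (z i).
have mE (r : seq ((I + I) * (nat * nat))) : mono phi r u = pair_mono (lpart r, rpart r) z.
  rewrite /pair_mono /=; elim: r => [|[[i|i] k] r ih]; rewrite /mono ?big_nil ?mulr1//.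
    by rewrite big_cons/= big_cons/= -mulrA; congr (_ * _); exact: ih.
  by rewrite big_cons/= [in RHS]big_cons/= mulrCA; congr (_ * _); exact: ih.
have := at_ u; rewrite /= ju; under eq_bigr do rewrite mE.
by [].
Qed.

End pair_tests.

Lemma uniq_map_inj_in (T1 T2 : eqType) (f : T1 -> T2) (r : seq T1) :
  uniq (map f r) -> {in r &, injective f}.
Proof.
elim: r => // a r ih /= /andP[ar ur] i j; rewrite !inE.
move=> /orP[/eqP ->|ir] /orP[/eqP ->|jr] // e.
- by move: ar; rewrite e map_f.
- by move: ar; rewrite -e map_f.
- exact: ih.
Qed.

Section product_law.
Context {R : realType} {G H : countGroupType} {X : compactMetricType R}.
Variables (s : symMap G) (t : symMap H) (A : finType) (p : fdist R A).
Variable x : A -> {ptws vertices s -> X}.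
Local Notation V := (vertices s).
Local Notation W := (vertices t).
Local Notation VW := (vertices (prod_map s t)).

Definition configuration (a : {ffun W -> A}) : {ptws VW -> X} :=
  fun vw => x (a vw.2) vw.1.

(** The law of [#|W|] independent copies of [fin_law p x], one on each row. *)
Definition product_law : Prob R {ptws VW -> X} := fin_law (fdist_pow W p) configuration.

Variable phi : nat * nat -> X -> R.
Hypothesis cphi : forall i, continuous (phi i).
Hypothesis phi01 : forall i x, 0 <= phi i x <= 1.
Local Notation tests := (seq ((G * H) * (nat * nat))).
Implicit Types (T : tests).

Lemma pullback_configuration a v w h :
  slice h (pullback ((v, w) : VW) (configuration a)) = pullback v (x (a (t h w))).
Proof. by apply/funext => g; rewrite /slice /pullback/= permE. Qed.

Lemma mono_pullback_bounded (vw : VW) T :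
  bounded_measurable ((fun y => mono phi T (pullback vw y)) : borel {ptws VW -> X} -> R).
Proof.
apply: (continuous_bounded_measurable (@compact_ptws R _ X)) => y.
by apply: continuous_comp; [exact: continuous_pullback|exact: mono_continuous].
Qed.

Definition site_mono T (vw : VW) : R :=
  \sum_a pow_fun p a * mono phi T (pullback vw (configuration a)).

Lemma site_mono01 T vw : 0 <= site_mono T vw <= 1.
Proof.
apply/andP; split.
  apply: sumr_ge0 => a _; rewrite mulr_ge0 ?pow_fun_ge0//.
  by case/andP: (mono01 phi01 T (pullback vw (configuration a))).
rewrite -(pow_fun_sum1 W p); apply: ler_sum => a _.
rewrite ler_piMr ?pow_fun_ge0//.
by case/andP: (mono01 phi01 T (pullback vw (configuration a))).
Qed.

Lemma expect_product_law T vw :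
  \int[product_law]_y mono phi T (pullback vw y) = site_mono T vw.
Proof. by rewrite expect_fin_law//; exact: mono_pullback_bounded. Qed.

(** At a vertex where the indices of the test read distinct rows, the slices of a
    random configuration are independent. *)
Lemma site_mono_distinct T v w :
  uniq [seq t h w | h <- slice_indices T] ->
  site_mono T (v, w) = \prod_(h <- slice_indices T)
    \int[fin_law p x]_y mono phi (slice_part T h) (pullback v y).
Proof.
move=> uT; rewrite /site_mono.
rewrite (eq_bigr (fun a : {ffun W -> A} => pow_fun p a * \prod_(h <- slice_indices T)
    mono phi (slice_part T h) (pullback v (x (a (t h w)))))); last first.
  move=> a _; rewrite mono_slices; congr (_ * _).
  by apply: eq_bigr => h _; rewrite pullback_configuration.
rewrite (expect_distinct_sites p (fun h b => mono phi (slice_part T h) (pullback v (x b)))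
  (kappa := fun h => t h w) (undup_uniq _)); last first.
  exact: uniq_map_inj_in.
apply: eq_bigr => h _; rewrite expect_fin_law//.
apply: (continuous_bounded_measurable (@compact_ptws R _ X)) => y.
by apply: continuous_comp; [exact: continuous_pullback|exact: mono_continuous].
Qed.

Lemma site_mono_disjoint T T' v w v' w' :
  (forall h h', h \in slice_indices T -> h' \in slice_indices T' -> t h w != t h' w') ->
  \sum_a pow_fun p a * (mono phi T (pullback ((v, w) : VW) (configuration a)) *
    mono phi T' (pullback ((v', w') : VW) (configuration a))) =
  site_mono T (v, w) * site_mono T' (v', w').
Proof.
move=> disj; rewrite /site_mono.
have E T1 v1 w1 a : mono phi T1 (pullback ((v1, w1) : VW) (configuration a)) =
    \prod_(h <- slice_indices T1) mono phi (slice_part T1 h) (pullback v1 (x (a (t h w1)))).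
  by rewrite mono_slices; apply: eq_bigr => h _; rewrite pullback_configuration.
rewrite [LHS](eq_bigr (fun a => pow_fun p a * (_ * _)) (fun a _ => congr1 (fun c => pow_fun p a * c)
  (f_equal2 *%R (E T v w a) (E T' v' w' a)))).
rewrite [X in _ = X * _](eq_bigr _ (fun a _ => congr1 (fun c => pow_fun p a * c) (E T v w a))).
rewrite [X in _ = _ * X](eq_bigr _ (fun a _ => congr1 (fun c => pow_fun p a * c) (E T' v' w' a))).
exact: (expect_disjoint_sites p
  (fun h b => mono phi (slice_part T h) (pullback v (x b)))
  (fun h b => mono phi (slice_part T' h) (pullback v' (x b))) disj).
Qed.

End product_law.

(** * Variance of empirical averages *)

Section concentration.
Context {R : realType} {G H : countGroupType} {X : compactMetricType R}.
Variables (s : symMap G) (t : symMap H) (A : finType) (p : fdist R A).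
Variable x : A -> {ptws vertices s -> X}.
Local Notation V := (vertices s).
Local Notation W := (vertices t).
Local Notation VW := (vertices (prod_map s t)).
Variable phi : nat * nat -> X -> R.
Hypothesis cphi : forall i, continuous (phi i).
Hypothesis phi01 : forall i x, 0 <= phi i x <= 1.
Local Notation tests := (seq ((G * H) * (nat * nat))).
Variable T : tests * tests.
Local Notation nu := (product_law t p x).

Definition pair_site (vw : VW) : R := site_mono p x phi T.1 vw * site_mono p x phi T.2 vw.

Lemma pair_site01 vw : 0 <= pair_site vw <= 1.
Proof.
have /andP[a0 a1] := site_mono01 p x phi01 T.1 vw.
have /andP[b0 b1] := site_mono01 p x phi01 T.2 vw.
by rewrite mulr_ge0//= -[leRHS]mulr1 ler_pM.
Qed.

Lemma expect_pair_site vw :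
  \int[square nu]_z pair_mono phi T (pullback vw z) = pair_site vw.
Proof.
rewrite /pair_site -(expect_product_law p x cphi) -(expect_product_law p x cphi).
exact: (expect_square nu (mono_pullback_bounded cphi vw T.1) (mono_pullback_bounded cphi vw T.2)).
Qed.

Definition test_indices : seq H := slice_indices T.1 ++ slice_indices T.2.

(** Whether the tests read a common row from [w] and from [w']. *)
Definition meets (w w' : W) : bool :=
  has (fun hh : H * H => t hh.1 w == t hh.2 w')
    [seq (h, h') | h <- test_indices, h' <- test_indices].

(** For a given pair of indices [h, h'] exactly one [w'] has [t h' w' = t h w]. *)
Lemma sum_meets w : (\sum_w' meets w w' <= size test_indices * size test_indices)%N.
Proof.
have -> : (size test_indices * size test_indices =
    \sum_(hh <- [seq (h, h') | h <- test_indices, h' <- test_indices]) 1)%N.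
  by rewrite sum1_size size_allpairs.
apply: (@leq_trans (\sum_w' \sum_(hh <- [seq (h, h') | h <- test_indices, h' <- test_indices])
    (t hh.1 w == t hh.2 w'))).
  apply: leq_sum => w' _; rewrite /meets.
  elim: [seq _ | _ <- _, _ <- _] => [|hh r ih]; first by rewrite big_nil.
  rewrite big_cons /=; apply: leq_trans (leq_add (leqnn _) ih).
  by case: (_ == _); case: (has _ _).
rewrite exchange_big/=; apply: leq_sum => hh _.
rewrite (bigD1 ((t hh.2)^-1%g (t hh.1 w)))//= permKV eqxx big1// => w' w'w.
apply/eqP; rewrite eqb0; apply: contra w'w => /eqP ->.
by rewrite permK.
Qed.

(** Without a common row the values of the test at the two vertices are
    independent; otherwise they are bounded by 1. *)
Lemma expect_pair_site2 (v v' : V) (w w' : W) :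
  \int[square nu]_z (pair_mono phi T (pullback ((v, w) : VW) z) *
      pair_mono phi T (pullback ((v', w') : VW) z)) <=
  pair_site (v, w) * pair_site (v', w') + (meets w w')%:R.
Proof.
pose f (T1 : tests) (y : borel {ptws VW -> X}) : R :=
  mono phi T1 (pullback ((v, w) : VW) y) * mono phi T1 (pullback ((v', w') : VW) y).
have bf T1 : bounded_measurable (f T1).
  by apply: bounded_measurableM; exact: mono_pullback_bounded.
have f01 T1 y : 0 <= f T1 y <= 1.
  have /andP[a0 a1] := mono01 phi01 T1 (pullback ((v, w) : VW) y).
  have /andP[b0 b1] := mono01 phi01 T1 (pullback ((v', w') : VW) y).
  by rewrite mulr_ge0//= -[leRHS]mulr1 ler_pM.
have -> : \int[square nu]_z (pair_mono phi T (pullback ((v, w) : VW) z) *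
      pair_mono phi T (pullback ((v', w') : VW) z)) =
    (\int[nu]_y f T.1 y) * (\int[nu]_y f T.2 y).
  rewrite -(expect_square nu (bf T.1) (bf T.2)).
  by apply: eq_Rintegral => z _; rewrite /pair_mono mulrACA.
have fE T1 : \int[nu]_y f T1 y = \sum_a pow_fun p a * f T1 (configuration x a).
  by rewrite expect_fin_law.
have sum01 T1 : 0 <= \int[nu]_y f T1 y <= 1.
  rewrite fE; apply/andP; split.
    by apply: sumr_ge0 => a _; rewrite mulr_ge0 ?pow_fun_ge0//; case/andP: (f01 T1 (configuration x a)).
  rewrite -(pow_fun_sum1 W p); apply: ler_sum => a _.
  by rewrite ler_piMr ?pow_fun_ge0//; case/andP: (f01 T1 (configuration x a)).
have [m|nm] := boolP (meets w w').
  have /andP[a0 a1] := sum01 T.1; have /andP[b0 b1] := sum01 T.2.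
  have /andP[c0 _] := pair_site01 (v, w); have /andP[d0 _] := pair_site01 (v', w').
  rewrite (@le_trans _ _ 1)//; first by rewrite -[leRHS]mulr1 ler_pM.
  by rewrite lerDr mulr_ge0.
have disj T1 : {subset slice_indices T1 <= test_indices} ->
    \int[nu]_y f T1 y = site_mono p x phi T1 (v, w) * site_mono p x phi T1 (v', w').
  move=> sub; rewrite fE -site_mono_disjoint// => h h' hT h'T.
  apply: contraNneq nm => e; apply/hasP; exists (h, h'); last exact/eqP.
  by apply: allpairs_f; exact: sub.
rewrite addr0 !disj; first by rewrite /pair_site mulrACA.
- by move=> h hT; rewrite mem_cat hT orbT.
- by move=> h hT; rewrite mem_cat hT.
Qed.

(** Most pairs of vertices read disjoint sets of rows, so the empirical average of a
    test has variance [O(1 / #|W|)]; the other term is the squared bias. *)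
Lemma variance_bound (c : R) :
  \int[square nu]_z ((\int[empirical z]_y pair_mono phi T y - c) ^+ 2) <=
  (size test_indices ^ 2)%:R / #|W|%:R +
  ((\sum_vw pair_site vw) / #|VW|%:R - c) ^+ 2.
Proof.
have V0 := vertices_gt0R (R := R) s; have W0 := vertices_gt0R (R := R) t.
have N0 := vertices_gt0R (R := R) (prod_map s t).
set N : R := #|VW|%:R in N0 *.
pose S (vw : VW) (z : borel {ptws VW -> (X * X)%type}) : R := pair_mono phi T (pullback vw z).
have bS vw : bounded_measurable (S vw).
  apply: (continuous_bounded_measurable (@compact_zip R _ X)) => z.
  apply: (@continuous_comp _ _ _ (pullback vw : {ptws VW -> (X * X)%type} ->
    {ptws (G * H)%type -> (X * X)%type}) (pair_mono phi T)).
    exact: (@continuous_pullback (G * H)%type (X * X)%type (prod_map s t) vw).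
  exact: pair_mono_continuous.
have bT : bounded_measurable (pair_mono phi T : borel {ptws (G * H)%type -> (X * X)%type} -> R).
  apply: (continuous_bounded_measurable (@compact_zip R _ X)).
  exact: pair_mono_continuous.
have bSS vw vw' : bounded_measurable ((fun z => S vw z * S vw' z)
    : borel {ptws VW -> (X * X)%type} -> R).
  exact: bounded_measurableM.
set M := (\sum_vw pair_site vw) / N.
have bS2 : bounded_measurable ((fun z => \sum_vw \sum_vw' S vw z * S vw' z)
    : borel {ptws VW -> (X * X)%type} -> R).
  by apply: bounded_measurable_sum => vw; exact: bounded_measurable_sum.
have bS1 : bounded_measurable ((fun z => \sum_vw S vw z)
    : borel {ptws VW -> (X * X)%type} -> R) by exact: bounded_measurable_sum.
have bcst (a : R) : bounded_measurable ((fun=> a) : borel {ptws VW -> (X * X)%type} -> R).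
  exact: bounded_measurable_cst.
have -> : \int[square nu]_z ((\int[empirical z]_y pair_mono phi T y - c) ^+ 2) =
    N^-1 ^+ 2 * (\sum_vw \sum_vw' \int[square nu]_z (S vw z * S vw' z))
    + ((- 2 * c) * N^-1) * (\sum_vw pair_site vw) + c ^+ 2.
  transitivity (\int[square nu]_z (N^-1 ^+ 2 * (\sum_vw \sum_vw' S vw z * S vw' z)
    + ((- 2 * c) * N^-1) * (\sum_vw S vw z) + c ^+ 2)).
    apply: eq_Rintegral => z _; rewrite expect_empirical// -/N.
    have -> : \sum_vw \sum_vw' S vw z * S vw' z = (\sum_vw S vw z) ^+ 2.
      by rewrite expr2 mulr_suml; apply: eq_bigr => vw _; rewrite mulr_sumr.
    by rewrite /S; set a := \sum_(v : _) _; ring.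
  have b1 := bounded_measurableM (bcst (N^-1 ^+ 2)) bS2.
  have b2 := bounded_measurableM (bcst ((- 2 * c) * N^-1)) bS1.
  rewrite expectD//; last exact: bounded_measurableD.
  rewrite expectD// expect_cst !expectZ//; congr (_ * _ + _ * _ + _).
    rewrite expect_sum; last by move=> vw; exact: bounded_measurable_sum.
    by apply: eq_bigr => vw _; rewrite expect_sum.
  rewrite expect_sum//; apply: eq_bigr => vw _; exact: expect_pair_site.
have SS : \sum_vw \sum_vw' \int[square nu]_z (S vw z * S vw' z) <=
    (\sum_vw pair_site vw) ^+ 2 + (#|V| ^ 2)%:R * (#|W|%:R * (size test_indices ^ 2)%:R).
  rewrite expr2 mulr_suml; under [X in _ <= X + _]eq_bigr do rewrite mulr_sumr.
  apply: (@le_trans _ _ (\sum_(vw : VW) \sum_(vw' : VW) (pair_site vw * pair_site vw' +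
      (meets vw.2 vw'.2)%:R))).
    apply: ler_sum => -[v w] _; apply: ler_sum => -[v' w'] _.
    exact: expect_pair_site2.
  rewrite [leLHS](eq_bigr (fun vw : VW => \sum_(vw' : VW) pair_site vw * pair_site vw' +
      \sum_(vw' : VW) (meets vw.2 vw'.2)%:R)); last by move=> vw _; rewrite big_split.
  rewrite big_split/= lerD2l.
  rewrite -(pair_bigA _ (fun (v : V) (w : W) => \sum_(vw' : VW) (meets w vw'.2)%:R : R))/=.
  rewrite (eq_bigr (fun=> \sum_(w : W) #|V|%:R * \sum_(w' : W) (meets w w')%:R)); last first.
    move=> v _; apply: eq_bigr => w _.
    rewrite -(pair_bigA _ (fun (v' : V) (w' : W) => (meets w w')%:R : R))/=.
    by rewrite sumr_const mulr_natl.
  rewrite sumr_const -[leLHS]mulr_natl -mulr_sumr mulrA natrX expr2.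
  rewrite ler_wpM2l ?mulr_ge0//.
  rewrite mulr_natl -sumr_const; apply: ler_sum => w _.
  by rewrite -natr_sum ler_nat expnS expn1; exact: sum_meets.
have Ni : 0 < N^-1 ^+ 2 by rewrite exprn_gt0// invr_gt0.
have := SS; rewrite -(ler_pM2l Ni) => SS'.
set SSum := \sum_vw \sum_vw' _ in SS' *.
have -> : (size test_indices ^ 2)%:R / #|W|%:R = N^-1 ^+ 2 *
    ((#|V| ^ 2)%:R * (#|W|%:R * (size test_indices ^ 2)%:R)) :> R.
  rewrite /N card_prod !natrM; field.
  by rewrite !gt_eqF.
have -> : M = N^-1 * \sum_vw pair_site vw by rewrite /M mulrC.
move: SS'; rewrite mulrDr; set a := \sum_vw _; set b := _ * (_ * _); nra.
Qed.

End concentration.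

(** * Independent rows converge locally and doubly empirically *)

Section product_lde.
Context {R : realType} {G H : countGroupType} {X : compactMetricType R}.
Variables (sigma : nat -> symMap G) (tau : nat -> symMap H).
Variables (mu : Prob R {ptws G -> X}) (nu : Prob R {ptws (G * H)%type -> X}).
Hypothesis sofic : sofic_approximation R tau.
Hypothesis coind : is_coinduction mu nu.
Hypothesis infH : infinite_set [set: H].
Variables (A : nat -> finType) (p : forall n, fdist R (A n)).
Variable x : forall n, A n -> {ptws vertices (sigma n) -> X}.
Arguments x : clear implicits.
Hypothesis lw : lwstar_cvg (fun n => fin_law (p n) (x n) : Prob R {ptws vertices (sigma n) -> X}) mu.
Variable phi : nat * nat -> X -> R.
Hypothesis cphi : forall i, continuous (phi i).
Hypothesis phi01 : forall i x, 0 <= phi i x <= 1.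
Hypothesis dense : forall (J : eqType) (f : {ptws J -> X} -> R) (eps : R),
  continuous f -> 0 < eps ->
  exists (I : finType) (a : I -> R) (t : I -> seq (J * (nat * nat))),
    forall u, `|f u - \sum_i a i * mono phi (t i) u| <= eps.
Local Notation tests := (seq ((G * H) * (nat * nat))).
Local Notation s n := (prod_map (sigma n) (tau n)).

Let limit (T : tests * tests) : R := \int[square nu]_z pair_mono phi T z.

Lemma vanishing_slice_error (q : seq (G * (nat * nat))) (e : R) : 0 < e ->
  vanishing (fun n => frac R (fun v : vertices (sigma n) =>
    e <= `|\int[fin_law (p n) (x n)]_y mono phi q (pullback v y) - \int[mu]_y mono phi q y|)).
Proof.
move=> e0 e' e'0.
have e2 : 0 < Num.min e e' by rewrite lt_min e0.
have := lwstar_tests (@compact_ptws R G X) (@mono_continuous _ _ _ cphi _ q) lw e2.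
apply: filterS => n h; apply: (@le_trans _ _ (Num.min e e')); last by rewrite ge_min lexx orbT.
apply: le_trans h; apply: le_frac => v; apply: le_trans.
by rewrite ge_min lexx.
Qed.

(** At most vertices [(v, w)] the rows read by the tests are distinct, so the
    expectation of the test is a product over slices, and the laws [p n] agree
    with [mu] at [v] on each slice. *)
Lemma vanishing_pair_error (T : tests * tests) (e : R) : 0 < e ->
  vanishing (fun n => frac R (fun vw : vertices (s n) =>
    e <= `|pair_site (p n) (x n) phi T vw - limit T|)).
Proof.
move=> e0.
pose Q := [seq slice_part T.1 h | h <- slice_indices T.1] ++
          [seq slice_part T.2 h | h <- slice_indices T.2].
pose e1 := e / (size Q).+1%:R.
have e10 : 0 < e1 by rewrite divr_gt0.
pose bad_slice n (q : seq (G * (nat * nat))) (v : vertices (sigma n)) : bool :=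
  e1 <= `|\int[fin_law (p n) (x n)]_y mono phi q (pullback v y) - \int[mu]_y mono phi q y|.
have v1 := vanishing_sum (r := Q) (u := fun q n => frac R (@bad_slice n q))
  (fun q _ => vanishing_slice_error q e10).
have v2 := sofic_injective sofic (undup_uniq [seq ee.1.2 | ee <- T.1]).
have v3 := sofic_injective sofic (undup_uniq [seq ee.1.2 | ee <- T.2]).
apply: (vanishing_le (vanishingD v1 (vanishingD v2 v3))) => n.
rewrite -/(slice_indices T.1) -/(slice_indices T.2).
set P2 := fun w : vertices (tau n) => ~~ uniq [seq tau n h w | h <- slice_indices T.1].
set P3 := fun w : vertices (tau n) => ~~ uniq [seq tau n h w | h <- slice_indices T.2].
apply: (@le_trans _ _ (frac R (fun v : vertices (sigma n) => has (bad_slice n ^~ v) Q) +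
  frac R (fun w => P2 w || P3 w))); last first.
  by apply: lerD; [exact: frac_has|exact: frac_or].
pose P1 v := has (bad_slice n ^~ v) Q.
rewrite -(frac_prod_fst (tau n) P1) -(frac_prod_snd (sigma n) (fun w => P2 w || P3 w)).
apply: le_trans (frac_or _ _ _); apply: le_frac => -[v w] /= ebad.
apply: contraT; rewrite !negb_or !negbK => /andP[/hasPn good /andP[u1 u2]].
move: ebad; rewrite leNgt; apply: contraNT => _.
pose a q := \int[fin_law (p n) (x n)]_y mono phi q (pullback v y).
pose b (q : seq (G * (nat * nat))) := \int[mu]_y mono phi q y.
have pE : pair_site (p n) (x n) phi T (v, w) = \prod_(q <- Q) a q.
  rewrite /pair_site !site_mono_distinct//.
  by rewrite big_cat/= !big_map.
have lE : limit T = \prod_(q <- Q) b q.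
  have bm T1 : bounded_measurable (mono phi T1 : borel {ptws (G * H)%type -> X} -> R).
    apply: (continuous_bounded_measurable (@compact_ptws R _ X)).
    exact: mono_continuous.
  rewrite /limit (expect_square nu (bm T.1) (bm T.2)).
  by rewrite !(expect_coinduction_mono cphi phi01 _ coind) big_cat/= !big_map.
have b01 q : 0 <= b q <= 1.
  apply: expect_unit_itv; first exact: mono_continuous.
  by move=> y; exact: mono01.
have a01 q : 0 <= a q <= 1.
  have bp : bounded_measurable ((fun y => mono phi q (pullback v y)) : borel {ptws vertices (sigma n) -> X} -> R).
    apply: (continuous_bounded_measurable (@compact_ptws R _ X)) => y.
    by apply: continuous_comp; [exact: continuous_pullback|exact: mono_continuous].
  rewrite /a; apply/andP; split.
    by apply: Rintegral_ge0 => y _; case/andP: (mono01 phi01 q (pullback v y)).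
  rewrite -(expect_cst (fin_law (p n) (x n)) 1); apply: expect_le => //.
    exact: bounded_measurable_cst.
  by move=> y; case/andP: (mono01 phi01 q (pullback v y)).
rewrite pE lE; apply: le_lt_trans (dist_prod_le Q a01 b01) _.
apply: (@le_lt_trans _ _ (\sum_(q <- Q) e1)).
  rewrite big_seq [leRHS]big_seq; apply: ler_sum => q qQ.
  by have := good q qQ; rewrite -ltNge => /ltW.
rewrite big_const_seq count_predT iter_addr_0 -mulr_natr /e1 -mulrA gtr_pMr//.
by rewrite mulrC ltr_pdivrMr// mul1r ltr_nat.
Qed.

Lemma product_lwstar_square :
  lwstar_cvg (sigma := fun n => s n)
    (fun n => square (product_law (tau n) (p n) (x n))) (square nu).
Proof.
apply: (lwstar_of_tests (@compact_zip R (G * H)%type X) (@pair_mono_continuous _ _ _ cphi _)).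
  exact: (pair_mono_dense dense).
move=> T e e0; have := vanishing_pair_error T e0 e0.
apply: filterS => n; apply: le_trans; apply: le_frac => vw.
by rewrite expect_pair_site.
Qed.

Lemma vanishing_variance (T : tests * tests) :
  vanishing (fun n => \int[square (product_law (tau n) (p n) (x n))]_z
    ((\int[empirical z]_y pair_mono phi T y - limit T) ^+ 2)).
Proof.
pose err n (vw : vertices (s n)) := `|pair_site (p n) (x n) phi T vw - limit T|.
have l01 : 0 <= limit T <= 1.
  have bp : bounded_measurable (pair_mono phi T : borel {ptws (G * H)%type -> (X * X)%type} -> R).
    apply: (continuous_bounded_measurable (@compact_zip R _ X)).
    exact: pair_mono_continuous.
  apply/andP; split.
    by apply: Rintegral_ge0 => y _; case/andP: (pair_mono01 phi01 T y).
  rewrite -(expect_cst (square nu) 1); apply: expect_le => //.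
    exact: bounded_measurable_cst.
  by move=> y; case/andP: (pair_mono01 phi01 T y).
have err1 n vw : err n vw <= 1.
  have /andP[a0 a1] := pair_site01 (p n) (x n) phi01 T vw.
  by case/andP: l01 => l0 l1; rewrite /err ler_norml; apply/andP; split; lra.
have verr : vanishing (fun n => (\sum_vw err n vw) / #|vertices (s n)|%:R).
  move=> e e0; have e20 : 0 < e / 2 by rewrite divr_gt0.
  have := vanishing_pair_error T e20 e20; apply: filterS => n h.
  have N0 := vertices_gt0R (R := R) (s n).
  have le1 : (\sum_vw err n vw) / #|vertices (s n)|%:R <=
      (\sum_(vw : vertices (s n)) (e / 2 + (e / 2 <= err n vw)%R%:R : R)) / #|vertices (s n)|%:R.
    rewrite ler_wpM2r ?invr_ge0//; apply: ler_sum => vw _.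
    have [h1|/ltW h1] := leP (e / 2) (err n vw); last by rewrite addr0.
    by apply: le_trans (err1 n vw) _; rewrite lerDr ltW.
  apply: (le_trans le1).
  rewrite big_split/= mulrDl sumr_const -[X in X / _]mulr_natr mulfK; last first.
    by rewrite gt_eqF.
  by rewrite [leRHS](splitr e) lerD2l; apply: le_trans h; rewrite fracE.
pose D := (size (test_indices T) ^ 2)%:R : R.
have vW : vanishing (fun n => D * #|vertices (tau n)|%:R^-1).
  by apply: vanishingZ => //; exact: sofic_card.
apply: (vanishing_le (vanishingD vW verr)) => n.
apply: le_trans (variance_bound _ _ _ cphi phi01 _ _) _; rewrite lerD2l.
have N0 := vertices_gt0R (R := R) (s n).
set c := _ - limit T.
have cE : c = (\sum_(vw : vertices (s n)) (pair_site (p n) (x n) phi T vw - limit T)) / #|vertices (s n)|%:R.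
  rewrite sumrB mulrBl sumr_const -[X in _ - X / _]mulr_natr mulfK//.
  by rewrite gt_eqF.
have cle : `|c| <= (\sum_vw err n vw) / #|vertices (s n)|%:R.
  rewrite cE normrM [X in _ * X]ger0_norm ?invr_ge0// ler_wpM2r ?invr_ge0//.
  exact: ler_norm_sum.
have c1 : `|c| <= 1.
  apply: (le_trans cle); rewrite ler_pdivrMr// mul1r -[leRHS]mul1r mulr_natr -sumr_const.
  exact: ler_sum.
apply: le_trans cle; rewrite -(real_normK (num_real c)) expr2.
by rewrite ler_piMl.
Qed.

(** Local convergence holds because expectations of tests converge at most
    vertices; good models have probability close to 1 by Chebyshev, the empirical
    averages of the tests having vanishing variance. *)
Lemma product_lde_cvg :
  lde_cvg (sigma := fun n => s n) (fun n => product_law (tau n) (p n) (x n)) nu.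
Proof.
split; first exact: product_lwstar_square.
move=> U oU.
have cY := @compact_zip R (G * H)%type X.
have [r [e [e0 eU]]] := nbhs_wstar_dense cY (@pair_mono_continuous _ _ _ cphi _)
  (pair_mono_dense dense (I := (G * H)%type)) oU.
pose th n := square (product_law (tau n) (p n) (x n)).
have mU n : measurable (good_models (s n) U : set (borel {ptws vertices (s n) -> (X * X)%type})).
  by apply: measurable_good_models => //; exact: oU.1.
have fin n : th n (good_models (s n) U) \is a fin_num.
  exact: (fin_num_measure (th n) _ (mU n)).
have e2 : 0 <= e ^- 2 by rewrite invr_ge0 exprn_ge0// ltW.
have v := vanishing_sum (r := r) (fun T _ => vanishingZ e2 (vanishing_variance T)).
(* Off the good models some test deviates by at least e, so the constant 1 is
   below the indicator of the good models plus the scaled squared deviations. *)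
have low n : 1 <= fine (th n (good_models (s n) U)) + \sum_(T <- r)
    e ^- 2 * \int[th n]_z ((\int[empirical z]_y pair_mono phi T y - limit T) ^+ 2).
  have bT (T : tests * tests) : bounded_measurable ((fun z => (\int[empirical z]_y pair_mono phi T y - limit T) ^+ 2)
      : borel {ptws vertices (s n) -> (X * X)%type} -> R).
    apply: (continuous_bounded_measurable (@compact_zip R _ X)) => z.
    have cE : continuous (fun z : {ptws vertices (s n) -> (X * X)%type} =>
        \int[empirical z]_y pair_mono phi T y - limit T).
      move=> {}z; apply: continuousD'; last exact: cst_continuous.
      have ce : continuous ((fun m : Prob R {ptws (G * H)%type -> (X * X)%type} =>
          \int[m]_y pair_mono phi T y) \o (@empirical R _ _ (s n))).
        move=> {}z; apply: continuous_comp; first exact: empirical_continuous.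
        exact: (@wstar_eval_continuous _ _ (exist _ _ (@pair_mono_continuous _ _ _ cphi _ T))).
      exact: ce.
    by apply: continuousM'; exact: cE.
  have bTe T := bounded_measurableM (bounded_measurable_cst _ (e ^- 2)) (bT T).
  have bsum := bounded_measurable_sum r bTe.
  have bi : bounded_measurable (\1_(good_models (s n) U) : borel {ptws vertices (s n) -> (X * X)%type} -> R).
    by apply: indic_bounded_measurable; exact: mU.
  rewrite -(expect_indic (th n) (mU n)).
  under [X in _ <= _ + X]eq_bigr do rewrite -expectZ//.
  rewrite -expect_sum// -expectD//.
  rewrite -[X in X <= _](expect_cst (th n) 1); apply: expect_le.
  - exact: bounded_measurable_cst.
  - exact: bounded_measurableD.
  move=> z; have sum0 : 0 <= \sum_(T <- r) e ^- 2 * (\int[empirical z]_y pair_mono phi T y - limit T) ^+ 2.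
    by apply: sumr_ge0 => T _; rewrite mulr_ge0// sqr_ge0.
  have [gz|gz] := pselect (good_models (s n) U z).
    by rewrite indicE mem_set// lerDl.
  rewrite indicE memNset// add0r.
  have [T Tr Te] : exists2 T, T \in r & e <= `|\int[empirical z]_y pair_mono phi T y - limit T|.
    apply: contrapT => nT; apply: gz; apply: eU => T Tr.
    by rewrite ltNge; apply/negP => h; apply: nT; exists T.
  rewrite (big_rem T)//= -[leLHS]addr0; apply: lerD.
    rewrite mulrC ler_pdivlMr ?exprn_gt0// mul1r -[X in _ <= X](real_normK (num_real _)).
    by rewrite lerXn2r ?nnegrE// ltW.
  by apply: sumr_ge0 => T' _; rewrite mulr_ge0// sqr_ge0.
suff h : fine (th n (good_models (s n) U)) @[n --> \oo] --> (1 : R).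
  by apply/fine_cvgP; split => //; apply: nearW => n; exact: fin.
apply/cvg_to1 => [n|e' e'0].
  rewrite -lee_fin fineK; last exact: fin.
  exact: (probability_le1 (th n) (mU n)).
apply: filterS (v e' e'0) => n; apply: le_trans.
by rewrite lerBlDl; exact: low.
Qed.

End product_lde.

(** * Covering numbers of independent rows *)

Section covering_lower_bound.
Context {R : realType} {G H : countGroupType} {X : compactMetricType R}.
Variables (s : symMap G) (t : symMap H) (A : finType) (p : fdist R A).
Variable x : A -> {ptws vertices s -> X}.
Local Notation V := (vertices s).
Local Notation W := (vertices t).
Local Notation VW := (vertices (prod_map s t)).
Context {P : set (set X)} (l : labelling P).
Local Notation K := (labels l).
Local Notation N := ((#|V| * #|W|)%N).
Variables (g : X -> R) (L : R).
Hypothesis g0 : forall y, 0 <= g y.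
Hypothesis L0 : 0 <= L.
(* Points with distinct labels are far apart unless the weight of one is large. *)
Hypothesis gL : forall y y', l y != l y' -> 1 <= 2 * g y + L * mdist y y'.

Definition configuration_name (a : {ffun W -> A}) : {ffun W -> {ffun V -> 'I_K}} :=
  [ffun w => name l (x (a w))].

Definition mean_weight (a : {ffun W -> A}) : R :=
  (\sum_w \sum_v g (x (a w) v)) / N%:R.

Let N0 : (0 : R) < N%:R.
Proof. by rewrite natrM mulr_gt0 ?vertices_gt0R. Qed.

Lemma mean_dist_common_ball (c y y' : {ptws VW -> X}) (delta : R) :
  mean_ball c delta y -> mean_ball c delta y' -> mean_dist y y' < 2 * delta.
Proof.
rewrite /mean_ball/= => h h'.
apply: (@le_lt_trans _ _ (mean_dist c y + mean_dist c y')); last by rewrite mulr2n mulrDl !mul1r ltrD.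
rewrite /mean_dist -mulrDl -big_split/= ler_wpM2r ?invr_ge0// ler_sum// => vw _.
by rewrite (metric_sym (c vw)) metric_triangle.
Qed.

(** Two names differ at a site only if the points there are far apart or the first
    point is near the boundary of its cell. *)
Lemma hamming_le (a a' : {ffun W -> A}) :
  (hamming (configuration_name a) (configuration_name a'))%:R <=
  (2 * mean_weight a + L * mean_dist (configuration (t := t) x a) (configuration x a')) * N%:R.
Proof.
have -> : (2 * mean_weight a + L * mean_dist (configuration (t := t) x a) (configuration x a')) * N%:R =
    \sum_w \sum_v (2 * g (x (a w) v) + L * mdist (x (a w) v) (x (a' w) v)).
  have e1 : mean_weight a * N%:R = \sum_w \sum_v g (x (a w) v).
    by rewrite /mean_weight divfK// gt_eqF.
  have e2 : mean_dist (configuration (t := t) x a) (configuration x a') * N%:R =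
      \sum_w \sum_v mdist (x (a w) v) (x (a' w) v).
    rewrite /mean_dist card_prod divfK; last by rewrite gt_eqF.
    rewrite -(pair_bigA _ (fun v w => mdist (configuration (t := t) x a (v, w)) (configuration x a' (v, w))))/=.
    by rewrite exchange_big.
  rewrite mulrDl -(mulrA 2) -(mulrA L) e1 e2 !mulr_sumr -big_split/=; apply: eq_bigr => w _.
  by rewrite !mulr_sumr -big_split.
rewrite /hamming natr_sum; apply: ler_sum => w _.
rewrite natr_sum; apply: ler_sum => v _; rewrite !ffunE.
case: eqVneq => [_|h]; last exact: gL.
by rewrite addr_ge0 ?mulr_ge0// mdist_ge0.
Qed.

Lemma expect_mean_weight :
  \sum_a pow_fun p a * mean_weight a = (\sum_v \sum_b p b * g (x b v)) / #|V|%:R.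
Proof.
transitivity ((\sum_w \sum_(a : {ffun W -> A}) pow_fun p a * \sum_v g (x (a w) v)) / N%:R).
  rewrite exchange_big/= mulr_suml; apply: eq_bigr => a _.
  by rewrite /mean_weight mulrA mulr_sumr.
rewrite (eq_bigr (fun=> \sum_v \sum_b p b * g (x b v))); last first.
  move=> w _; rewrite (expect_coord p w (fun b => \sum_v g (x b v))).
  by rewrite exchange_big/=; apply: eq_bigr => b _; rewrite mulr_sumr.
rewrite sumr_const -(mulr_natr (\sum_v _)) natrM invfM mulrACA mulfV ?mulr1//.
by rewrite gt_eqF// vertices_gt0R.
Qed.

(** Typical configurations, those of small weight, that lie in one ball have names at
    small Hamming distance, so that [k] balls meet few of their names. Yet these
    names carry most of the mass of a law with the entropy of [#|W|] independent
    rows. *)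
Lemma entropy_le_covering (eps delta kappa1 kappa lam : R) (k : nat)
    (c : 'I_k -> {ptws VW -> X}) :
  0 < eps < 2^-1 -> 0 < kappa1 -> 0 <= lam -> 2 * kappa1 + 2 * L * delta <= kappa ->
  (\sum_v \sum_b p b * g (x b v)) / #|V|%:R <= kappa1 * eps ->
  ((1 - eps)%:E < product_law t p x (\bigcup_i mean_ball (c i) delta))%E ->
  (0 < k)%N /\
  #|W|%:R * entropy (fdist_image p (fun b => name l (x b))) <=
    ln 2 + ln k%:R + N%:R * (lam * kappa + K%:R * expR (- lam)) + 2 * eps * (N%:R * ln K%:R).
Proof.
move=> /andP[eps0 eps12] kappa10 lam0 kappaE gsmall.
have -> : product_law t p x (\bigcup_i mean_ball (c i) delta) =
    (\sum_(a | configuration (t := t) x a \in \bigcup_i mean_ball (c i) delta) pow_fun p a)%:E.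
  exact: fin_lawE.
rewrite lte_fin => cover.
pose covered (a : {ffun W -> A}) := configuration (t := t) x a \in \bigcup_i mean_ball (c i) delta.
pose typical (a : {ffun W -> A}) := mean_weight a < kappa1.
pose good a := covered a && typical a.
pose S := [set configuration_name a | a in good]%SET.
pose Q := fdist_image p (fun b => name l (x b)).
have mw0 a : 0 <= mean_weight a by rewrite divr_ge0// sumr_ge0// => w _; rewrite sumr_ge0.
(* By Markov, since the mean weight is at most [kappa1 * eps]. *)
have atyp : \sum_(a | ~~ typical a) pow_fun p a <= eps.
  rewrite (eq_bigl (fun a => kappa1 <= mean_weight a)); last by move=> a; rewrite -leNgt.
  apply: (le_trans (markov_fdist (fdist_pow W p) kappa10 mw0)) => /=.
  by rewrite ler_pdivrMr// expect_mean_weight [leRHS]mulrC.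
have uncov : \sum_(a | ~~ covered a) pow_fun p a <= eps.
  have := pow_fun_sum1 W p; rewrite (bigID covered)/= => e1.
  by move: cover e1; rewrite /covered => h1 h2; lra.
have bad : \sum_(a | ~~ good a) pow_fun p a <= 2 * eps.
  apply: (@le_trans _ _ (\sum_(a | ~~ covered a) pow_fun p a + \sum_(a | ~~ typical a) pow_fun p a)); last by lra.
  rewrite big_mkcond [X in _ <= X + _]big_mkcond [X in _ <= _ + X]big_mkcond -big_split/=.
  apply: ler_sum => a _; rewrite /good; have := pow_fun_ge0 p a.
  by case: (covered a); case: (typical a) => /= h; rewrite ?addr0 ?add0r// lerDl.
have [a0 ga0] : exists a, good a.
  apply: contrapT => /forallNP ng.
  have := pow_fun_sum1 W p; rewrite (eq_bigl (fun a => ~~ good a)); last first.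
    by move=> a; apply/esym/negP; exact: ng.
  by lra.
have k0 : (0 < k)%N.
  by have /andP[/set_mem[i _ _] _] := ga0; exact: leq_ltn_trans (ltn_ord i).
split => //.
have S0 : (0 < #|S|)%N by apply/card_gt0P; exists (configuration_name a0); exact: imset_f.
have K0 : (0 < K)%N.
  have [v _] := card_gt0P (vertices_gt0 s); have [w _] := card_gt0P (vertices_gt0 t).
  exact: leq_ltn_trans (ltn_ord (configuration_name a0 w v)).
have cardS : #|S|%:R <= k%:R * expR (N%:R * (lam * kappa + K%:R * expR (- lam))) :> R.
  pose Si i := [set configuration_name a | a in [pred a | good a & `[< mean_ball (c i) delta (configuration (t := t) x a) >]]]%SET.
  have SSi : S \subset (\bigcup_i Si i)%SET.
    apply/fintype.subsetP => n /imsetP[a ga ->]; have /andP[/set_mem[i _ ia] _] := ga.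
    apply/finset.bigcupP; exists i => //; apply/imsetP; exists a => //.
    by rewrite inE; apply/andP; split => //; exact/asboolP.
  have Sicard i : #|Si i|%:R <= expR (N%:R * (lam * kappa + K%:R * expR (- lam))) :> R.
    have [->|[n /imsetP[a]]] := set_0Vmem (Si i); first by rewrite cards0 expR_ge0.
    rewrite inE => /andP[ga /asboolP ia] _.
    apply: le_trans (card_hamming_ball (configuration_name a) kappa lam0).
    rewrite ler_nat; apply: subset_leq_card; apply/fintype.subsetP => _ /imsetP[a' + ->].
    rewrite inE => /andP[ga' /asboolP ia'].
    apply: (le_trans (hamming_le a' a)); rewrite ler_wpM2r//.
    have /andP[_ ty] := ga'; have := mean_dist_common_ball ia' ia.
    move/ltW/(ler_wpM2l L0); rewrite /typical in ty; lra.
  apply: (@le_trans _ _ (\sum_i #|Si i|%:R)).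
    rewrite -natr_sum ler_nat (leq_trans (subset_leq_card SSi))//.
    elim/big_ind2 : _ => [|? ? ? ? h1 h2|//]; first by rewrite cards0.
    by apply: leq_trans (leq_card_setU _ _).1 _; exact: leq_add.
  by rewrite mulr_natl -[X in _ *+ X]card_ord -sumr_const; apply: ler_sum.
rewrite -(entropy_pow W).
apply: (le_trans (entropy_le_set _ S0)).
have outS : \sum_(n | n \notin S) fdist_pow W Q n <= 2 * eps.
  rewrite big_mkcond/= (eq_bigr (fun n => pow_fun Q n * (n \notin S)%:R)); last first.
    by move=> n _; case: ifP => _; rewrite ?mulr1 ?mulr0.
  rewrite expect_pow_image; apply: le_trans bad.
  rewrite [leRHS]big_mkcond/=; apply: ler_sum => a _.
  have [ga|_] := boolP (good a).
    by rewrite (_ : _ \notin S = false) ?mulr0//; apply/negbTE; rewrite negbK; exact: imset_f.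
  by rewrite ler_piMr ?pow_fun_ge0// lern1 leq_b1.
have lnS : ln #|S|%:R <= ln k%:R + N%:R * (lam * kappa + K%:R * expR (- lam)).
  rewrite -[X in _ <= _ + X]expRK -lnM ?posrE ?ltr0n ?expR_gt0// ler_ln ?posrE ?ltr0n//.
  by rewrite mulr_gt0 ?ltr0n ?expR_gt0.
have cardN : ln #|{ffun W -> {ffun V -> 'I_K}}|%:R = N%:R * ln K%:R :> R.
  by rewrite !card_ffun card_ord -expnM natrX lnXn ?ltr0n// mulr_natl.
have lnK0 : 0 <= N%:R * ln K%:R :> R by rewrite mulr_ge0 ?ln_ge0 ?ler1n// ltW.
rewrite cardN; apply: lerD; first by rewrite -addrA lerD2l.
by rewrite ler_wpM2r.
Qed.

End covering_lower_bound.

(** * Continuous weights near the boundary of a partition *)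

Section cell_depth.
Context {R : realType} {X : compactMetricType R} {P : set (set X)} (l : labelling P).

Let escape (x : X) : set R := [set 1] `|` [set mdist x y | y in [set y | l y != l x]].

(** Distance to the other cells, truncated at 1. *)
Definition cell_depth (x : X) : R := inf (escape x).

Let escape_lb x : lbound (escape x) 0.
Proof. by move=> _ [->|[y _ <-]]; [exact: ler01|exact: mdist_ge0]. Qed.

Lemma cell_depth_ge0 x : 0 <= cell_depth x.
Proof. by apply: lb_le_inf; [exists 1; left|exact: escape_lb]. Qed.

Lemma cell_depth_le1 x : cell_depth x <= 1.
Proof. by apply: ge_inf; [exists 0; exact: escape_lb|left]. Qed.

Lemma cell_depth_le x y : l y != l x -> cell_depth x <= mdist x y.
Proof. by move=> xy; apply: ge_inf; [exists 0; exact: escape_lb|right; exists y]. Qed.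

Lemma cell_depth_lipschitz x y : cell_depth x <= cell_depth y + mdist x y.
Proof.
have [lxy|lxy] := eqVneq (l y) (l x); last first.
  by apply: (le_trans (cell_depth_le lxy)); rewrite lerDr cell_depth_ge0.
rewrite -lerBlDr; apply: lb_le_inf; first by exists 1; left.
move=> _ [->|[z /= lz <-]]; first by rewrite lerBlDr (le_trans (cell_depth_le1 x))// lerDl mdist_ge0.
rewrite lxy in lz; rewrite lerBlDr addrC.
by apply: (le_trans (cell_depth_le lz)); exact: metric_triangle.
Qed.

Lemma cell_depth0 x : cell_depth x = 0 -> boundary [set y | l y = l x] x.
Proof.
move=> d0; split; first exact: subset_closure.
move=> /metricType_numDomainType.nbhs_mdistP [r /= r0 rC].
have : Num.min r 1 <= cell_depth x.
  apply: lb_le_inf; first by exists 1; left.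
  move=> _ [->|[y /= ly <-]]; first by rewrite ge_min lexx orbT.
  rewrite ge_min leNgt; apply/orP; left; apply/negP => /rC /= e.
  by rewrite e eqxx in ly.
by rewrite d0 leNgt lt_min r0 ltr01.
Qed.

(** A continuous majorant of the indicator of the points of depth 0 that vanishes at
    depth [1 / n.+1]. *)
Definition boundary_weight (n : nat) (x : X) : R := Num.max 0 (1 - n.+1%:R * cell_depth x).

Lemma boundary_weight_continuous n : continuous (boundary_weight n).
Proof.
have cd : continuous cell_depth by apply: lipschitz1_continuous; exact: cell_depth_lipschitz.
move=> x; apply: (@continuous_max R X (fun=> 0) (fun x => 1 - n.+1%:R * cell_depth x)).
  exact: cst_continuous.
apply: cvgB; first exact: cvg_cst.
by apply: cvgM; [exact: cvg_cst|exact: cd].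
Qed.

Lemma boundary_weight01 n x : 0 <= boundary_weight n x <= 1.
Proof.
rewrite /boundary_weight le_max lexx/= ge_max ler01/= gerBl.
by rewrite mulr_ge0// cell_depth_ge0.
Qed.

Lemma boundary_weightP n y y' : l y != l y' ->
  1 <= 2 * boundary_weight n y + (2 * n.+1%:R) * mdist y y'.
Proof.
rewrite eq_sym => /cell_depth_le h.
have h2 : 1 - n.+1%:R * cell_depth y <= boundary_weight n y by rewrite /boundary_weight le_max lexx orbT.
have : n.+1%:R * cell_depth y <= n.+1%:R * mdist y y' by rewrite ler_wpM2l.
rewrite -mulrA; set a := n.+1%:R * _ in h2 *; set b := n.+1%:R * mdist _ _; lra.
Qed.

(** The weights live on sets that decrease to the points of depth 0, and these are
    boundary points of their cells. *)
Lemma boundary_weight_small (G : countGroupType) (mu : Prob R {ptws G -> X}) (eta : R) :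
  (forall C, P C -> mu [set x | boundary C (x 1%g)] = 0%E) -> 0 < eta ->
  exists n, \int[mu]_y boundary_weight n (y 1%g) < eta.
Proof.
move=> nullP eta0.
have cd : continuous (fun y : {ptws G -> X} => cell_depth (y 1%g)).
  move=> y; apply: (@continuous_comp _ _ _ (fun y : {ptws G -> X} => y 1%g) cell_depth).
    exact: continuous_coord.
  by apply: lipschitz1_continuous; exact: cell_depth_lipschitz.
pose F n : set (borel {ptws G -> X}) := [set y | cell_depth (y 1%g) < n.+1%:R^-1].
have mF n : measurable (F n).
  apply: sub_sigma_algebra; rewrite (_ : F n = (fun y : {ptws G -> X} => cell_depth (y 1%g)) @^-1` [set r | r < n.+1%:R^-1])//.
  by apply: open_comp; [move=> y _; exact: cd|exact: open_lt].
have mcapF : measurable (\bigcap_n F n) by exact: bigcapT_measurable.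
have mB j : measurable ([set y | boundary [set z | l z = j] (y 1%g)] : set (borel {ptws G -> X})).
  rewrite -[X in measurable X]setTI.
  apply: (@continuous_borel {ptws G -> X} X (fun y => y 1%g)) => //.
    exact: continuous_coord.
  rewrite /boundary; apply: measurableD; last first.
    by apply: sub_sigma_algebra; exact: open_interior.
  rewrite -[closure _]setCK; apply: measurableC; apply: sub_sigma_algebra.
  exact: closed_openC (@closed_closure _ _).
have null : mu (\bigcap_n F n) = 0%E.
  have fin : mu (\bigcap_n F n) \is a fin_num by exact: fin_num_measure.
  rewrite -(fineK fin) -expect_indic//; congr (_%:E); apply/eqP; rewrite eq_le.
  apply/andP; split; last by apply: Rintegral_ge0 => y _; rewrite indicE.
  pose f y : R := \sum_(j < labels l) \1_[set y : {ptws G -> X} | boundary [set z | l z = j] (y 1%g)] y.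
  have b1 j : bounded_measurable (\1_[set y : {ptws G -> X} | boundary [set z | l z = j] (y 1%g)]
      : borel {ptws G -> X} -> R).
    by apply: indic_bounded_measurable; exact: mB.
  have -> : 0 = \int[mu]_y f y.
    rewrite /f expect_sum// big1// => j _; rewrite expect_indic; last exact: mB.
    by rewrite (nullP [set z | l z = j])//; apply/(labellingP l); exists j.
  apply: expect_le; [exact: indic_bounded_measurable|exact: bounded_measurable_sum|].
  move=> y; have f0 : 0 <= f y by apply: sumr_ge0 => j _; rewrite indicE.
  have [yF|yF] := pselect ((\bigcap_n F n) y); last by rewrite indicE memNset.
  have d0 : cell_depth (y 1%g) = 0.
    apply/eqP; rewrite eq_le cell_depth_ge0 andbT; apply/ler_addgt0Pr => e e0; rewrite add0r.
    have := yF (Num.truncn e^-1) I; rewrite /F/= => /ltW/le_trans; apply.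
    rewrite -[leRHS]invrK lef_pV2 ?posrE ?invr_gt0//.
    by rewrite ltW// truncnS_gt.
  rewrite [leLHS]indicE mem_set// /f (bigD1 (l (y 1%g)))//= indicE mem_set; last exact: cell_depth0.
  by rewrite lerDl sumr_ge0// => j _; rewrite indicE.
have : mu (F n) @[n --> \oo] --> mu (\bigcap_n F n).
  apply: nonincreasing_cvg_mu => //.
    by apply: le_lt_trans (probability_le1 mu (mF 0%N)) _; exact: ltry.
  move=> m n mn; apply/subsetPset => y; rewrite /F/= => /lt_le_trans; apply.
  by rewrite lef_pV2 ?posrE// ler_nat ltnS.
rewrite null => /(_ [set e | (e < eta%:E)%E]) [].
  by apply: open_nbhs_nbhs; split; [exact: open_ereal_lt_ereal|rewrite /= lte_fin].
move=> n _ /(_ n (leqnn n)) /= Fn; exists n.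
have bw : bounded_measurable ((fun y => boundary_weight n (y 1%g)) : borel {ptws G -> X} -> R).
  apply: (continuous_bounded_measurable (@compact_ptws R G X)) => y.
  apply: (@continuous_comp _ _ _ (fun y : {ptws G -> X} => y 1%g) (boundary_weight n)).
    exact: continuous_coord.
  exact: boundary_weight_continuous.
apply: (@le_lt_trans _ _ (fine (mu (F n)))); last first.
  by rewrite -lte_fin fineK// fin_num_measure.
rewrite -expect_indic//; apply: expect_le => //; first exact: indic_bounded_measurable.
move=> y; have /andP[w0 w1] := boundary_weight01 n (y 1%g).
have [yF|yF] := pselect (F n y); first by rewrite indicE mem_set.
rewrite indicE memNset// /boundary_weight ge_max lexx/= subr_le0.
move: yF => /negP; rewrite /F/= -leNgt => h.
by rewrite -ler_pdivrMl// mulr1.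
Qed.

End cell_depth.

(** * Partition entropy is at most model-measure entropy *)

(** The identity element of [G] acts on the vertices by some permutation, possibly
    not the trivial one, which does not change the average over the vertices. *)
Lemma lwstar_average_le (R : realType) (G : countGroupType) (X : compactMetricType R)
    (sigma : nat -> symMap G) (A : nat -> finType) (p : forall n, fdist R (A n))
    (x : forall n, A n -> {ptws vertices (sigma n) -> X}) (mu : Prob R {ptws G -> X})
    (g : X -> R) (eta : R) :
  continuous g -> (forall y, 0 <= g y <= 1) ->
  lwstar_cvg (fun n => fin_law (p n) (x n) : Prob R {ptws vertices (sigma n) -> X}) mu ->
  \int[mu]_y g (y 1%g) < eta ->
  \forall n \near \oo,
    (\sum_v \sum_a p n a * g (x n a v)) / #|vertices (sigma n)|%:R <= eta.
Proof.
move=> cg g01 lw small.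
have cf : continuous (fun y : {ptws G -> X} => g (y 1%g)).
  move=> y; apply: (@continuous_comp _ _ _ (fun y : {ptws G -> X} => y 1%g) g).
    exact: continuous_coord.
  exact: cg.
set I := \int[mu]_y g (y 1%g) in small.
pose e := (eta - I) / 2.
have e0 : 0 < e by rewrite divr_gt0// subr_gt0.
have I0 : 0 <= I by apply: Rintegral_ge0 => // y _; have /andP[] := g01 (y 1%g).
have := lwstar_tests (@compact_ptws R G X) cf lw e0; apply: filterS => n.
rewrite -/I => h.
have N0 := vertices_gt0R (R := R) (sigma n).
pose E v := \sum_a p n a * g (x n a (sigma n 1%g v)).
have EE v : \int[fin_law (p n) (x n)]_y g (pullback v y 1%g) = E v.
  rewrite (expect_fin_law (p n) (x n) (f := fun y => g (pullback v y 1%g)))//.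
  apply: (continuous_bounded_measurable (@compact_ptws R _ X)) => y.
  apply: (@continuous_comp _ _ _ (fun y : {ptws vertices (sigma n) -> X} => pullback v y)
    (fun y : {ptws G -> X} => g (y 1%g))); [exact: continuous_pullback|exact: cf].
have E1 v : E v <= 1.
  rewrite -(fdist_sum1 (p n)); apply: ler_sum => a _.
  by rewrite ler_piMr ?fdist_ge0//; have /andP[] := g01 (x n a (sigma n 1%g v)).
rewrite (reindex_inj (@perm_inj _ (sigma n 1%g))) -/E.
have step v : E v <= (I + e) + (e <= `|E v - I|)%R%:R :> R.
  have [_|] := leP e `|E v - I|; first by rewrite mulr1n; have := E1 v; lra.
  by rewrite ltr_norml mulr0n => /andP[_]; lra.
apply: (@le_trans _ _ (I + e + frac R (fun v => e <= `|E v - I|))); last first.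
  have : frac R (fun v => e <= `|E v - I|) <= e.
    by apply: le_trans h; apply: le_frac => v /=; rewrite EE.
  by rewrite /e; lra.
rewrite fracE -[X in X + _](mulfK (lt0r_neq0 N0)) -mulrDl ler_wpM2r ?invr_ge0 ?ler0n//.
have -> : (I + e) * #|vertices (sigma n)|%:R = \sum_(v : vertices (sigma n)) (I + e).
  by rewrite sumr_const mulr_natr.
rewrite -big_split/=.
by apply: ler_sum => v _; exact: step.
Qed.

Lemma covering_constants (R : realType) (K : nat) (theta : R) : 0 < theta ->
  exists eps lam kappa : R, [/\ 0 < eps < 2^-1, 0 <= lam, 0 < kappa,
    2 * eps * ln K%:R <= theta & lam * kappa + K%:R * expR (- lam) <= theta].
Proof.
move=> theta0.
have lnK : 0 <= ln K%:R :> R.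
  by case: K => [|K]; [rewrite ln0|apply: ln_ge0; rewrite ler1n].
have K0 : 0 <= K%:R :> R by [].
(* Large enough for [K / (1 + lam) <= theta / 2]. *)
pose lam := 2 * K%:R / theta.
have lam0 : 0 <= lam by rewrite divr_ge0 ?mulr_ge0// ltW.
have a0 : 0 < 4 * (theta + ln K%:R + 1) by lra.
have b0 : 0 < 2 * (lam + 1) by lra.
exists (theta / (4 * (theta + ln K%:R + 1))), lam, (theta / (2 * (lam + 1))); split => //.
- by rewrite divr_gt0//= ltr_pdivrMr//; lra.
- by rewrite divr_gt0.
- set D := 4 * _ in a0 *.
  have -> : 2 * (theta / D) * ln K%:R = theta * (2 * ln K%:R) / D by ring.
  by rewrite ler_pdivrMr// ler_wpM2l ?(ltW theta0)// /D; lra.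
rewrite [leRHS]splitr; apply: lerD.
  have -> : theta / 2 = theta * (lam + 1) / (2 * (lam + 1)) by field; lra.
  by rewrite mulrCA mulrA ler_wpM2r ?invr_ge0 ?(ltW b0)// ler_wpM2l ?(ltW theta0)//; lra.
rewrite expRN ler_pdivrMr ?expR_gt0//.
have := expR_ge1Dx lam; have -> : K%:R = theta / 2 * lam :> R.
  by rewrite /lam mulrCA mulrA; field; rewrite gt_eqF.
nra.
Qed.

Lemma lne_mcov_ge (R : realType) (X : compactMetricType R) (V : finType)
    (m : Prob R {ptws V -> X}) (eps delta a : R) :
  (forall (k : nat) (c : 'I_k -> {ptws V -> X}),
     ((1 - eps)%:E < m (\bigcup_i mean_ball (c i) delta))%E ->
     (0 < k)%N /\ a <= ln k%:R) ->
  (a%:E <= lne (mcov eps delta m))%E.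
Proof.
move=> h; have : ((expR a)%:E <= mcov eps delta m)%E.
  apply: le_ereal_inf_tmp => _ [k [c ck] <-].
  have [k0 ak] := h k c ck.
  by rewrite lee_fin -(@lnK R k%:R) ?posrE ?ltr0n// ler_expR.
move=> le; rewrite -(expRK a) -lne_EFin ?expR_gt0// lee_lne//.
  by rewrite in_itv/= leey lee_fin expR_ge0.
by rewrite in_itv/= leey mcov_ge0.
Qed.

(** The error terms of the covering estimate, namely the factor 2 in the mixture,
    the names in one ball and the atypical configurations, cost at most [theta]
    per vertex each. *)
Lemma mcov_product_ge (R : realType) (G H : countGroupType) (X : compactMetricType R)
    (s : symMap G) (t : symMap H) (A : finType) (p : fdist R A)
    (x : A -> {ptws vertices s -> X}) (P : set (set X)) (l : labelling P)
    (g : X -> R) (L eps delta kappa1 kappa lam theta c : R) :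
  (forall y, 0 <= g y) -> 0 <= L ->
  (forall y y', l y != l y' -> 1 <= 2 * g y + L * mdist y y') ->
  0 < eps < 2^-1 -> 0 < kappa1 -> 0 <= lam -> 2 * kappa1 + 2 * L * delta <= kappa ->
  2 * eps * ln (labels l)%:R <= theta -> lam * kappa + (labels l)%:R * expR (- lam) <= theta ->
  (\sum_v \sum_b p b * g (x b v)) / #|vertices s|%:R <= kappa1 * eps ->
  #|vertices t|%:R^-1 <= theta ->
  c + 3 * theta <= #|vertices s|%:R^-1 * entropy (fdist_image p (fun b => name l (x b))) ->
  (c%:E <= (#|vertices (prod_map s t)|%:R^-1)%:E *
    lne (mcov eps delta (product_law t p x)))%E.
Proof.
move=> g0 L0 gL eps01 kappa10 lam0 kappaE epsK lamK gsmall tsmall cE.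
set h := entropy _ in cE.
have V0 := vertices_gt0R (R := R) s; have W0 := vertices_gt0R (R := R) t.
have cardN : #|vertices (prod_map s t)|%:R = #|vertices s|%:R * #|vertices t|%:R :> R.
  by rewrite card_prod natrM.
have N0 : 0 < #|vertices s|%:R * #|vertices t|%:R :> R by rewrite mulr_gt0.
rewrite cardN; set N := _ * _ in N0 *.
suff low : ((N * c)%:E <= lne (mcov eps delta (product_law t p x)))%E.
  apply: (@le_trans _ _ ((N^-1)%:E * (N * c)%:E)%E).
    by rewrite -EFinM mulKf// gt_eqF.
  by apply: lee_wpmul2l => //; rewrite lee_fin invr_ge0 ltW.
apply: lne_mcov_ge => k b cover.
have [k0 hk] := entropy_le_covering g0 L0 gL eps01 kappa10 lam0 kappaE gsmall cover.
split=> //; move: hk; rewrite natrM -/N -/h => hk.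
have h1 : N * (c + 3 * theta) <= #|vertices t|%:R * h.
  have -> : #|vertices t|%:R * h = N * (#|vertices s|%:R^-1 * h).
    by rewrite /N; field; rewrite gt_eqF.
  by rewrite ler_wpM2l// ltW.
have h2 : N * (lam * kappa + (labels l)%:R * expR (- lam)) <= N * theta by rewrite ler_wpM2l// ltW.
have h3 : 2 * eps * (N * ln (labels l)%:R) <= N * theta.
  by rewrite mulrCA ler_wpM2l// ltW.
have h4 : ln 2 <= N * theta.
  have ln2 : ln 2 <= 1 :> R by have := @le_ln1Dx R 1; rewrite -[1 + 1]/2; apply; lra.
  apply: (le_trans ln2); have : 1 <= theta * #|vertices t|%:R.
    by rewrite -ler_pdivrMr// div1r.
  have V1 : 1 <= #|vertices s|%:R :> R by rewrite ler1n; exact: vertices_gt0.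
  move=> h4; apply: (le_trans h4).
  have -> : N * theta = #|vertices s|%:R * (theta * #|vertices t|%:R) by rewrite /N; ring.
  by apply: ler_peMl => //; exact: le_trans ler01 h4.
rewrite mulrDr in h1; lra.
Qed.

(** Given laws on the vertex sets of [sigma] that converge locally to [mu], made
    finitely supported, independent copies of them on the rows of the product
    vertex sets LDE-converge to [nu]. Their covering numbers have at least the
    exponential growth given by the entropy of the names. *)
Lemma partition_le_model_measure (R : realType) (G H : countGroupType)
    (sigma : nat -> symMap G) (tau : nat -> symMap H) (X : compactMetricType R)
    (mu : Prob R {ptws G -> X}) (nu : Prob R {ptws (G * H)%type -> X})
    (PP : set (set (set X))) :
  sofic_approximation R tau -> is_coinduction mu nu ->
  (forall P, PP P -> finite_borel_partition P) ->
  (forall delta : R, 0 < delta ->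
     exists2 P, PP P & forall C, P C -> (diameter C < delta%:E)%E) ->
  (forall P, PP P -> forall C, P C -> mu [set x | boundary C (x 1%g)] = 0%E) ->
  infinite_set [set: H] ->
  (partition_entropy sigma mu PP <=
    model_measure_entropy (fun n => prod_map (sigma n) (tau n)) nu)%E.
Proof.
move=> sofic coind fbP small nullP infH.
apply: lee_of_real => c /ereal_sup_gt[_ [P [n_ [mu_ [PPP n_mono lw ->]]]]] /real_between[c' cc' c'lt].
have [l] := finite_borel_partition_labelling (fbP P PPP).
have [A [p [x [lwx shx]]]] := lwstar_discretize fbP small PPP lw.
pose theta := (c' - c) / 3; have theta0 : 0 < theta by rewrite divr_gt0// subr_gt0.
have [eps [lam [kappa [eps01 lam0 kappa0 epsK lamK]]]] := covering_constants (labels l) theta0.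
have /andP[eps0 _] := eps01.
pose kappa1 := kappa / 4; have kappa10 : 0 < kappa1 by rewrite divr_gt0.
have eta0 : 0 < kappa1 * eps by rewrite mulr_gt0.
have [n gsmall] := boundary_weight_small l (nullP P PPP) eta0.
have g01 y : 0 <= boundary_weight l n y <= 1 by exact: boundary_weight01.
pose L : R := 2 * n.+1%:R; have L0 : 0 < L by rewrite mulr_gt0.
pose delta := kappa / (4 * L); have delta0 : 0 < delta by rewrite divr_gt0// mulr_gt0.
have kappaE : 2 * kappa1 + 2 * L * delta <= kappa.
  have -> : 2 * L * delta = kappa / 2 by rewrite /delta; field; rewrite gt_eqF.
  by rewrite /kappa1; lra.
have sofic_ := sofic_subsequence sofic n_mono.
have [phi [cphi phi01 dense]] := mono_dense X.
have lde := product_lde_cvg sofic_ coind infH lwx cphi phi01 dense.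
have avg := lwstar_average_le (@boundary_weight_continuous _ _ _ l n) g01 lwx gsmall.
have [i0 _ hi0] := filterI avg (sofic_card sofic_ infH theta0).
apply: (@le_trans _ _ (limn_esup (fun i =>
    (#|vertices (prod_map (sigma (n_ i)) (tau (n_ i)))|%:R^-1)%:E *
    lne (mcov eps delta (product_law (tau (n_ i)) (p i) (x i))))%E)); last first.
  apply: le_trans (ereal_sup_ubound _); last first.
    by exists n_, (fun i => product_law (tau (n_ i)) (p i) (x i)); split; [exact: n_mono|exact: lde|].
  by apply: ereal_sup_ubound; exists eps => //; exists delta.
apply: limn_esup_ge => m.
have [i im ci] := frequently_gt_limn_esup (maxn m i0) c'lt.
exists i; first by rewrite (leq_trans _ im)// leq_maxl.
have [avgi cardi] := hi0 i (leq_trans (leq_maxr m i0) im).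
apply: (mcov_product_ge (g := boundary_weight l n) (L := L) (theta := theta) _ _ _ eps01 kappa10 lam0 kappaE epsK lamK avgi cardi).
- by move=> y; have /andP[] := g01 y.
- exact: ltW.
- exact: boundary_weightP.
move: ci; rewrite -shx -EFinM lte_fin (shannon_fin_law l) => /ltW; apply: le_trans.
by rewrite /theta; lra.
Qed.

Theorem mainTheorem5 (R : realType) (G H : countGroupType)
    (sigma : nat -> symMap G) (tau : nat -> symMap H)
    (X : compactMetricType R)
    (mu : Prob R {ptws G -> X}) (nu : Prob R {ptws (G * H)%type -> X})
    (PP : set (set (set X))) :
  sofic_approximation R sigma ->
  sofic_approximation R tau ->
  shift_invariant mu ->
  is_coinduction mu nu ->
  (forall P, PP P -> finite_borel_partition P) ->
  (forall delta : R, 0 < delta ->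
     exists2 P, PP P & forall C, P C -> (diameter C < delta%:E)%E) ->
  (forall P, PP P -> forall C, P C ->
     mu [set x | boundary C (x 1%g)] = 0%E) ->
  infinite_set [set: H] ->
  sofic_entropy (fun n => prod_map (sigma n) (tau n)) nu =
    model_measure_entropy (fun n => prod_map (sigma n) (tau n)) nu /\
  model_measure_entropy (fun n => prod_map (sigma n) (tau n)) nu =
    partition_entropy sigma mu PP.
Proof.
move=> _ sofic _ coind fbP small nullP infH.
have up := sofic_le_partition sigma tau coind fbP small infH.
have low := partition_le_model_measure sigma sofic coind fbP small nullP infH.
have mid := model_measure_le_sofic (fun n => prod_map (sigma n) (tau n)) nu.
split; apply/eqP; rewrite eq_le.
  by rewrite mid (le_trans up low).
by rewrite low (le_trans mid up).
Qed.
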